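(* For every $L>0$ there exists a constant $C(L)$, depending only on $L$, such that for all sufficiently small $h>0$ (with threshold depending only on $L$) and for every nonzero $\boldsymbol{\phi}\in V_h^1\cup V_h^2$, $$\frac{\|(\nabla\boldsymbol{\phi})_{r\theta}\|^2}{\|e(\boldsymbol{\phi})\|^2}\le\frac{C(L)}{h\sqrt h},\qquad \frac{\|\phi_{\theta,z}\|^2}{\|e(\boldsymbol{\phi})\|^2}\le\frac{C(L)}{\sqrt h},\qquad \frac{\|\phi_{r,z}\|^2}{\|e(\boldsymbol{\phi})\|^2}\le\frac{C(L)}{h}.$$
   Context: For $h\in(0,1)$ and $L>0$ the circular cylindrical shell is, in cylindrical coordinates $(r,\theta,z)$, $$\mathcal{C}_h=\{(r,\theta,z): r\in I_h,\ \theta\in\mathbb{T},\ z\in[0,L]\},\qquad I_h=\Big[1-\frac h2,1+\frac h2\Big],$$ where $\mathbb{T}$ is the circle ($2\pi$-periodicity in $\theta$). Vector fields are written $\boldsymbol{\phi}=\phi_r\boldsymbol{e}_r+\phi_\theta\boldsymbol{e}_\theta+\phi_z\boldsymbol{e}_z$ and, in cylindrical coordinates (a subscript after a comma denotes a partial derivative), $$\nabla\boldsymbol{\phi}=\begin{bmatrix}\phi_{r,r}&\frac{\phi_{r,\theta}-\phi_\theta}{r}&\phi_{r,z}\\ \phi_{\theta,r}&\frac{\phi_{\theta,\theta}+\phi_r}{r}&\phi_{\theta,z}\\ \phi_{z,r}&\frac{\phi_{z,\theta}}{r}&\phi_{z,z}\end{bmatrix},\qquad e(\boldsymbol{\phi})=\tfrac12\big(\nabla\boldsymbol{\phi}+(\nabla\boldsymbol{\phi})^T\big).$$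 In particular $(\nabla\boldsymbol{\phi})_{r\theta}=(\phi_{r,\theta}-\phi_\theta)/r$. $\|\cdot\|$ is the $L^2$ norm on $\mathcal{C}_h$ (Frobenius norm for matrices). The spaces are (boundary values in the sense of traces) $$V_h^1=\{\boldsymbol{\phi}\in W^{1,2}(\mathcal{C}_h;\mathbb{R}^3):\boldsymbol{\phi}(r,\theta,0)=0,\ \phi_r(r,\theta,L)=\phi_\theta(r,\theta,L)=0\},$$ $$V_h^2=\{\boldsymbol{\phi}\in W^{1,2}(\mathcal{C}_h;\mathbb{R}^3):\phi_\theta(r,\theta,0)=\phi_z(r,\theta,0)=\phi_\theta(r,\theta,L)=\phi_z(r,\theta,L)=0\}.$$ *)

(* Defs.v *)
From mathcomp Require Import all_boot all_order all_algebra.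
From mathcomp Require Import all_classical all_reals all_analysis.

Set Implicit Arguments.
Unset Strict Implicit.
Unset Printing Implicit Defensive.

Import Order.TTheory GRing.Theory Num.Theory.
Import numFieldNormedType.Exports.

Local Open Scope classical_set_scope.
Local Open Scope ring_scope.

(* A point is p = (r, theta, z).  A function of theta in the circle is a      *)
(* 2 pi-periodic function on the line, integrated over `[0, 2 pi].            *)

(* These index both the coordinates and the vector components. *)
Definition ri : 'I_3 := @Ordinal 3 0 isT.
Definition ti : 'I_3 := @Ordinal 3 1 isT.
Definition zi : 'I_3 := @Ordinal 3 2 isT.

Definition dir (R : realType) (i : 'I_3) : R * R * R :=
  ((i == ri)%:R, (i == ti)%:R, (i == zi)%:R).

Definition theta_periodic (R : realType) (u : R * R * R -> R) : Prop :=
  forall r t z : R, u (r, t + 2 * pi, z) = u (r, t, z).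

Definition Ih (R : realType) (h : R) : set R := `[1 - h / 2, 1 + h / 2].

Definition shell (R : realType) (h L : R) : set (R * R * R) :=
  (Ih h `*` `[0, 2 * pi]) `*` `[0, L].

Definition leb2 (R : realType) :=
  (@lebesgue_measure R \x @lebesgue_measure R)%E.
Arguments leb2 R : clear implicits.

Definition leb3 (R : realType) := (leb2 R \x @lebesgue_measure R)%E.
Arguments leb3 R : clear implicits.

(* Squared L^2 norms; the factor r = p.1.1 comes from the volume element      *)
(* r dr dtheta dz.                                                            *)
Definition sqnorm (R : realType) (h L : R) (u : R * R * R -> R) : \bar R :=
  (\int[leb3 R]_(p in shell h L) (u p ^+ 2 * p.1.1)%:E)%E.

Definition sqnorm_mx (R : realType) (h L : R) (M : R * R * R -> 'M[R]_3)
    : \bar R :=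
  (\int[leb3 R]_(p in shell h L)
     ((\sum_i \sum_j M p i j ^+ 2)%R * p.1.1)%:E)%E.

(* On a cross-section z = const the surface element is r dr dtheta. *)
Definition sqnorm_face (R : realType) (h : R) (g : R * R -> R) : \bar R :=
  (\int[leb2 R]_(q in Ih h `*` `[0%R, (2 * pi)%R]) (g q ^+ 2 * q.1)%:E)%E.

Definition in_L2 (R : realType) (h L : R) (u : R * R * R -> R) : Prop :=
  measurable_fun (shell h L) u /\ (sqnorm h L u < +oo)%E.

Fixpoint Ck (R : realType) (k : nat) (f : R * R * R -> R) : Prop :=
  continuous f /\
  if k is k'.+1 then
    forall i : 'I_3, (forall p, derivable f p (dir R i)) /\
                     Ck k' (fun p => 'D_(dir R i) f p)
  else True.

Definition smooth_periodic (R : realType) (f : R * R * R -> R) : Prop :=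
  theta_periodic f /\ forall k, Ck k f.

(* C^oo functions compactly supported in the interior of the shell, that is,  *)
(* vanishing near the lateral faces and the ends but not cut off in theta.    *)
Definition test_function (R : realType) (h L : R) (psi : R * R * R -> R)
    : Prop :=
  smooth_periodic psi /\
  exists2 d : R, 0 < d &
    forall p, psi p != 0 ->
      (1 - h / 2 + d <= p.1.1 <= 1 + h / 2 - d) /\ (d <= p.2 <= L - d).

(* The coordinates r, theta, z are integrated by parts against dr dtheta dz,  *)
(* so there is no factor r here.                                              *)
Definition is_weak_partial (R : realType) (h L : R) (i : 'I_3)
    (u v : R * R * R -> R) : Prop :=
  in_L2 h L v /\
  forall psi, test_function h L psi ->
    Rintegral (leb3 R) (shell h L) (fun p => u p * 'D_(dir R i) psi p) =
    - Rintegral (leb3 R) (shell h L) (fun p => v p * psi p).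

(* Unique almost everywhere when it exists, e.g. for u in W12; 0 otherwise. *)
Definition weak_partial (R : realType) (h L : R) (i : 'I_3)
    (u : R * R * R -> R) : R * R * R -> R :=
  xget (fun _ => 0) [set v | is_weak_partial h L i u v].

Definition W12 (R : realType) (h L : R) (u : R * R * R -> R) : Prop :=
  [/\ theta_periodic u, in_L2 h L u &
      forall i, exists v, is_weak_partial h L i u v].

(* The trace operator is the continuous extension to W12 of the restriction   *)
(* of functions smooth up to the boundary.                                    *)
Definition is_trace (R : realType) (h L c : R) (u : R * R * R -> R)
    (g : R * R -> R) : Prop :=
  exists un : nat -> R * R * R -> R,
    [/\ forall n, smooth_periodic (un n),
        sqnorm h L (fun p => un n p - u p) @[n --> \oo] --> 0%E,
        forall i, sqnorm h L (fun p => 'D_(dir R i) (un n) p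
                                       - weak_partial h L i u p)
                  @[n --> \oo] --> 0%E &
        sqnorm_face h (fun q => un n (q, c) - g q) @[n --> \oo] --> 0%E].

Definition zero_trace (R : realType) (h L c : R) (u : R * R * R -> R) : Prop :=
  is_trace h L c u (fun _ => 0).

Definition component (R : realType) (phi : R * R * R -> 'rV[R]_3) (i : 'I_3)
    : R * R * R -> R := fun p => phi p 0 i.

Definition V1 (R : realType) (h L : R) : set (R * R * R -> 'rV[R]_3) :=
  [set phi | [/\ forall i, W12 h L (component phi i),
                 forall i, zero_trace h L 0 (component phi i),
                 zero_trace h L L (component phi ri) &
                 zero_trace h L L (component phi ti)]].

Definition V2 (R : realType) (h L : R) : set (R * R * R -> 'rV[R]_3) :=
  [set phi | [/\ forall i, W12 h L (component phi i),
                 zero_trace h L 0 (component phi ti),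
                 zero_trace h L 0 (component phi zi),
                 zero_trace h L L (component phi ti) &
                 zero_trace h L L (component phi zi)]].

Definition nonzero_field (R : realType) (h L : R)
    (phi : R * R * R -> 'rV[R]_3) : Prop :=
  ~ {ae leb3 R, forall p, shell h L p -> phi p = 0}.

(* \nabla phi in the frame (e_r, e_theta, e_z). *)
Definition cyl_grad (R : realType) (h L : R) (phi : R * R * R -> 'rV[R]_3)
    : R * R * R -> 'M[R]_3 :=
  fun p =>
  let r := p.1.1 in
  let d i j := weak_partial h L j (component phi i) p in
  let rows :=
    [:: [:: d ri ri; (d ri ti - phi p 0 ti) / r; d ri zi];
        [:: d ti ri; (d ti ti + phi p 0 ri) / r; d ti zi];
        [:: d zi ri; d zi ti / r;                d zi zi]] in
  \matrix_(i, j) (nth [::] rows i)`_j.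

Definition cyl_strain (R : realType) (h L : R) (phi : R * R * R -> 'rV[R]_3)
    : R * R * R -> 'M[R]_3 :=
  fun p => 2^-1 *: (cyl_grad h L phi p + (cyl_grad h L phi p)^T).

Definition sq_ratio (R : realType) (h L : R) (u : R * R * R -> R)
    (M : R * R * R -> 'M[R]_3) : R :=
  fine (sqnorm h L u) / fine (sqnorm_mx h L M).

(* Submission.v *)
From HB Require Import structures.
From Pilot Require Import Defs.
From mathcomp Require Import all_boot all_order all_algebra.
From mathcomp Require Import all_classical all_reals all_analysis.
From mathcomp Require Import measurable_realfun.
From mathcomp Require Import ring lra.
Import Order.TTheory GRing.Theory Num.Theory.
Import numFieldNormedType.Exports.
Local Open Scope classical_set_scope.
Local Open Scope ring_scope.

(** Write u, v, w for the radial, circumferential and axial components, E for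
    the squared norm of the strain and s for its square root. All estimates are
    first proved for smooth fields, with constants that do not depend on the
    field, and then extended by density.

    For smooth fields two mechanisms compete. The membrane strains v_theta + u,
    v_z + w_theta and w_z control the tangential components once u is known:
    in the square of v_z + w_theta the integral of the product v_z w_theta
    equals that of v_theta w_z, which is small except for u w_z. Hence v_z and
    w_theta are of square at most of order s^2 + |u| s ([membrane_bound]), and v by Poincare's
    inequality. Bending is controlled by a Korn inequality in the thin
    direction. It is proved by reflection: contracting by one half towards a
    lateral face, one forms combinations of a field and its contraction that
    agree with the field on the face and whose shear strain is again a
    combination of shear strains. The difference of the products of the two
    components before and after reflection vanishes on that face; integrating
    its radial derivative against the distance to the other face, and adding
    the results for both faces, gives a bound of a tangential derivative
    m = P_tau by the shear strain m + q_r, by |P_r| |q_tau| and by q/h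
    ([korn_reflection], [korn_layer]). For P = u, q = v the last term improves,
    because v_theta + u is small: |u_theta|^2 is bounded by s^2 + |u| s / h + |v|^2
    ([bending_bound]). Finally |u|^2 is bounded by |u| s + |u_theta| |v|
    ([radial_bound]). Solving these inequalities with t = h^(1/4) shows that, in
    units of s, u is at most of order t^-2, u_theta of order t^-3 and v_z of
    order t^-1 ([scaling_bounds]), which are the first two claims.

    The bound of u_z is of another nature, since the layer inequality with q = w
    involves |w|/h. Let psi be u smoothed at the scale h in theta and z. The
    displacements smoothed at this scale have derivatives larger only by 1/h, so
    the layer inequality bounds the curvatures psi_zz, psi_{theta z} and
    psi_{theta theta} by s/h. Integrations by parts express the inner product of
    u_z and psi_z through products of these curvatures with the membrane
    strains, which is s^2/h; and u_z - psi_z obeys the layer inequality with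
    q = w - (smoothed w), which is of size h |grad w| ([axial_bound]). Smoothing
    is done by solving y + h y_theta = f and y - h^2 y_zz = f, with Neumann or
    Dirichlet conditions according to the boundary conditions of the fields, so
    that all boundary terms continue to vanish.

    Density is needed with boundary values. Near an end where the trace is zero,
    approximants are multiplied by 1 - exp(-m |z - c|), whose derivative costs
    only m times their small boundary values ([zero_trace_approximable]). A
    component without boundary condition is mollified by a kernel that moves
    points away from the ends, so that no extension is necessary and
    mollification commutes with weak derivatives ([W12_approximable]). That
    mollifiers converge in L^2 follows from boxes by Dynkin's lemma, as they are
    uniformly bounded ([moll_bound], [mollified_L2]). The same estimates bound u,
    v and w themselves by s, so that E vanishes for the zero field only and the
    quotients make sense ([field_korn]). *)

Set Implicit Arguments.
Unset Strict Implicit.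
Unset Printing Implicit Defensive.

(** * Coordinates and directional derivatives *)

HB.lock Definition pd {R : realType} (i : 'I_3) (f : R * R * R -> R) : R * R * R -> R :=
  fun p => 'D_(dir R i) f p.

Section Coordinates.
Context {R : realType}.
Local Notation pt := (R * R * R)%type.
Implicit Types (f g : pt -> R) (p : pt) (i j : 'I_3).

Definition crd i p : R :=
  if i == ri then p.1.1 else if i == ti then p.1.2 else p.2.

Definition upd i p t : pt :=
  if i == ri then (t, p.1.2, p.2) else if i == ti then (p.1.1, t, p.2)
  else (p.1, t).


Definition haspd i f g :=
  forall p, is_derive (crd i p) 1 (fun t => f (upd i p t)) (g p).

Lemma ord3P i : [\/ i = ri, i = ti | i = zi].
Proof.
case: i => -[|[|[|//]]] lt3; [apply: Or31|apply: Or32|apply: Or33];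
  exact: val_inj.
Qed.

Lemma upd_crd i p : upd i p (crd i p) = p.
Proof. by case: p => -[x t] z; case: (ord3P i) => ->. Qed.

Lemma crd_upd i p t : crd i (upd i p t) = t.
Proof. by case: p => -[x s] z; case: (ord3P i) => ->. Qed.

Lemma upd_upd i p s t : upd i (upd i p s) t = upd i p t.
Proof. by case: p => -[x r] z; case: (ord3P i) => ->. Qed.

Lemma upd_comm i j p s t : i != j -> upd i (upd j p s) t = upd j (upd i p t) s.
Proof.
by case: p => -[x r] z; case: (ord3P i) => ->; case: (ord3P j) => ->.
Qed.

Lemma crd_upd_neq i j p s : i != j -> crd i (upd j p s) = crd i p.
Proof.
by case: p => -[x r] z; case: (ord3P i) => ->; case: (ord3P j) => ->.
Qed.

Lemma dir_upd i p h : h *: dir R i + p = upd i p (h + crd i p).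
Proof.
case: p => -[x r] z; case: (ord3P i) => -> /=; rewrite /dir /upd /crd /=;
by congr (_, _, _) => /=; rewrite /GRing.scale /= ?mulr1 ?mulr0 ?add0r.
Qed.

Lemma haspd_quot i f p : (fun h : R => h^-1 *: ((f \o shift p) (h *: dir R i) - f p))
  = (fun h : R => h^-1 *: (((fun t => f (upd i p t)) \o shift (crd i p)) (h *: 1)
                   - (fun t => f (upd i p t)) (crd i p))).
Proof.
apply/funext => h /=; rewrite dir_upd upd_crd.
by congr (_ *: (f (upd _ _ (_ + _)) - _)); rewrite [RHS]mulr1.
Qed.

Lemma derivable_upd i f p :
  derivable f p (dir R i) = derivable (fun t => f (upd i p t)) (crd i p) 1.
Proof. by rewrite /derivable haspd_quot. Qed.

Lemma pd_def i f : pd i f = (fun p => 'D_(dir R i) f p).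
Proof. by rewrite unlock. Qed.

Lemma pdE i f p : pd i f p = 'D_1 (fun t => f (upd i p t)) (crd i p).
Proof. by rewrite pd_def /derive haspd_quot. Qed.

Lemma haspd_derivable i f g p : haspd i f g -> derivable f p (dir R i).
Proof. by move=> fg; rewrite derivable_upd; have [] := fg p. Qed.

Lemma haspdE i f g : haspd i f g -> pd i f = g.
Proof. by move=> fg; apply/funext => p; rewrite pdE; have [] := fg p. Qed.

Lemma derivable_haspd i f :
  (forall p, derivable f p (dir R i)) -> haspd i f (pd i f).
Proof. by move=> df p; split; [rewrite -derivable_upd|rewrite pdE]. Qed.

(** The derivative at the base point of a line gives it along the whole line. *)
Lemma haspd_line i f g p (t : R) :
  haspd i f g -> is_derive t 1 (fun s => f (upd i p s)) (g (upd i p t)).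
Proof.
move=> /(_ (upd i p t)); rewrite crd_upd.
by under [X in is_derive _ _ X _]eq_fun do rewrite upd_upd.
Qed.

Lemma haspd_cst i (c : R) : haspd i (fun=> c) (fun=> 0).
Proof. by move=> p; exact: is_derive_cst. Qed.

Lemma haspdD i f g f' g' :
  haspd i f f' -> haspd i g g' -> haspd i (f + g) (f' + g').
Proof. by move=> df dg p; exact: is_deriveD. Qed.

Lemma haspdN i f f' : haspd i f f' -> haspd i (- f) (- f').
Proof. by move=> df p; exact: is_deriveN. Qed.

Lemma haspdM i f g f' g' :
  haspd i f f' -> haspd i g g' -> haspd i (f * g) (f' * g + f * g').
Proof.
move=> df dg p; have := is_deriveM (df p) (dg p); rewrite !upd_crd.
suff -> : (f' * g + f * g') p = f p *: g' p + g p *: f' p by [].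
by rewrite addrC [g p *: _]mulrC.
Qed.


Lemma haspd_crd i j : haspd i (crd j) (fun=> (i == j)%:R).
Proof.
move=> p; have [<-|ij] := eqVneq i j.
  by under eq_fun do rewrite crd_upd; exact: is_derive_id.
under eq_fun do rewrite crd_upd_neq 1?eq_sym//.
exact: is_derive_cst.
Qed.

Lemma haspd_comp_crd i j (u v : R -> R) : (forall x : R, is_derive x (1 : R) u (v x)) ->
  haspd i (u \o crd j) (fun p => (i == j)%:R * v (crd j p)).
Proof.
move=> uv p; have [<-|ij] := eqVneq i j.
  under [X in is_derive _ _ X _]eq_fun do rewrite /= crd_upd.
  by rewrite mul1r; exact: uv.
under [X in is_derive _ _ X _]eq_fun do rewrite /= crd_upd_neq 1?eq_sym//.
by rewrite mul0r; exact: is_derive_cst.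
Qed.

Definition sub i (a b : R) f : pt -> R := fun p => f (upd i p (a * crd i p + b)).

Lemma haspd_sub_neq i j a b f g :
  i != j -> haspd j f g -> haspd j (sub i a b f) (sub i a b g).
Proof.
move=> ij fg p; rewrite /sub.
under [X in is_derive _ _ X _]eq_fun do rewrite crd_upd_neq// upd_comm//.
have := haspd_line (upd i p (a * crd i p + b)) (crd j p) fg.
by rewrite -upd_comm// upd_crd.
Qed.

Lemma haspd_sub i a b f g :
  haspd i f g -> haspd i (sub i a b f) ((fun=> a) * sub i a b g).
Proof.
move=> fg p; rewrite /sub.
under [X in is_derive _ _ X _]eq_fun do rewrite crd_upd upd_upd.
have h1 : is_derive (crd i p) (1 : R) (fun t : R => a * t + b) a.
  have -> : (fun t : R => a * t + b) = (a \*: (id : R -> R)) + cst b.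
    by apply/funext.
  have := is_deriveD (is_deriveZ a (is_derive_id (crd i p) (1:R)))
    (is_derive_cst b (crd i p) (1:R)).
  by move/is_derive_eq; apply; rewrite addr0 /GRing.scale/= mulr1.
have := @is_derive1_comp _ (fun s => f (upd i p s)) (fun t => a * t + b) _ _ _
  (haspd_line p (a * crd i p + b) fg) h1.
by rewrite [X in is_derive _ _ _ X]mulrC.
Qed.

Lemma continuous_fst (U V : topologicalType) : continuous (fst : U * V -> U).
Proof. by move=> q; exact: cvg_fst. Qed.

Lemma continuous_snd (U V : topologicalType) : continuous (snd : U * V -> V).
Proof. by move=> q; exact: cvg_snd. Qed.

Lemma continuous_pair (T U V : topologicalType) (a : T -> U) (b : T -> V) s :
  {for s, continuous a} -> {for s, continuous b} ->
  {for s, continuous (fun x => (a x, b x))}.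
Proof. by move=> ca cb; apply: cvg_pair. Qed.

Lemma continuous_crd i : continuous (crd i).
Proof.
case: (ord3P i) => -> p; rewrite /crd /=.
- exact: (continuous_comp (@continuous_fst _ _ p) (@continuous_fst _ _ _)).
- exact: (continuous_comp (@continuous_fst _ _ p) (@continuous_snd _ _ _)).
- exact: continuous_snd.
Qed.

Lemma continuous_upd i (T : topologicalType) (u : T -> pt) (v : T -> R) :
  continuous u -> continuous v -> continuous (fun s => upd i (u s) (v s)).
Proof.
move=> cu cv s; have c1 := cu s; have c2 := cv s.
have c3 := continuous_comp c1 (@continuous_fst _ _ _).
have c4 := continuous_comp c1 (@continuous_snd _ _ _).
have c5 := continuous_comp c3 (@continuous_fst _ _ _).
have c6 := continuous_comp c3 (@continuous_snd _ _ _).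
case: (ord3P i) => ->; rewrite /upd /=.
- exact: continuous_pair (continuous_pair c2 c6) c4.
- exact: continuous_pair (continuous_pair c5 c2) c4.
- exact: continuous_pair c3 c2.
Qed.

Lemma continuous_sub i a b f : continuous f -> continuous (sub i a b f).
Proof.
move=> cf p; apply: (continuous_comp (f := fun q => upd i q (a * crd i q + b))
  (g := f)); last exact: cf.
apply: (@continuous_upd i pt id (fun q => a * crd i q + b)) => [q|q].
  exact: cvg_id.
apply: cvgD; last exact: cvg_cst.
by apply: cvgM; [exact: cvg_cst|exact: continuous_crd].
Qed.
End Coordinates.

(** * Integrals depending on a parameter *)

Section Param.
Context {R : realType}.
Local Notation pt := (R * R * R)%type.
Local Notation leb := (@lebesgue_measure R).

Lemma compact_bound (X : topologicalType) (K : set X) (f : X -> R) :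
  compact K -> continuous f -> exists2 M : R, 0 < M & forall x, K x -> `|f x| <= M.
Proof.
move=> cK cf.
have := continuous_compact (continuous_subspaceT cf) cK.
move=> /compact_bounded[M [Mr HM]].
exists (`|M| + 1) => [|x Kx]; first by rewrite ltr_wpDl.
by apply: (HM (`|M| + 1)); [rewrite (le_lt_trans (ler_norm M))// ltrDl|exists x].
Qed.

Lemma continuous_integrable01 (f : R -> R) : continuous f ->
  leb.-integrable `[0, 1] (EFin \o f).
Proof.
move=> cf; apply: continuous_compact_integrable; first exact: segment_compact.
exact: continuous_subspaceT.
Qed.

Lemma Rint01_cst (c : R) : \int[leb]_(s in `[0, 1]) c = c.
Proof.
rewrite Rintegral_cst//= lebesgue_measure_itv/= lte_fin ltr01.
by rewrite -EFinB/= subr0 mulr1.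
Qed.

Lemma Rint01_bound (f : R -> R) (M : R) : continuous f ->
  (forall s, s \in `[0, 1] -> `|f s| <= M) -> `|\int[leb]_(s in `[0, 1]) f s| <= M.
Proof.
move=> cf fM; rewrite -(Rint01_cst M).
apply: le_trans (le_normr_Rintegral _ _) _ => //; first exact: continuous_integrable01.
apply: le_Rintegral => //.
- apply: (@continuous_integrable01 (fun s => `|f s|)).
  by move=> s; apply: cvg_norm; exact: cf.
- exact: (@continuous_integrable01 (fun=> M) (fun=> cvg_cst _)).
Qed.

Lemma continuous_pairr (X Y : topologicalType) (x : X) : continuous (fun y : Y => (x, y)).
Proof. by move=> y; apply: continuous_pair; [exact: cvg_cst|exact: cvg_id]. Qed.

Lemma continuous_param (F : pt -> R -> R) :
  continuous (fun ps : pt * R => F ps.1 ps.2) ->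
  continuous (fun p => \int[leb]_(s in `[0, 1]) F p s).
Proof.
move=> cF p0.
have cFp p : continuous (F p).
  move=> s; exact: (continuous_comp (@continuous_pairr _ _ p s) (cF (p, s))).
apply/cvgrPdist_le => e e0.
have : \forall p \near p0, `[0, 1] `<=` (fun s => `|F p0 s - F p s| <= e).
  have /compact_near_coveringP ncov := @segment_compact R 0 1.
  apply: (ncov pt (nbhs p0) (fun p s => `|F p0 s - F p s| <= e)) => s _.
  have e20 : 0 < e / 2 by rewrite divr_gt0.
  have /cvgrPdist_le/(_ _ e20) := cF (p0, s).
  have /cvgrPdist_le/(_ _ e20) := cFp p0 s.
  move=> H1 H2.
  have H1' : \forall s' \near s & p \near p0, `|F p0 s - F p0 s'| <= e / 2.
    exists ([set s' | `|F p0 s - F p0 s'| <= e / 2], setT) => //=; last by case=> s' p [].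
    by split => /=; [exact: H1|exact: filterT].
  have H2' : \forall s' \near s & p \near p0, `|F p0 s - F p s'| <= e / 2.
    case: H2 => -[U V] /= [nU nV] UV; exists (V, U) => //= -[s' p] [/= Vs Up].
    exact: (UV (p, s')).
  move: H1' H2'; apply: filterS2 => -[s' p] /= h1 h2.
  rewrite (_ : F p0 s' - F p s' = (F p0 s - F p s') - (F p0 s - F p0 s')); last by ring.
  by rewrite (le_trans (ler_normB _ _))// [leRHS](splitr e) lerD.
apply: filterS => p Hp.
rewrite -RintegralB//; last 2 first.
- exact: continuous_integrable01.
- exact: continuous_integrable01.
apply: (@Rint01_bound (fun s => F p0 s - F p s)).
  by move=> s; apply: cvgB; exact: cFp.
by move=> s s01; exact: Hp.
Qed.

(** Differentiation under the integral sign: by compactness of [0, 1] the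
    derivative G is uniformly close to its value at the base point. *)
Lemma haspd_param i (F G : pt -> R -> R) :
  continuous (fun ps : pt * R => F ps.1 ps.2) ->
  continuous (fun ps : pt * R => G ps.1 ps.2) ->
  (forall s, haspd i (F ^~ s) (G ^~ s)) ->
  haspd i (fun p => \int[leb]_(s in `[0, 1]) F p s)
          (fun p => \int[leb]_(s in `[0, 1]) G p s).
Proof.
move=> cF cG FG p.
have cFp q : continuous (F q).
  move=> s; exact: (continuous_comp (@continuous_pairr _ _ q s) (cF (q, s))).
set c := crd i p; pose f (x : R) (s : R) := F (upd i p x) s.
have df x s : is_derive x (1 : R) (f ^~ s) (G (upd i p x) s).
  exact: (haspd_line p x (FG s)).
have [M M0 HM] : exists2 M, 0 < M & forall xs : R * R,
    (`[c - 1, c + 1] `*` `[0, 1]) xs -> `|G (upd i p xs.1) xs.2| <= M.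
  apply: (@compact_bound _ _ (fun xs : R * R => G (upd i p xs.1) xs.2)).
    by apply: compact_setX; exact: segment_compact.
  move=> xs; apply: (continuous_comp (f := fun xs : R * R => (upd i p xs.1, xs.2))
    (g := fun ps => G ps.1 ps.2)); last exact: cG.
  apply: continuous_pair; last exact: continuous_snd.
  apply: (@continuous_upd _ i _ (fun=> p)) => ys; first exact: cvg_cst.
  exact: continuous_fst.
have cI : `]c - 1, c + 1[%classic c.
  by rewrite /= in_itv/= ltrDl ltr01 andbT ltrBlDr ltrDl ltr01.
have If x : `]c - 1, c + 1[%classic x -> leb.-integrable `[0, 1] (EFin \o f x).
  by move=> _; exact: (@continuous_integrable01 (f x) (cFp _)).
have Df x s : `]c - 1, c + 1[%classic x -> `[0, 1]%classic s ->
   derivable (f ^~ s) x 1 by move=> _ _; have [] := df x s.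
have IM : leb.-integrable `[0, 1] (EFin \o fun=> M).
  exact: (@continuous_integrable01 (fun=> M) (fun=> cvg_cst _)).
have Bf x s : `]c - 1, c + 1[%classic x -> `[0, 1]%classic s ->
   `|partial1of2 f x s| <= M.
  move=> xI sI; rewrite partial1of2E; have [_ ->] := df x s.
  apply: (HM (x, s)); split => //=.
  by move: xI; rewrite /= !in_itv/= => /andP[/ltW -> /ltW ->].
have M0' : forall s : R, 0 <= (fun=> M) s by move=> _; exact: ltW.
have H1 := @derivable_under_integral _ _ _ leb f `[0, 1] (measurable_itv _)
  _ _ _ cI If Df _ M0' IM Bf.
have H2 := @differentiation_under_integral _ _ _ leb f `[0, 1] (measurable_itv _)
  _ _ _ cI If Df _ M0' IM Bf.
split; first exact H1.
rewrite -derive1E; rewrite /f in H2; rewrite [LHS]H2 {H1 H2}.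
apply: eq_Rintegral => s _; rewrite partial1of2E.
by have [_ ->] := df c s; rewrite upd_crd.
Qed.
End Param.

(** * A calculus of smooth functions *)

Section Smooth.
Context {R : realType}.
Local Notation pt := (R * R * R)%type.
Local Notation leb := (@lebesgue_measure R).
Implicit Types (f g : pt -> R) (p : pt) (i j : 'I_3).

Definition smooth f := forall k, Ck k f.

(** A class of functions closed under partial derivatives consists of smooth
    functions, so smoothness of an explicit family needs only first
    derivatives. *)
Lemma smooth_coind (S : (pt -> R) -> Prop) :
  (forall f, S f -> continuous f /\ forall i, exists2 g, haspd i f g & S g) ->
  forall f, S f -> smooth f.
Proof.
move=> HS f Sf k; elim: k f Sf => [|k IH] f /HS[cf df]; first by split.
split=> // i; have [g fg Sg] := df i; split; first by move=> p; exact: haspd_derivable fg.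
by rewrite -pd_def (haspdE fg); exact: IH.
Qed.

Lemma smooth_continuous f : smooth f -> continuous f.
Proof. by move=> /(_ 0%N)[]. Qed.

Lemma smooth_haspd i f : smooth f -> haspd i f (pd i f).
Proof. by move=> /(_ 1%N)[_ /(_ i)[df _]]; exact: derivable_haspd. Qed.

Lemma smooth_pd i f : smooth f -> smooth (pd i f).
Proof. by move=> sf k; have [_ /(_ i)[_]] := sf k.+1; rewrite -pd_def. Qed.

Inductive alg : (pt -> R) -> Prop :=
| alg_base f : smooth f -> alg f
| alg_add f g : alg f -> alg g -> alg (f + g)
| alg_opp f : alg f -> alg (- f)
| alg_mul f g : alg f -> alg g -> alg (f * g).

Lemma alg_smooth f : alg f -> smooth f.
Proof.
apply: smooth_coind => {}f; elim=> {f}.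
- move=> f sf; split; first exact: smooth_continuous.
  by move=> i; exists (pd i f); [exact: smooth_haspd|apply/alg_base/smooth_pd].
- move=> f g af [cf df] ag [cg dg]; split; first by move=> p; apply: cvgD; [exact: cf|exact: cg].
  move=> i; have [f' ? ?] := df i; have [g' ? ?] := dg i.
  by exists (f' + g'); [exact: haspdD|exact: alg_add].
- move=> f af [cf df]; split; first by move=> p; apply: cvgN; exact: cf.
  move=> i; have [f' ? ?] := df i.
  by exists (- f'); [exact: haspdN|exact: alg_opp].
- move=> f g af [cf df] ag [cg dg]; split; first by move=> p; apply: cvgM; [exact: cf|exact: cg].
  move=> i; have [f' ? ?] := df i; have [g' ? ?] := dg i.
  by exists (f' * g + f * g'); [exact: haspdM|apply: alg_add; exact: alg_mul].
Qed.

Lemma smoothD f g : smooth f -> smooth g -> smooth (f + g).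
Proof. by move=> sf sg; apply/alg_smooth/alg_add; exact: alg_base. Qed.

Lemma smoothM f g : smooth f -> smooth g -> smooth (f * g).
Proof. by move=> sf sg; apply/alg_smooth/alg_mul; exact: alg_base. Qed.

Lemma smoothN f : smooth f -> smooth (- f).
Proof. by move=> sf; apply/alg_smooth/alg_opp; exact: alg_base. Qed.

Lemma smooth_cst (c : R) : smooth (fun=> c).
Proof.
apply: (@smooth_coind (fun f => exists c : R, f = fun=> c)); last by exists c.
move=> _ [a ->]; split; first by move=> p; exact: cvg_cst.
by move=> i; exists (fun=> 0); [exact: haspd_cst|exists 0].
Qed.

Definition smooth1 (u : R -> R) := exists d : nat -> R -> R,
  d 0%N = u /\ forall n (x : R), is_derive x (1 : R) (d n) (d n.+1 x).

Lemma continuous_is_derive (u v : R -> R) :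
  (forall x : R, is_derive x (1 : R) u (v x)) -> continuous u.
Proof.
move=> uv x; apply/differentiable_continuous/derivable1_diffP.
by have [] := uv x.
Qed.

Lemma smooth_comp_crd j (u : R -> R) : smooth1 u -> smooth (u \o crd j).
Proof.
move=> [d [<- dd]].
apply: (@smooth_coind (fun f => exists (k : R) n, f = (fun=> k) * (d n \o crd j))); last first.
  by exists 1, 0%N; apply/funext => p; rewrite fctE mul1r.
move=> _ [k [n ->]]; split.
  move=> p; apply: cvgM; first exact: cvg_cst.
  apply: (continuous_comp (f := crd j) (g := d n)); first exact: continuous_crd.
  exact: (continuous_is_derive (dd n)).
move=> i; have := haspdM (haspd_cst i k) (haspd_comp_crd i j (dd n)).
move=> H; eexists; first exact: H.
exists (k * (i == j)%:R), n.+1; apply/funext => p.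
rewrite /GRing.add /GRing.mul /=.
by rewrite mul0r add0r mulrA.
Qed.

Lemma smooth1_id : smooth1 (@id R).
Proof.
exists (fun n => if n is 0%N then id else if n is 1%N then fun=> 1 else fun=> 0).
split=> // -[|[|n]] x; [exact: is_derive_id|exact: is_derive_cst|exact: is_derive_cst].
Qed.

Lemma smooth_crd j : smooth (crd j).
Proof. exact: (smooth_comp_crd j smooth1_id). Qed.

Lemma smooth1_exp (c : R) : smooth1 (fun x => expR (c * x)).
Proof.
exists (fun n x => c ^+ n * expR (c * x)); split.
  by apply/funext => x; rewrite expr0 mul1r.
move=> n x.
have h1 : is_derive x (1 : R) (fun t : R => c * t) c.
  have := is_deriveZ c (is_derive_id x (1 : R)).
  by move/is_derive_eq; apply; rewrite /GRing.scale/= mulr1.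
have h2 := @is_derive1_comp _ expR (fun t => c * t) _ _ _ (is_derive_expR (c * x)) h1.
have := is_deriveZ (c ^+ n) h2.
by move/is_derive_eq; apply; rewrite /GRing.scale/= exprSr; ring.
Qed.

Lemma smooth_sub i a b f : smooth f -> smooth (sub i a b f).
Proof.
move=> sf.
apply: (@smooth_coind (fun g => exists (k : R) f, smooth f /\ g = (fun=> k) * sub i a b f)); last first.
  by exists 1, f; split => //; apply/funext => p; rewrite fctE mul1r.
move=> _ [k [{sf}f [sf ->]]]; split.
  move=> p; apply: cvgM; first exact: cvg_cst.
  by apply: continuous_sub; exact: smooth_continuous.
move=> j; have [ij|ij] := eqVneq i j.
  subst j; have H := haspdM (haspd_cst i k) (haspd_sub a b (smooth_haspd i sf)).
  eexists; first exact: H.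
  exists (k * a), (pd i f); split; first exact: smooth_pd.
  apply/funext => p; rewrite /GRing.add /GRing.mul /=.
  by rewrite mul0r add0r mulrA.
have H := haspdM (haspd_cst j k) (haspd_sub_neq a b ij (smooth_haspd j sf)).
eexists; first exact: H.
exists k, (pd j f); split; first exact: smooth_pd.
apply/funext => p; rewrite /GRing.add /GRing.mul /=.
by rewrite mul0r add0r.
Qed.

(** Weighted averages of affine substitutions in one coordinate. Their partial
    derivatives are averages of the same kind, which makes them smooth. *)
Definition avg i (al be w : R -> R) f : pt -> R :=
  fun p => \int[leb]_(s in `[0, 1]) (w s * f (upd i p (al s * crd i p + be s))).

Section Avg.
Variables (i : 'I_3) (al be : R -> R).
Hypotheses (cal : continuous al) (cbe : continuous be).

Lemma continuous_avg_integrand (w : R -> R) f : continuous w -> continuous f ->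
  continuous (fun ps : pt * R =>
    w ps.2 * f (upd i ps.1 (al ps.2 * crd i ps.1 + be ps.2))).
Proof.
have c2 (u : R -> R) : continuous u -> continuous (fun ps : pt * R => u ps.2).
  move=> cu ps; exact: (continuous_comp (@continuous_snd _ _ ps) (cu _)).
move=> cw cf ps; apply: cvgM; first exact: c2.
apply: (continuous_comp (f := fun ps : pt * R => upd i ps.1 (al ps.2 * crd i ps.1 + be ps.2))
  (g := f)); last exact: cf.
apply: (@continuous_upd _ i (pt * R)%type fst) => {ps} ps; first exact: continuous_fst.
apply: cvgD; last exact: c2.
apply: cvgM; first exact: c2.
exact: (continuous_comp (@continuous_fst _ _ ps) (@continuous_crd _ i _)).
Qed.

Lemma haspd_avg w f : continuous w -> smooth f ->
  haspd i (avg i al be w f) (avg i al be (w \* al) (pd i f)).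
Proof.
move=> cw sf; rewrite /avg.
apply: (@haspd_param _ i
  (fun p s => w s * f (upd i p (al s * crd i p + be s)))
  (fun p s => (w \* al) s * pd i f (upd i p (al s * crd i p + be s)))).
- by apply: continuous_avg_integrand => //; exact: smooth_continuous.
- apply: continuous_avg_integrand; last exact/smooth_continuous/smooth_pd.
  by move=> s; apply: cvgM; [exact: cw|exact: cal].
- move=> s p; have := haspdM (haspd_cst i (w s)) (haspd_sub (al s) (be s) (smooth_haspd i sf)).
  move=> /(_ p); rewrite /GRing.add /GRing.mul /=.
  by move/is_derive_eq; apply; rewrite mul0r add0r mulrA.
Qed.

Lemma haspd_avg_neq j w f : i != j -> continuous w -> smooth f ->
  haspd j (avg i al be w f) (avg i al be w (pd j f)).
Proof.
move=> ij cw sf; rewrite /avg.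
apply: (@haspd_param _ j
  (fun p s => w s * f (upd i p (al s * crd i p + be s)))
  (fun p s => w s * pd j f (upd i p (al s * crd i p + be s)))).
- by apply: continuous_avg_integrand => //; exact: smooth_continuous.
- by apply: continuous_avg_integrand => //; exact/smooth_continuous/smooth_pd.
- move=> s p; have := haspdM (haspd_cst j (w s)) (haspd_sub_neq (al s) (be s) ij (smooth_haspd j sf)).
  move=> /(_ p); rewrite /GRing.add /GRing.mul /=.
  by move/is_derive_eq; apply; rewrite mul0r add0r.
Qed.

Lemma smooth_avg w f : continuous w -> smooth f -> smooth (avg i al be w f).
Proof.
move=> cw sf.
apply: (@smooth_coind (fun g => exists w f, [/\ continuous w, smooth f & g = avg i al be w f])); last first.
  by exists w, f.
move=> _ [{cw}w [{sf}f [cw sf ->]]]; split.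
  apply: (@continuous_param _ (fun p s => w s * f (upd i p (al s * crd i p + be s)))).
  by apply: continuous_avg_integrand => //; exact: smooth_continuous.
move=> j; have [ij|ij] := eqVneq i j.
  subst j; eexists; first exact: haspd_avg.
  exists (w \* al), (pd i f); split => //; last exact: smooth_pd.
  by move=> s; apply: cvgM; [exact: cw|exact: cal].
eexists; first exact: haspd_avg_neq.
by exists w, (pd j f); split => //; exact: smooth_pd.
Qed.
End Avg.

Lemma Rint_FTC (F f : R -> R) (a b : R) : a < b ->
  (forall x : R, is_derive x (1 : R) F (f x)) -> continuous f ->
  \int[leb]_(s in `[a, b]) f s = F b - F a.
Proof.
move=> ab Ff cf; rewrite /Rintegral.
have cF : continuous F := continuous_is_derive Ff.
rewrite (@continuous_FTC2 _ f F)//.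
- exact: continuous_subspaceT.
- split; first by move=> x _; have [] := Ff x.
  + by apply: cvg_at_right_filter; exact: cF.
  + by apply: cvg_at_left_filter; exact: cF.
- by move=> x _; rewrite derive1E; have [] := Ff x.
Qed.

(** The primitive along the i-th coordinate, scaled to the fixed interval
    [0, 1] so that it is an average. *)
Definition prim i f : pt -> R := crd i * avg i id (fun=> 0) (fun=> 1) f.

Lemma continuous_cst (c : R) : continuous (fun _ : R => c).
Proof. by move=> x; exact: cvg_cst. Qed.

Lemma smooth_prim i f : smooth f -> smooth (prim i f).
Proof.
move=> sf; apply: smoothM; first exact: smooth_crd.
apply: smooth_avg => //; [by move=> x; exact: cvg_id|exact: continuous_cst|exact: continuous_cst].
Qed.

Lemma haspd_prim i f : smooth f -> haspd i (prim i f) f.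
Proof.
move=> sf.
have cid : continuous (@id R) by move=> x; exact: cvg_id.
have H := haspdM (haspd_crd i i)
  (haspd_avg i cid (@continuous_cst 0) (@continuous_cst 1) sf).
move=> p; have /is_derive_eq := H p; apply.
rewrite /GRing.add /GRing.mul /= eqxx mul1r.
pose g s := s * f (upd i p (s * crd i p)).
pose g' s := f (upd i p (s * crd i p)) + s * (crd i p * pd i f (upd i p (s * crd i p))).
have cline (h : pt -> R) : continuous h -> continuous (fun s : R => h (upd i p (s * crd i p))).
  move=> ch s; apply: (continuous_comp (f := fun s : R => upd i p (s * crd i p)) (g := h)); last exact: ch.
  apply: (@continuous_upd _ i _ (fun=> p)) => {}s; first exact: cvg_cst.
  by apply: cvgM; [exact: cvg_id|exact: cvg_cst].
have cf := smooth_continuous sf.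
have cf' := smooth_continuous (smooth_pd i sf).
have gg' (s : R) : is_derive s (1 : R) g (g' s).
  have h1 : is_derive s (1 : R) (fun t : R => t * crd i p) (crd i p).
    have := is_deriveM (is_derive_id s (1 : R)) (is_derive_cst (crd i p) s (1 : R)).
    by move/is_derive_eq; apply; rewrite /GRing.scale/= mulr0 add0r mulr1.
  have := @is_derive1_comp _ (fun s => f (upd i p s)) (fun t => t * crd i p) _ _ _
    (haspd_line p (s * crd i p) (smooth_haspd i sf)) h1.
  move=> h2; have := is_deriveM (is_derive_id s (1 : R)) h2.
  by move/is_derive_eq; apply; rewrite /g' /GRing.scale/=; ring.
have cg' : continuous g'.
  move=> s; apply: cvgD; first exact: cline.
  apply: cvgM; first exact: cvg_id.
  by apply: cvgM; [exact: cvg_cst|exact: cline].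
have := Rint_FTC ltr01 gg' cg'.
rewrite /g mul1r mul0r subr0 mul1r upd_crd => <-.
rewrite /avg -RintegralZl//; last first.
  apply: (@continuous_integrable01 _ (fun s => 1 * s * pd i f (upd i p (s * crd i p + 0)))).
  under eq_fun do rewrite mul1r addr0.
  by move=> s; apply: cvgM; [exact: cvg_id|exact: cline].
have i1 : leb.-integrable `[0, 1] (EFin \o (fun s => 1 * f (upd i p (s * crd i p + 0)))).
  apply: continuous_integrable01.
  under eq_fun do rewrite mul1r addr0.
  exact: cline.
have i2 : leb.-integrable `[0, 1]
    (EFin \o (fun s => crd i p * (1 * s * pd i f (upd i p (s * crd i p + 0))))).
  apply: continuous_integrable01.
  under eq_fun do rewrite mul1r addr0.
  move=> s; apply: cvgM; first exact: cvg_cst.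
  by apply: cvgM; [exact: cvg_id|exact: cline].
have := @RintegralD _ _ _ leb _ _ _ (measurable_itv _) i1 i2; move=> <-.
by apply: eq_Rintegral => s _; rewrite /g' !addr0 !mul1r mulrCA.
Qed.
End Smooth.

(** * Measure on the shell *)

Lemma sigma_finite_product_measure d1 d2 (T1 : measurableType d1)
  (T2 : measurableType d2) (R : realType)
  (m1 : {sigma_finite_measure set T1 -> \bar R})
  (m2 : {sigma_finite_measure set T2 -> \bar R}) :
  sigma_finite setT (m1 \x m2)%E.
Proof.
have /sigma_finiteP[F [TF ndF mF]] := sigma_finiteT m1.
have /sigma_finiteP[G [TG ndG mG]] := sigma_finiteT m2.
exists (fun n => F n `*` G n) => [|k].
  apply/seteqP; split=> // -[x y] _.
  have [n _ Fnx] : (\bigcup_n F n) x by rewrite -TF.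
  have [k _ Gky] : (\bigcup_n G n) y by rewrite -TG.
  exists (n + k)%N => //; split=> /=.
  - exact: (subsetPset _ _ (ndF _ _ (leq_addr k n))).
  - exact: (subsetPset _ _ (ndG _ _ (leq_addl n k))).
have [mFk Fkoo] := mF k; have [mGk Gkoo] := mG k.
split; first exact: measurableX.
by rewrite product_measure1E// lte_mul_pinfty// ge0_fin_numE.
Qed.

HB.instance Definition _ (R : realType) :=
  Measure.copy (leb2 R) (@lebesgue_measure R \x @lebesgue_measure R)%E.
HB.instance Definition _ (R : realType) :=
  Measure_isSigmaFinite.Build _ _ _ (leb2 R)
    (sigma_finite_product_measure _ _).
HB.instance Definition _ (R : realType) :=
  Measure.copy (leb3 R) (leb2 R \x @lebesgue_measure R)%E.
HB.instance Definition _ (R : realType) :=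
  Measure_isSigmaFinite.Build _ _ _ (leb3 R)
    (sigma_finite_product_measure _ _).

Section Slices.
Context d1 d2 (T1 : measurableType d1) (T2 : measurableType d2) (R : realType).
Variables (m1 : {sigma_finite_measure set T1 -> \bar R})
          (m2 : {sigma_finite_measure set T2 -> \bar R}).
Variables (A : set T1) (B : set T2) (f : T1 * T2 -> R).
Hypotheses (mA : measurable A) (mB : measurable B).
Hypothesis (If : (m1 \x m2)%E.-integrable (A `*` B) (EFin \o f)).

Let Ir : (m1 \x m2)%E.-integrable setT ((EFin \o f) \_ (A `*` B)).
Proof. by apply/(integrable_mkcond _ (measurableX mA mB)). Qed.

Lemma slice_ge0_1 : (forall x, A x -> (0 <= \int[m2]_(y in B) (f (x, y))%:E)%E) ->
  (0 <= \int[m1 \x m2]_(p in A `*` B) (f p)%:E)%E.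
Proof.
move=> H; rewrite integral_mkcond -(integral12_prod_meas1 Ir).
apply: integral_ge0 => x _; rewrite /fubini_F.
have [Ax|nAx] := pselect (A x); last first.
  rewrite integral0_eq// => y _; rewrite patchE; case: ifPn => //.
  by rewrite inE => -[].
rewrite (_ : integral _ _ _ = \int[m2]_(y in B) (f (x, y))%:E)%E; first exact: H.
rewrite [in RHS]integral_mkcond; apply: eq_integral => y _; rewrite !patchE.
have [By|nBy] := pselect (B y).
  by rewrite !mem_set//.
by rewrite !memNset// => -[].
Qed.

Lemma slice_ge0_2 : (forall y, B y -> (0 <= \int[m1]_(x in A) (f (x, y))%:E)%E) ->
  (0 <= \int[m1 \x m2]_(p in A `*` B) (f p)%:E)%E.
Proof.
move=> H; rewrite integral_mkcond -(integral21_prod_meas1 Ir).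
apply: integral_ge0 => y _; rewrite /fubini_G.
have [By|nBy] := pselect (B y); last first.
  rewrite integral0_eq// => x _; rewrite patchE; case: ifPn => //.
  by rewrite inE => -[].
rewrite (_ : integral _ _ _ = \int[m1]_(x in A) (f (x, y))%:E)%E; first exact: H.
rewrite [in RHS]integral_mkcond; apply: eq_integral => x _; rewrite !patchE.
have [Ax|nAx] := pselect (A x).
  by rewrite !mem_set//.
by rewrite !memNset// => -[].
Qed.
End Slices.

Section Box.
Context {R : realType}.
Local Notation pt := (R * R * R)%type.
Local Notation mR := (measurableTypeR R).
Local Notation leb := (@lebesgue_measure R).

Definition boxQ (c : R * R * R) (r : R) : set pt :=
  (ball c.1.1 r `*` ball c.1.2 r) `*` ball c.2 r.

Lemma open_measurable3 (U : set (mR * mR * mR)%type) : open (U : set pt) -> measurable U.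
Proof.
move=> oU.
pose C (k : rat * rat * rat * nat) : set pt :=
  boxQ (ratr k.1.1.1, ratr k.1.1.2, ratr k.1.2) k.2.+1%:R^-1.
have mC k : measurable (C k : set (mR * mR * mR)%type).
  by apply: measurableX; [apply: measurableX|]; 
    by apply: measurable_realfun.open_measurable; exact: ball_open.
rewrite (_ : U = \bigcup_k (if `[< C k `<=` U >] then C k else set0)).
  by apply: countable_bigcupT_measurable => // k; case: ifPn.
apply/seteqP; split; last first.
  by move=> p [k _]; case: ifPn => // /asboolP; exact.
move=> p Up; have /nbhs_ballP[e /= e0 eU] : nbhs p U by exact: open_nbhs_nbhs.
have [n ne] : exists n : nat, n.+1%:R^-1 < e / 2.
  have [n _ Hn] := @near_infty_natSinv_lt R (PosNum (divr_gt0 e0 (ltr0n _ 2))).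
  by exists n; exact: (Hn n (leqnn n)).
have rq (x : R) : exists q : rat, `|ratr q - x| < n.+1%:R^-1.
  have xx : x - n.+1%:R^-1 < x + n.+1%:R^-1.
    by rewrite ltrBlDr -addrA ltrDl addr_gt0// invr_gt0.
  have [q] := rat_in_itvoo xx; rewrite in_itv/= => /andP[h1 h2]; exists q.
  by rewrite ltr_distl h1 h2.
have [q1 h1] := rq p.1.1; have [q2 h2] := rq p.1.2; have [q3 h3] := rq p.2.
exists (q1, q2, q3, n) => //; rewrite ifT; last first.
  apply/asboolP => -[[x y] z] [[/= bx yb] bz]; apply: eU.
  have close (a b : R) (q : rat) : `|ratr q - a| < n.+1%:R^-1 -> `|ratr q - b| < n.+1%:R^-1 -> `|a - b| < e.
    move=> k1 k2; rewrite (_ : a - b = (ratr q - b) - (ratr q - a)); last by ring.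
    rewrite (le_lt_trans (ler_normB _ _))// (splitr e) ltrD//; exact: lt_trans ne.
  by split; [split|]; rewrite /ball /=; [exact: close h1 bx|exact: close h2 yb|exact: close h3 bz].
by split; [split|]; rewrite /ball /=.
Qed.

Lemma continuous_measurable3 (f : pt -> R) : continuous f ->
  measurable_fun setT (f : mR * mR * mR -> mR).
Proof.
move=> /continuousP cf; apply: (measurability _ (measurable_realfun.RGenOpens.measurableE R)).
move=> _ [_ [a [b ->] <-]]; rewrite setTI; apply: open_measurable3.
exact/cf/interval_open.
Qed.

Variables (h L : R).
Local Notation Q := (shell h L).

Lemma measurable_shell : measurable (Q : set (mR * mR * mR)%type).
Proof.
by apply: measurableX; [apply: measurableX|]; exact: measurable_itv.
Qed.

Lemma leb_itv_lty (a b : R) : (leb `[a, b] < +oo)%E.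
Proof. by rewrite lebesgue_measure_itv/=; case: ifP => _; rewrite ?ltry. Qed.

Lemma leb2_face_lty : (leb2 R (Ih h `*` `[0%R, (2 * pi)%R]) < +oo)%E.
Proof.
have -> : leb2 R (Ih h `*` `[0%R, (2 * pi)%R]) =
    (leb (Ih h) * leb `[0%R, (2 * pi)%R])%E.
  by apply: product_measure1E; exact: measurable_itv.
by apply: lte_mul_pinfty; rewrite ?ge0_fin_numE// leb_itv_lty.
Qed.

Lemma leb3_shell_lty : (leb3 R Q < +oo)%E.
Proof.
have -> : leb3 R Q = (leb2 R (Ih h `*` `[0%R, (2 * pi)%R]) * leb `[0%R, L])%E.
  by apply: product_measure1E; [apply: measurableX|]; exact: measurable_itv.
by apply: lte_mul_pinfty; rewrite ?ge0_fin_numE// ?leb2_face_lty ?leb_itv_lty.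
Qed.

Lemma compact_shell : compact (Q : set pt).
Proof.
by apply: compact_setX; [apply: compact_setX|]; exact: segment_compact.
Qed.

Lemma continuous_integrable3 (f : pt -> R) : continuous f ->
  (leb3 R).-integrable Q (EFin \o f).
Proof.
move=> cf; apply: measurable_bounded_integrable.
- exact: measurable_shell.
- exact: leb3_shell_lty.
- by apply: measurable_funS (continuous_measurable3 cf).
- have [M M0 HM] := compact_bound compact_shell cf.
  exists M; split; first exact: num_real.
  by move=> N MN p Qp; apply: (le_trans (HM p Qp)); exact: ltW.
Qed.
End Box.

(** * Integration over the shell *)

Section BoxIntegral.
Context {R : realType}.
Local Notation pt := (R * R * R)%type.
Local Notation mR := (measurableTypeR R).
Local Notation leb := (@lebesgue_measure R).
Variables (h L : R).
Local Notation Q := (shell h L).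
Implicit Types (f g : pt -> R) (p : pt) (i j : 'I_3).

Definition Ibox f : R := Rintegral (leb3 R) Q f.
Local Notation I := Ibox.

Definition lo i : R := if i == ri then 1 - h / 2 else 0.
Definition hi i : R :=
  if i == ri then 1 + h / 2 else if i == ti then 2 * pi else L.

Lemma IboxD f g : continuous f -> continuous g -> I (f + g) = I f + I g.
Proof.
by move=> cf cg; apply: RintegralD;
  [exact: measurable_shell|exact: continuous_integrable3|exact: continuous_integrable3].
Qed.

Lemma IboxZ (c : R) f : continuous f -> I ((fun=> c) * f) = c * I f.
Proof.
by move=> cf; apply: RintegralZl; [exact: measurable_shell|exact: continuous_integrable3].
Qed.

Lemma IboxN f : continuous f -> I (- f) = - I f.
Proof.
move=> cf; rewrite -[RHS]mulN1r -IboxZ//; congr I; apply/funext => p.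
by rewrite -[LHS]mulN1r.
Qed.

Lemma Ibox_ge0 f : (forall p, Q p -> 0 <= f p) -> 0 <= I f.
Proof. by move=> H; apply: Rintegral_ge0. Qed.

Lemma le_Ibox f g : continuous f -> continuous g ->
  (forall p, Q p -> f p <= g p) -> I f <= I g.
Proof.
by move=> cf cg fg; apply: le_Rintegral => //;
  [exact: measurable_shell|exact: continuous_integrable3|exact: continuous_integrable3].
Qed.

Lemma Rintegral_EFin_ge0 (D : set mR) (f : R -> R) :
  leb.-integrable D (EFin \o f) -> measurable D ->
  0 <= \int[leb]_(s in D) f s -> (0 <= \int[leb]_(s in D) (f s)%:E)%E.
Proof.
move=> If mD; rewrite -lee_fin => H; apply: le_trans H _.
rewrite /Rintegral fineK//; exact: integrable_fin_num.
Qed.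

Lemma continuous_integrable_itv (f : R -> R) (a b : R) : continuous f ->
  leb.-integrable `[a, b] (EFin \o f).
Proof.
move=> cf; apply: continuous_compact_integrable; first exact: segment_compact.
exact: continuous_subspaceT.
Qed.

Lemma continuous_line i p f : continuous f -> continuous (fun s => f (upd i p s)).
Proof.
move=> cf s; apply: (continuous_comp (f := fun s : R => upd i p s) (g := f)); last exact: cf.
by apply: (@continuous_upd _ i _ (fun=> p)) => {}s; [exact: cvg_cst|exact: cvg_id].
Qed.

Lemma integrable_slice2 f (z : R) : continuous f ->
  (leb2 R).-integrable (Ih h `*` `[0, 2 * pi]) (EFin \o (fun q : R * R => f (q, z))).
Proof.
move=> cf.
have mA : measurable (Ih h `*` `[0, 2 * pi] : set (mR * mR)%type).
  by apply: measurableX; exact: measurable_itv.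
apply: measurable_bounded_integrable => //.
- exact: leb2_face_lty.
- apply: (@measurable_funS _ _ _ _ setT) => //.
  apply: (measurableT_comp (continuous_measurable3 cf)).
  exact: measurable_fun_pair.
- have cK : compact (Ih h `*` `[0, 2 * pi] : set (R * R)) by apply: compact_setX; exact: segment_compact.
  have cfz : continuous (fun q : R * R => f (q, z)).
    move=> q; apply: (continuous_comp (f := fun q : R * R => (q, z)) (g := f)); last exact: cf.
    by apply: continuous_pair; [exact: cvg_id|exact: cvg_cst].
  have [M M0 HM] := compact_bound cK cfz.
  exists M; split; first exact: num_real.
  by move=> N MN q Qq; apply: (le_trans (HM q Qq)); exact: ltW.
Qed.

(** The box integral is an iterated integral, which may be started in any
    coordinate. This form gives the fundamental theorem of calculus on the box
    and all one-dimensional inequalities used on it. *)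
Lemma Ibox_slice_ge0 i f : continuous f ->
  (forall p, 0 <= \int[leb]_(s in `[lo i, hi i]) f (upd i p s)) -> 0 <= I f.
Proof.
move=> cf H; apply: fine_ge0.
have H' p : (0 <= \int[leb]_(s in `[lo i, hi i]) (f (upd i p s))%:E)%E.
  apply: Rintegral_EFin_ge0 (H p); last exact: measurable_itv.
  exact/continuous_integrable_itv/continuous_line.
have mI (a b : R) : measurable (`[a, b] : set mR) by exact: measurable_itv.
have mA : measurable (Ih h `*` `[0, 2 * pi] : set (mR * mR)%type).
  by apply: measurableX; exact: measurable_itv.
have i3 := continuous_integrable3 h L cf.
move: H'; case: (ord3P i) => -> /= H'.
- apply: (slice_ge0_2 mA (mI _ _) i3) => z _.
  apply: (slice_ge0_2 (mI _ _) (mI _ _) (integrable_slice2 z cf)) => t _.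
  exact: (H' ((0, t), z)).
- apply: (slice_ge0_2 mA (mI _ _) i3) => z _.
  apply: (slice_ge0_1 (mI _ _) (mI _ _) (integrable_slice2 z cf)) => x _.
  exact: (H' ((x, 0), z)).
- apply: (slice_ge0_1 mA (mI _ _) i3) => q _.
  exact: (H' (q, 0)).
Qed.

Hypotheses (h_gt0 : 0 < h) (L_gt0 : 0 < L).

Lemma lo_lt_hi i : lo i < hi i.
Proof.
case: (ord3P i) => ->; rewrite /lo /hi /=; last by [].
- by rewrite ltrD2l gtrN// divr_gt0.
- by rewrite mulr_gt0// pi_gt0.
Qed.

Lemma Ibox_pd i f : smooth f ->
  (forall p, f (upd i p (hi i)) = f (upd i p (lo i))) -> I (pd i f) = 0.
Proof.
move=> sf bc.
have cf' := smooth_continuous (smooth_pd i sf).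
have E p : \int[leb]_(s in `[lo i, hi i]) pd i f (upd i p s) = 0.
  have dF (x : R) : is_derive x (1 : R) (fun s => f (upd i p s)) (pd i f (upd i p x)).
    exact: haspd_line (smooth_haspd i sf).
  rewrite (Rint_FTC (lo_lt_hi i) dF); first by rewrite bc subrr.
  exact: continuous_line.
apply/eqP; rewrite eq_le; apply/andP; split.
  rewrite -oppr_ge0 -IboxN//; apply: (@Ibox_slice_ge0 i) => [p|p].
    by apply: cvgN; exact: cf'.
  rewrite (_ : Rintegral _ _ _ = - \int[leb]_(s in `[lo i, hi i]) pd i f (upd i p s)).
    by rewrite E oppr0.
  rewrite -[RHS]mulN1r -RintegralZl//.
  - by apply: eq_Rintegral => s _; rewrite mulN1r.
  - exact/continuous_integrable_itv/continuous_line.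
by apply: (@Ibox_slice_ge0 i) => // p; rewrite E.
Qed.

End BoxIntegral.

(** * Partial derivatives of smooth periodic functions *)

Section PdCalculus.
Context {R : realType}.
Local Notation pt := (R * R * R)%type.
Implicit Types (f g : pt -> R) (p : pt) (i j : 'I_3).

Definition kst (c : R) : pt -> R := fun=> c.

Lemma pdD i f g : smooth f -> smooth g -> pd i (f + g) = pd i f + pd i g.
Proof. by move=> sf sg; apply: haspdE; apply: haspdD; exact: smooth_haspd. Qed.

Lemma pdN i f : smooth f -> pd i (- f) = - pd i f.
Proof. by move=> sf; apply: haspdE; apply: haspdN; exact: smooth_haspd. Qed.

Lemma pdM i f g : smooth f -> smooth g -> pd i (f * g) = pd i f * g + f * pd i g.
Proof. by move=> sf sg; apply: haspdE; apply: haspdM; exact: smooth_haspd. Qed.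

Lemma pd_kst i c : pd i (kst c) = 0.
Proof. exact/haspdE/haspd_cst. Qed.

Lemma pd_nat i n : pd i (n%:R : pt -> R) = 0.
Proof.
have -> : (n%:R : pt -> R) = kst n%:R; last exact: pd_kst.
by elim: n => // n IH; rewrite -[in LHS]natr1 IH; apply/funext => p; rewrite /kst -natr1.
Qed.

Lemma smooth_nat n : smooth (n%:R : pt -> R).
Proof.
have -> : (n%:R : pt -> R) = kst n%:R; last exact: smooth_cst.
by elim: n => // n IH; rewrite -[in LHS]natr1 IH; apply/funext => p; rewrite /kst -natr1.
Qed.

Lemma pd_crd i j : pd i (crd j : pt -> R) = (i == j)%:R.
Proof.
rewrite (haspdE (@haspd_crd R i j)); case: eqP => _ //=.
Qed.

Lemma pd_sub_neq i j a b f : i != j -> smooth f ->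
  pd j (sub i a b f) = sub i a b (pd j f).
Proof. by move=> ij sf; apply/haspdE/haspd_sub_neq => //; exact: smooth_haspd. Qed.

Lemma pd_sub i a b f : smooth f -> pd i (sub i a b f) = kst a * sub i a b (pd i f).
Proof. by move=> sf; apply/haspdE/haspd_sub/smooth_haspd. Qed.

Lemma haspd0_line i f p (s t : R) : haspd i f 0 -> f (upd i p s) = f (upd i p t).
Proof.
move=> f0; apply: (is_derive_0_is_cst (f := fun s => f (upd i p s))) => x.
exact: (haspd_line p x f0).
Qed.

(** Symmetry of second derivatives: along the i-th coordinate, f is the
    primitive of its derivative plus a function of the other coordinates, and
    the primitive may be differentiated under the integral sign. *)
Lemma pdC i j f : smooth f -> pd i (pd j f) = pd j (pd i f).
Proof.
move=> sf; have [->//|ij] := eqVneq i j.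
have spf := smooth_pd i sf.
have decomp : f = prim i (pd i f) + sub i 0 0 f.
  pose D := f - prim i (pd i f).
  have sD : smooth D by apply: smoothD => //; apply/smoothN/smooth_prim.
  have D0 : haspd i D 0.
    rewrite -(_ : pd i f - pd i f = 0); last by rewrite subrr.
    by apply: haspdD; [exact: smooth_haspd|apply: haspdN; exact: haspd_prim].
  apply/funext => p; have := haspd0_line p (crd i p) 0 D0; rewrite upd_crd.
  have P0 : prim i (pd i f) (upd i p 0) = 0.
    by change (crd i (upd i p 0) * avg i id (fun=> 0) (fun=> 1) (pd i f) (upd i p 0) = 0);
      rewrite crd_upd mul0r.
  change (f p - prim i (pd i f) p = f (upd i p 0) - prim i (pd i f) (upd i p 0) ->
    f p = prim i (pd i f) p + f (upd i p (0 * crd i p + 0))).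
  by rewrite P0 subr0 mul0r addr0 => <-; rewrite addrC subrK.
have cid : continuous (@id R) by move=> x; exact: cvg_id.
have dj : pd j f = prim i (pd j (pd i f)) + sub i 0 0 (pd j f).
  rewrite {1}decomp pdD//; [|exact: smooth_prim|exact: smooth_sub].
  rewrite pd_sub_neq//; congr (_ + _); rewrite /prim.
  apply: haspdE.
  have := haspdM (haspd_crd j i) (haspd_avg_neq cid (@continuous_cst R 0) ij (@continuous_cst R 1) spf).
  rewrite eq_sym (negbTE ij) => H p; have /is_derive_eq := H p; apply.
  by rewrite /GRing.add /GRing.mul /= mul0r add0r.
rewrite {1}dj pdD; last first.
- exact/smooth_sub/smooth_pd.
- exact/smooth_prim/smooth_pd.
rewrite pd_sub; last exact: smooth_pd.
rewrite (haspdE (haspd_prim i (smooth_pd j spf))).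
by apply/funext => p; rewrite /GRing.add /GRing.mul /= /kst mul0r addr0.
Qed.

Notation sm := (@smooth_periodic R).

Lemma sm_smooth f : sm f -> smooth f.
Proof. by case. Qed.

Lemma sm_per f p : sm f -> f (upd ti p (crd ti p + 2 * pi)) = f p.
Proof. by case: p => -[x t] z [+ _]; apply. Qed.

Lemma mk_sm f : smooth f -> (forall p, f (upd ti p (crd ti p + 2 * pi)) = f p) -> sm f.
Proof. by move=> sf pf; split => // r t z; exact: (pf ((r, t), z)). Qed.

Lemma smD f g : sm f -> sm g -> sm (f + g).
Proof.
move=> sf sg; apply: mk_sm => [|p]; first by apply: smoothD; exact: sm_smooth.
by rewrite [LHS]/GRing.add /= !sm_per.
Qed.

Lemma smM f g : sm f -> sm g -> sm (f * g).
Proof.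
move=> sf sg; apply: mk_sm => [|p]; first by apply: smoothM; exact: sm_smooth.
by rewrite [LHS]/GRing.mul /= !sm_per.
Qed.

Lemma smN f : sm f -> sm (- f).
Proof.
move=> sf; apply: mk_sm => [|p]; first by apply: smoothN; exact: sm_smooth.
by rewrite [LHS]/GRing.opp /= !sm_per.
Qed.

Lemma smB f g : sm f -> sm g -> sm (f - g).
Proof. by move=> sf sg; apply: smD => //; exact: smN. Qed.

Lemma sm_kst c : sm (kst c).
Proof. by apply: mk_sm => //; exact: smooth_cst. Qed.

Lemma sm_nat n : sm n%:R.
Proof.
apply: mk_sm => [|p]; first exact: smooth_nat.
have -> : (n%:R : pt -> R) = kst n%:R by elim: n => // n IH; rewrite -[in LHS]natr1 IH; apply/funext => q; rewrite /kst -natr1.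
by [].
Qed.

Lemma sm_comp_crd j (u : R -> R) : j != ti -> smooth1 u -> sm (u \o crd j).
Proof.
move=> jt su; apply: mk_sm => [|p]; first exact: smooth_comp_crd.
by rewrite /= crd_upd_neq.
Qed.

Lemma sm_crd j : j != ti -> sm (crd j).
Proof. by move=> jt; exact: (@sm_comp_crd j id jt smooth1_id). Qed.

Lemma sm_sub i a b f : i != ti -> sm f -> sm (sub i a b f).
Proof.
move=> it sf; apply: mk_sm => [|p]; first exact/smooth_sub/sm_smooth.
rewrite /sub crd_upd_neq// upd_comm//.
set q := upd i p _; rewrite -(@sm_per f q sf); congr (f (upd _ _ (_ + _))).
by rewrite /q crd_upd_neq// eq_sym.
Qed.

Lemma per_shift f p t : sm f -> f (upd ti p (t + 2 * pi)) = f (upd ti p t).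
Proof. by move=> sf; have := @sm_per f (upd ti p t) sf; rewrite crd_upd upd_upd. Qed.

Lemma sm_pd i f : sm f -> sm (pd i f).
Proof.
move=> sf; apply: mk_sm => [|p]; first exact/smooth_pd/sm_smooth.
have df := smooth_haspd i (sm_smooth sf).
have [it|it] := eqVneq i ti.
  subst i.
  have h1 := haspd_line p (crd ti p + 2 * pi) df.
  have h2 : is_derive (crd ti p) (1 : R) (fun t : R => t + 2 * pi) 1.
    have := is_deriveD (is_derive_id (crd ti p) (1 : R)) (is_derive_cst (2 * pi : R) (crd ti p) (1:R)).
    by move/is_derive_eq; apply; rewrite addr0.
  have h3 := @is_derive1_comp _ (fun t => f (upd ti p t)) (fun t => t + 2 * pi) _ _ _ h1 h2.
  have E : (fun t => f (upd ti p t)) \o (fun t => t + 2 * pi) = (fun t => f (upd ti p t)).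
    by apply/funext => t /=; rewrite per_shift.
  rewrite E mulr1 in h3; have [_ e1] := h3; have [_ e2] := df p.
  exact: etrans (esym e1) e2.
have E : (fun t => f (upd i (upd ti p (crd ti p + 2 * pi)) t)) = (fun t => f (upd i p t)).
  apply/funext => t; rewrite upd_comm//.
  set q := upd i p t; rewrite -(@sm_per f q sf).
  by congr (f (upd _ _ (_ + _))); rewrite /q crd_upd_neq// eq_sym.
by rewrite !pdE crd_upd_neq// E.
Qed.

End PdCalculus.
Notation sm := (@smooth_periodic _).

(** * Inner product and integration by parts *)

Section BoxNorm.
Context {R : realType}.
Local Notation pt := (R * R * R)%type.
Local Notation leb := (@lebesgue_measure R).
Variables (h L : R).
Hypotheses (h_gt0 : 0 < h) (L_gt0 : 0 < L).
Local Notation Q := (shell h L).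
Local Notation I := (Ibox h L).
Implicit Types (f g : pt -> R) (p : pt) (i j : 'I_3).

Lemma sm_cont f : sm f -> continuous f.
Proof. by move=> sf; exact/smooth_continuous/sm_smooth. Qed.
Hint Resolve sm_cont : core.

Definition ip f g : R := I (f * g).
Definition nrm f : R := Num.sqrt (ip f f).

Lemma ipC f g : ip f g = ip g f.
Proof. by rewrite /ip mulrC. Qed.

Lemma ipDl f g k : sm f -> sm g -> sm k -> ip (f + g) k = ip f k + ip g k.
Proof. by move=> sf sg sk; rewrite /ip mulrDl IboxD//; apply/sm_cont/smM. Qed.

Lemma ipNl f g : sm f -> sm g -> ip (- f) g = - ip f g.
Proof. by move=> sf sg; rewrite /ip mulNr IboxN//; apply/sm_cont/smM. Qed.

Lemma ipZl c f g : sm f -> sm g -> ip (kst c * f) g = c * ip f g.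
Proof. by move=> sf sg; rewrite /ip -mulrA IboxZ//; apply/sm_cont/smM. Qed.

Lemma ipDr f g k : sm f -> sm g -> sm k -> ip k (f + g) = ip k f + ip k g.
Proof. by move=> sf sg sk; rewrite ![ip k _]ipC ipDl. Qed.

Lemma ipNr f g : sm f -> sm g -> ip g (- f) = - ip g f.
Proof. by move=> sf sg; rewrite ![ip g _]ipC ipNl. Qed.

Lemma ipZr c f g : sm f -> sm g -> ip g (kst c * f) = c * ip g f.
Proof. by move=> sf sg; rewrite ![ip g _]ipC ipZl. Qed.

Lemma ip_ge0 f : 0 <= ip f f.
Proof. by apply: Ibox_ge0 => p _; exact: sqr_ge0. Qed.

Lemma nrm_ge0 f : 0 <= nrm f. Proof. exact: sqrtr_ge0. Qed.

Lemma nrmE f : nrm f ^+ 2 = ip f f.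
Proof. by rewrite sqr_sqrtr// ip_ge0. Qed.

Lemma cauchy_schwarz f g : sm f -> sm g -> `|ip f g| <= nrm f * nrm g.
Proof.
move=> sf sg.
have quad a b : 0 <= a ^+ 2 * ip f f + 2 * a * b * ip f g + b ^+ 2 * ip g g.
  have := ip_ge0 (kst a * f + kst b * g).
  have sa : sm (kst a * f) by apply: smM => //; exact: sm_kst.
  have sb : sm (kst b * g) by apply: smM => //; exact: sm_kst.
  rewrite ipDl// ?ipDr// ?ipZl// ?ipZr//; last exact: smD.
  by rewrite [ip g f]ipC => H; apply: le_trans H _; rewrite le_eqVlt; apply/orP; left; apply/eqP; ring.
suff H : ip f g ^+ 2 <= ip f f * ip g g.
  rewrite -(ler_pXn2r (_ : 0 < 2)%N)// ?nnegrE//; last by rewrite mulr_ge0// nrm_ge0.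
  by rewrite exprMn !nrmE real_normK// num_real.
have [G0|G0] := eqVneq (ip g g) 0.
  have [->|N0] := eqVneq (ip f g) 0; first by rewrite expr0n/= mulr_ge0// ip_ge0.
  have := quad 1 (- (ip f f + 1) / ip f g).
  rewrite G0 mulr0 addr0 expr1n mul1r mulr1.
  rewrite (_ : 2 * (- (ip f f + 1) / ip f g) * ip f g = - 2 * (ip f f + 1)); last by field.
  by have := ip_ge0 f; lra.
have Gp : 0 < ip g g by rewrite lt_def G0 ip_ge0.
have := quad (ip g g) (- ip f g).
rewrite (_ : _ + _ = ip g g * (ip f f * ip g g - ip f g ^+ 2)); last by ring.
by rewrite pmulr_rge0// subr_ge0.
Qed.

Lemma ip_le f g : sm f -> sm g -> ip f g <= nrm f * nrm g.
Proof. by move=> sf sg; apply: le_trans (ler_norm _) (cauchy_schwarz sf sg). Qed.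

Lemma nrmD f g : sm f -> sm g -> nrm (f + g) <= nrm f + nrm g.
Proof.
move=> sf sg.
rewrite -(ler_pXn2r (_ : 0 < 2)%N)// ?nnegrE// ?addr_ge0// ?nrm_ge0//.
rewrite nrmE ipDl// ?ipDr//; last exact: smD.
rewrite sqrrD !nrmE [ip g f]ipC; have := ip_le sf sg; lra.
Qed.

Lemma nrmN f : nrm (- f) = nrm f.
Proof. by rewrite /nrm /ip mulrNN. Qed.

Lemma nrmB f g : sm f -> sm g -> nrm (f - g) <= nrm f + nrm g.
Proof. by move=> sf sg; rewrite -(nrmN g); apply: nrmD => //; exact: smN. Qed.

Lemma nrmZ c f : sm f -> nrm (kst c * f) = `|c| * nrm f.
Proof.
move=> sf; have sc : sm (kst c * f) by apply: smM => //; exact: sm_kst.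
by rewrite /nrm ipZl// ipZr// mulrA -expr2 sqrtrM ?sqr_ge0// sqrtr_sqr.
Qed.

Lemma kst_nat n : (n%:R : pt -> R) = kst n%:R.
Proof. by elim: n => // n IH; rewrite -[in LHS]natr1 IH; apply/funext => q; rewrite /kst -natr1. Qed.

Lemma nrm_natM n f : sm f -> nrm (n%:R * f) = n%:R * nrm f.
Proof. by move=> sf; rewrite kst_nat nrmZ// ger0_norm. Qed.

Lemma ip_weight_le (om : pt -> R) (c : R) f g : sm om -> 0 <= c ->
  (forall p, Q p -> `|om p| <= c) -> sm f -> sm g ->
  ip (om * f) g <= c * (nrm f * nrm g).
Proof.
move=> so c0 oc sf sg.
have sof : sm (om * f) by exact: smM.
apply: le_trans (ip_le sof sg) _; rewrite mulrA ler_wpM2r ?nrm_ge0//.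
rewrite -(ler_pXn2r (_ : 0 < 2)%N)// ?nnegrE// ?mulr_ge0// ?nrm_ge0//.
rewrite nrmE exprMn nrmE -[leRHS]IboxZ//; last exact/sm_cont/smM.
apply: le_Ibox; first exact/sm_cont/smM.
  by apply: sm_cont; apply: smM; [exact: sm_kst|exact: smM].
move=> p /oc op; rewrite /GRing.mul /=.
rewrite (_ : om p * f p * (om p * f p) = om p ^+ 2 * (f p * f p)); last by ring.
rewrite ler_wpM2r//; first exact: sqr_ge0.
by rewrite -(real_normK (num_real (om p))) lerXn2r ?nnegrE.
Qed.

Definition vanish (e : R) f := forall x t, f ((x, t), e) = 0.

Definition admissible i f g :=
  i = ti \/ (i = zi /\ (vanish 0 f \/ vanish 0 g) /\ (vanish L f \/ vanish L g)).

(** In the angle the boundary terms cancel by periodicity; along the axis one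
    of the two factors has to vanish at each end. *)
Lemma ibp i f g : sm f -> sm g -> admissible i f g ->
  ip (pd i f) g = - ip f (pd i g).
Proof.
move=> sf sg a.
have sfg : sm (f * g) by exact: smM.
have : I (pd i (f * g)) = 0.
  apply: Ibox_pd => //; first exact: sm_smooth.
  move=> p; case: a => [->|[-> [[H0|H0] [H1|H1]]]]; rewrite /lo /hi /=.
  - by have := per_shift p 0 sfg; rewrite add0r.
  - by case: p => -[x t] z; rewrite /upd /= /GRing.mul /= H0 H1 !mul0r.
  - by case: p => -[x t] z; rewrite /upd /= /GRing.mul /= H0 H1 mulr0 mul0r.
  - by case: p => -[x t] z; rewrite /upd /= /GRing.mul /= H0 H1 mulr0 mul0r.
  - by case: p => -[x t] z; rewrite /upd /= /GRing.mul /= H0 H1 !mulr0.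
rewrite pdM; [|exact: sm_smooth|exact: sm_smooth].
rewrite IboxD; last 2 first.
- by apply/sm_cont/smM => //; exact: sm_pd.
- by apply/sm_cont/smM => //; exact: sm_pd.
by move/eqP; rewrite addr_eq0 => /eqP.
Qed.

Lemma vanishMr e f g : vanish e g -> vanish e (f * g).
Proof. by move=> H x t; rewrite /GRing.mul /= H mulr0. Qed.
Lemma vanishD e f g : vanish e f -> vanish e g -> vanish e (f + g).
Proof. by move=> H1 H2 x t; rewrite /GRing.add /= H1 H2 addr0. Qed.
Lemma vanishN e f : vanish e f -> vanish e (- f).
Proof. by move=> H1 x t; rewrite /GRing.opp /= H1 oppr0. Qed.
Lemma vanish_sub e a b f : vanish e f -> vanish e (sub ri a b f).
Proof. by move=> H x t; rewrite /sub /upd /=. Qed.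
Lemma vanish_pd e i f : i != zi -> vanish e f -> vanish e (pd i f).
Proof.
move=> iz H x t; rewrite pdE.
rewrite (_ : (fun s => _) = cst 0); first by rewrite derive_cst.
apply/funext => s; move: iz; case: (ord3P i) => -> //= _; exact: H.
Qed.

Definition contr (xb : R) f := sub ri 2^-1 (2^-1 * xb) f.

Lemma sm_contr xb f : sm f -> sm (contr xb f).
Proof. by move=> sf; exact: sm_sub. Qed.

(** The contraction maps the shell to the half of it next to the face; the
    change of variables costs a factor 2 in the squared norm. *)
Lemma nrm_contr xb f : xb = lo h ri \/ xb = hi h L ri -> sm f ->
  nrm (contr xb f) <= 2 * nrm f.
Proof.
move=> Hxb sf.
rewrite -(ler_pXn2r (_ : 0 < 2)%N)// ?nnegrE ?mulr_ge0 ?nrm_ge0// exprMn !nrmE.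
have sff : sm (f * f) by exact: smM.
suff : 0 <= I (kst 2 * (f * f) - contr xb (f * f)).
  rewrite IboxD; last 2 first.
  - by apply: sm_cont; apply: smM => //; exact: sm_kst.
  - by apply/sm_cont/smN/sm_contr.
  rewrite IboxN; last exact/sm_cont/sm_contr.
  rewrite IboxZ; last exact/sm_cont.
  have := ip_ge0 f; rewrite /ip (_ : contr xb f * contr xb f = contr xb (f * f)) //.
  by move=> H1 H2; lra.
apply: (@Ibox_slice_ge0 _ _ _ ri) => [|p].
  by apply/sm_cont/smB; [apply: smM => //; exact: sm_kst|exact: sm_contr].
set a := lo h ri; set b := hi h L ri.
have ab : a < b by exact: lo_lt_hi.
pose G s := prim ri (f * f) (upd ri p s).
have dG (x : R) : is_derive x (1 : R) G ((f * f) (upd ri p x)).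
  exact: (haspd_line p x (haspd_prim ri (sm_smooth sff))).
have cff : continuous (fun s => (f * f) (upd ri p s)) by apply: continuous_line; exact: sm_cont.
have mG u v : u <= v -> G u <= G v.
  rewrite le_eqVlt => /predU1P[->//|uv].
  rewrite -subr_ge0 -(Rint_FTC uv dG cff); apply: Rintegral_ge0 => s _.
  by rewrite /GRing.mul /=; exact: sqr_ge0.
pose k s := 2^-1 * s + 2^-1 * xb.
have dk (x : R) : is_derive x (1 : R) k 2^-1.
  have := is_deriveD (is_deriveZ 2^-1 (is_derive_id x (1 : R)))
    (is_derive_cst (2^-1 * xb) x (1 : R)).
  by move/is_derive_eq; apply; rewrite addr0 /GRing.scale/= mulr1.
pose F s := 2 * G s - 2 * G (k s).
pose F' s := 2 * (f * f) (upd ri p s) - (f * f) (upd ri p (k s)).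
have dF (x : R) : is_derive x (1 : R) F (F' x).
  have h1 := @is_derive1_comp _ G k _ _ _ (dG (k x)) (dk x).
  have h2 := is_deriveZ 2 h1.
  have h3 := is_deriveB (is_deriveZ 2 (dG x)) h2.
  by move/is_derive_eq : h3; apply; rewrite /F' /GRing.scale/=; field.
have cF' : continuous F'.
  move=> s; apply: cvgB; first by apply: cvgM; [exact: cvg_cst|exact: cff].
  apply: (continuous_comp (f := k) (g := fun s => (f * f) (upd ri p s))); last exact: cff.
  exact: (continuous_is_derive dk).
have E : \int[leb]_(s in `[a, b]) F' s = F b - F a by exact: Rint_FTC.
rewrite (_ : Rintegral _ _ _ = F b - F a); last first.
  rewrite -E; apply: eq_Rintegral => s _.
  have H : contr xb (f * f) (upd ri p s) = (f * f) (upd ri p (k s)).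
    by rewrite /contr /sub upd_upd crd_upd.
  by rewrite /F' -H.
have ma : a <= k a by rewrite /k; case: Hxb => ->; rewrite -/a -/b; lra.
have mb : k b <= b by rewrite /k; case: Hxb => ->; rewrite -/a -/b; lra.
by rewrite /F; have := mG _ _ ma; have := mG _ _ mb; lra.
Qed.

End BoxNorm.

(** * Reflection in the thickness *)

Ltac smt := lazymatch goal with
  | H : smooth_periodic ?f |- smooth_periodic ?f => exact: H
  | |- smooth_periodic (_ + _) => apply: smD; smt
  | |- smooth_periodic (- _) => apply: smN; smt
  | |- smooth_periodic (_ * _) => apply: smM; smt
  | |- smooth_periodic (pd _ _) => apply: sm_pd; smt
  | |- smooth_periodic (contr _ _) => apply: sm_contr; smt
  | |- smooth_periodic (kst _) => exact: sm_kst
  | |- smooth_periodic (_%:R) => exact: sm_nat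
  | |- smooth_periodic (crd _) => exact: sm_crd
  end.
Ltac smo := lazymatch goal with
  | |- smooth_periodic _ => smt
  | |- smooth _ => apply: sm_smooth; smt
  | |- continuous _ => apply: sm_cont; smt
  | |- _ => apply: sm_cont; smt
  end.

Section Reflection.
Context {R : realType}.
Local Notation pt := (R * R * R)%type.

Lemma fmulE (f g : pt -> R) p : (f * g) p = f p * g p. Proof. by []. Qed.
Lemma faddE (f g : pt -> R) p : (f + g) p = f p + g p. Proof. by []. Qed.
Lemma foppE (f : pt -> R) p : (- f) p = - f p. Proof. by []. Qed.

Variables (h L : R).
Hypotheses (h_gt0 : 0 < h) (L_gt0 : 0 < L).
Local Notation Q := (shell h L).
Local Notation I := (Ibox h L).
Local Notation ip := (ip h L).
Local Notation nrm := (nrm h L).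
Implicit Types (f g m q c P : pt -> R) (p : pt) (i j : 'I_3).

Lemma contrD b f g : contr b (f + g) = contr b f + contr b g. Proof. by []. Qed.
Lemma pd_contr_neq b i f : i != ri -> smooth f -> pd i (contr b f) = contr b (pd i f).
Proof. by move=> ir sf; rewrite pd_sub_neq// eq_sym. Qed.

Lemma pd_contr b f : smooth f -> pd ri (2%:R * contr b f) = contr b (pd ri f).
Proof.
move=> sf; rewrite pdM; [|exact: smooth_nat|exact: smooth_sub].
rewrite pd_nat mul0r add0r pd_sub// kst_nat; apply/funext => p.
rewrite /GRing.mul /= /kst /contr mulrA divff ?mul1r//.
Qed.

Lemma vanish_contr e b f : vanish e f -> vanish e (contr b f).
Proof. by move=> H; exact: vanish_sub. Qed.

(** The two combinations that continue a displacement across the face r = b: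
    they agree with it on the face, and their shear strain is again a
    combination of values of the shear strain. *)
Definition refl_n b m := 3%:R * m - 2%:R * contr b m.
Definition refl_t b q := 4%:R * contr b q - 3%:R * q.
Definition jump b m q := m * q - refl_n b m * refl_t b q.

Lemma sm_refl_n b m : sm m -> sm (refl_n b m). Proof. by move=> ?; rewrite /refl_n; smt. Qed.
Lemma sm_refl_t b m : sm m -> sm (refl_t b m). Proof. by move=> ?; rewrite /refl_t; smt. Qed.

Lemma pd_refl_n b m : sm m -> pd ri (refl_n b m) = 3%:R * pd ri m - contr b (pd ri m).
Proof.
move=> sm_m; rewrite /refl_n pdD; [|smo|smo].
rewrite pdN; last smo.
rewrite pd_contr; last smo.
by rewrite pdM; [|smo|smo]; rewrite pd_nat mul0r add0r.
Qed.

Lemma pd_refl_n_neq b i m : i != ri -> sm m -> pd i (refl_n b m) = refl_n b (pd i m).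
Proof.
move=> ir sm_m; rewrite /refl_n pdD; [|smo|smo].
rewrite pdN; last smo.
do 2 (rewrite pdM; [|smo|smo]); rewrite !pd_nat !mul0r !add0r.
by rewrite pd_contr_neq//; smo.
Qed.

Lemma pd_refl_t b q : sm q -> pd ri (refl_t b q) = 2%:R * contr b (pd ri q) - 3%:R * pd ri q.
Proof.
move=> sq; rewrite /refl_t.
rewrite (_ : 4%:R * contr b q = 2%:R * (2%:R * contr b q)); last by ring.
rewrite pdD; [|smo|smo].
rewrite pdN; last smo.
rewrite pdM; [|smo|smo].
rewrite pd_contr; last smo.
rewrite pdM; [|smo|smo].
by rewrite !pd_nat !mul0r !add0r.
Qed.

Lemma pd_refl_t_neq b i q : i != ri -> sm q -> pd i (refl_t b q) = refl_t b (pd i q).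
Proof.
move=> ir sq; rewrite /refl_t pdD; [|smo|smo].
rewrite pdN; last smo.
do 2 (rewrite pdM; [|smo|smo]); rewrite !pd_nat !mul0r !add0r.
by rewrite pd_contr_neq//; smo.
Qed.

Definition is_face (b s : R) (om : pt -> R) :=
  (b = lo h ri /\ s = -1 /\ om = kst (hi h L ri) - crd ri) \/
  (b = hi h L ri /\ s = 1 /\ om = crd ri - kst (lo h ri)).

Lemma is_face_end b s om : is_face b s om -> b = lo h ri \/ b = hi h L ri.
Proof. by case=> -[-> _]; [left|right]. Qed.

Lemma is_face_sm b s om : is_face b s om -> sm om.
Proof. by case=> -[_ [_ ->]]; smt. Qed.

Lemma is_face_pd b s om : is_face b s om -> pd ri om = kst s.
Proof.
case=> -[_ [-> ->]].
  rewrite pdD; [|smo|smo].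
  rewrite pdN; last smo.
  rewrite pd_kst pd_crd add0r.
  by apply/funext => p; rewrite /GRing.opp /=.
rewrite pdD; [|smo|smo].
rewrite pdN; last smo.
by rewrite pd_kst pd_crd oppr0 addr0.
Qed.

Lemma is_face_pd_neq b s om i : i != ri -> is_face b s om -> pd i om = 0.
Proof.
move=> ir; case=> -[_ [_ ->]]; (rewrite pdD; [|smo|smo]); (rewrite pdN; last smo);
by rewrite pd_kst pd_crd (negbTE ir) ?oppr0 addr0.
Qed.

Lemma is_face_bnd b s om p : is_face b s om -> Q p -> 0 <= om p <= h.
Proof.
move=> H [[/= + _] _]; rewrite /Ih /= in_itv/= => /andP[h1 h2].
case: H => -[_ [_ ->]]; rewrite /GRing.add /GRing.opp /= /kst /crd /= /lo /hi /=; lra.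
Qed.

Lemma refl_contr_face b f p : f (upd ri p b) = contr b f (upd ri p b).
Proof.
rewrite /contr /sub upd_upd crd_upd; congr (f (upd _ _ _)); lra.
Qed.

Lemma jump_face b m q p : jump b m q (upd ri p b) = 0.
Proof.
rewrite /jump /refl_n /refl_t !kst_nat.
rewrite !(faddE, foppE, fmulE) /kst -!refl_contr_face; ring.
Qed.

Lemma nrm_refl_n b m : b = lo h ri \/ b = hi h L ri -> sm m -> nrm (refl_n b m) <= 7 * nrm m.
Proof.
move=> Hb sm_m; have := nrm_contr h_gt0 L_gt0 Hb sm_m.
have s1 : sm (3%:R * m) by smt.
have s2 : sm (2%:R * contr b m) by smt.
have := nrmB h L s1 s2; rewrite !nrm_natM//; last exact: sm_contr.
rewrite /refl_n; lra.
Qed.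

Lemma nrm_refl_t b m : b = lo h ri \/ b = hi h L ri -> sm m -> nrm (refl_t b m) <= 11 * nrm m.
Proof.
move=> Hb sm_m; have := nrm_contr h_gt0 L_gt0 Hb sm_m.
have s1 : sm (3%:R * m) by smt.
have s2 : sm (4%:R * contr b m) by smt.
have := nrmB h L s2 s1; rewrite !nrm_natM//; last exact: sm_contr.
rewrite /refl_t; lra.
Qed.

(** The function jump vanishes on the face r = b and the weight om on the
    other face, so the integral of the radial derivative of their product is
    zero. With c = m + q_r and tildes for the reflected fields, jump_r = m_r q
    - m~_r q~ + m c + m~ c~ - m^2 - m~^2, and the term with m~ is absorbed by
    its square; c~ is a combination of c and its contraction. *)
Lemma reflection_half b s om m q : is_face b s om -> sm m -> sm q ->
  ip (om * m) m <= s * I (jump b m q)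
   + (ip (om * pd ri m) q - ip (om * pd ri (refl_n b m)) (refl_t b q))
   + ip (om * m) (m + pd ri q) + 13 * h * nrm (m + pd ri q) ^+ 2.
Proof.
move=> Hb sm_m sq; have so := is_face_sm Hb.
have Hend := is_face_end Hb.
set c := m + pd ri q; set mt := refl_n b m; set qt := refl_t b q.
have smt_ : sm mt by exact: sm_refl_n.
have sqt : sm qt by exact: sm_refl_t.
have sc : sm c by rewrite /c; smt.
pose ct := refl_n b c.
have sct : sm ct by exact: sm_refl_n.
have qtx : pd ri qt = mt - ct.
  rewrite pd_refl_t// /mt /ct /c /refl_n !contrD; ring.
have sD : sm (jump b m q) by rewrite /jump -/mt -/qt; smt.
have : I (pd ri (om * jump b m q)) = 0.
  apply: Ibox_pd => //; first smo.
  move=> p; rewrite !fmulE; have j0 := jump_face b m q p.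
  case: Hb => -[bE [_ omE]]; rewrite bE in j0 *.
    by rewrite omE !faddE !foppE !crd_upd j0 /kst subrr mulr0 mul0r.
  by rewrite omE !faddE !foppE !crd_upd j0 /kst subrr mulr0 mul0r.
rewrite pdM; [|smo|smo].
rewrite (is_face_pd Hb).
have -> : pd ri (jump b m q) = pd ri m * q + m * c - m * m - pd ri mt * qt - mt * mt + mt * ct.
  rewrite /jump -/mt -/qt pdD; [|smo|smo].
  rewrite pdN; last smo.
  rewrite pdM; [|smo|smo]; rewrite pdM; [|smo|smo].
  rewrite qtx /c; ring.
rewrite IboxD; [|smo|smo]; rewrite IboxZ; last smo.
have -> : om * (pd ri m * q + m * c - m * m - pd ri mt * qt - mt * mt + mt * ct)
  = ((om * pd ri m) * q - (om * pd ri mt) * qt) + (om * m) * c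
    + (om * (mt * ct - mt * mt)) - (om * m) * m by ring.
rewrite IboxD; [|smo|smo]; rewrite IboxD; [|smo|smo]; rewrite IboxD; [|smo|smo].
rewrite IboxD; [|smo|smo]; rewrite !IboxN; try smo.
have : I (om * (mt * ct - mt * mt)) <= 13 * h * nrm c ^+ 2.
  have h1 : I (om * (mt * ct - mt * mt)) <= I (kst (h / 4) * (ct * ct)).
    apply: le_Ibox; try smo; move=> p /(is_face_bnd Hb)/andP[om0 omh].
    rewrite !fmulE !faddE !foppE !fmulE /kst.
    have h2 : 0 <= (mt p - ct p / 2) ^+ 2 by exact: sqr_ge0.
    have h3 : mt p * ct p - mt p * mt p <= ct p * ct p / 4 by lra.
    have h4 : 0 <= ct p * ct p by exact: sqr_ge0.
    have h5 : om p * (mt p * ct p - mt p * mt p) <= om p * (ct p * ct p / 4) by rewrite ler_wpM2l.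
    have h6 : om p * (ct p * ct p / 4) <= h * (ct p * ct p / 4) by rewrite ler_wpM2r// divr_ge0.
    by apply: le_trans (le_trans h5 h6) _; rewrite le_eqVlt; apply/orP; left; apply/eqP; field.
  apply: le_trans h1 _; rewrite IboxZ; last smo.
  have h2 := nrm_refl_n Hend sc; have h3 := nrm_ge0 h L ct; have h4 := nrm_ge0 h L c.
  rewrite -/(Pilot.Submission.ip h L ct ct) -nrmE -/ct.
  have h5 : nrm ct ^+ 2 <= 49 * nrm c ^+ 2.
    rewrite (_ : 49 = 7 ^+ 2); last by rewrite -natrX.
    by rewrite -exprMn lerXn2r// nnegrE ?mulr_ge0.
  have h6 : 0 <= nrm c ^+ 2 by exact: sqr_ge0.
  have h7 : h / 4 * nrm ct ^+ 2 <= h / 4 * (49 * nrm c ^+ 2) by rewrite ler_wpM2l// divr_ge0// ltW.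
  by have := mulr_ge0 (ltW h_gt0) h6; lra.
rewrite (@IboxD _ _ _ (om * pd ri m * q)); try smo.
rewrite [I (- (om * pd ri mt * qt))]IboxN; last smo.
rewrite /ip; lra.
Qed.

End Reflection.

(** * A Korn inequality by reflection *)

Section KornReflection.
Context {R : realType}.
Local Notation pt := (R * R * R)%type.
Variables (h L : R).
Hypotheses (h_gt0 : 0 < h) (L_gt0 : 0 < L).
Local Notation Q := (shell h L).
Local Notation I := (Ibox h L).
Local Notation ip := (ip h L).
Local Notation nrm := (nrm h L).
Local Notation admissible := (admissible L).
Implicit Types (f g m q c P : pt -> R) (p : pt) (i j : 'I_3).

Lemma admissible_mono i f g F G : admissible i f g ->
  (forall e, vanish e f -> vanish e F) -> (forall e, vanish e g -> vanish e G) ->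
  admissible i F G.
Proof.
move=> [->|[-> [H0 HL]]] HF HG; first by left.
by right; split => //; split; [move: H0|move: HL] => -[/HF|/HG]; by [left|right].
Qed.

Lemma vanish_refl_n e b f : vanish e f -> vanish e (refl_n b f).
Proof.
move=> H; apply: vanishD; first exact: vanishMr.
by apply/vanishN/vanishMr/vanish_contr.
Qed.

Lemma vanish_refl_t e b f : vanish e f -> vanish e (refl_t b f).
Proof.
move=> H; apply: vanishD; first exact/vanishMr/vanish_contr.
by apply/vanishN/vanishMr.
Qed.

(** The weight depends on r only, so a tangential derivative passes over it.
    *)
Lemma face_weight b s om tau X Y : tau != ri -> is_face h L b s om -> sm X -> sm Y ->
  admissible tau X Y -> `|ip (om * pd tau X) Y| <= h * (nrm X * nrm (pd tau Y)).
Proof.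
move=> tr Hb sX sY aXY; have so := is_face_sm Hb.
have soX : sm (om * X) by smt.
have -> : om * pd tau X = pd tau (om * X).
  rewrite pdM; [|smo|smo].
  by rewrite (is_face_pd_neq tr Hb) mul0r add0r.
rewrite ibp//; last first.
  by apply: (admissible_mono aXY) => [e He|e He]; [exact: vanishMr|exact: He].
have s' : sm (pd tau Y) by smt.
rewrite normrN; apply: le_trans (cauchy_schwarz h L soX s') _.
have h1 : ip (om * X) (om * X) <= h * (nrm X * nrm (om * X)).
  apply: ip_weight_le => //; first exact: ltW.
  by move=> p /(is_face_bnd Hb)/andP[om0 omh]; rewrite ger0_norm.
rewrite mulrA ler_wpM2r ?nrm_ge0//.
have [->|N0] := eqVneq (nrm (om * X)) 0; first by rewrite mulr_ge0 ?nrm_ge0// ltW.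
have Np : 0 < nrm (om * X) by rewrite lt_def N0 nrm_ge0.
by rewrite -(ler_pM2r Np) -expr2 nrmE -mulrA.
Qed.

(** The two half estimates, one for each face, are added: the weights sum up
    to the constant h. As m is a tangential derivative of P, the terms m_r q
    become P_r q_tau after an integration by parts, which does not see the
    radial weight. *)
Lemma korn_reflection tau P q : tau != ri -> sm P -> sm q -> admissible tau P q ->
  nrm (pd tau P) ^+ 2 <=
    2 / h * (`|I (jump (lo h ri) (pd tau P) q)| + `|I (jump (hi h L ri) (pd tau P) q)|)
    + 224 * (nrm (pd ri P) * nrm (pd tau q)) + 53 * nrm (pd tau P + pd ri q) ^+ 2.
Proof.
move=> tr sP sq aPq.
set m := pd tau P; set c := m + pd ri q.
have smm : sm m by rewrite /m; smt.
have sc : sm c by rewrite /c; smt.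
have half b s om : is_face h L b s om -> ip (om * m) m <= `|I (jump b m q)|
    + 56 * h * (nrm (pd ri P) * nrm (pd tau q)) + ip (om * m) c + 13 * h * nrm c ^+ 2.
  move=> Hb; apply: le_trans (reflection_half h_gt0 L_gt0 Hb smm sq) _.
  rewrite -/c.
  have h1 : s * I (jump b m q) <= `|I (jump b m q)|.
    apply: le_trans (ler_norm _) _; rewrite normrM.
    by case: Hb => -[_ [-> _]]; rewrite ?normrN1 ?normr1 mul1r.
  have e1 : pd ri m = pd tau (pd ri P) by rewrite /m pdC; [|smo].
  have h2 : ip (om * pd ri m) q <= h * (nrm (pd ri P) * nrm (pd tau q)).
    rewrite e1; apply: le_trans (ler_norm _) _.
    apply: (face_weight tr Hb); [smt|exact: sq|].
    by apply: (admissible_mono aPq) => [e He|e He]; [exact: vanish_pd|exact: He].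
  have e2 : pd ri (refl_n b m) = pd tau (pd ri (refl_n b P)).
    rewrite /m -(pd_refl_n_neq _ tr sP) pdC; first by [].
    exact/sm_smooth/sm_refl_n.
  have h3 : - ip (om * pd ri (refl_n b m)) (refl_t b q) <=
      h * (nrm (pd ri (refl_n b P)) * nrm (pd tau (refl_t b q))).
    rewrite e2; apply: le_trans (ler_norm _) _; rewrite normrN.
    apply: (face_weight tr Hb).
    - exact/sm_pd/sm_refl_n.
    - exact/sm_refl_t.
    - apply: (admissible_mono aPq) => [e He|e He]; last exact: vanish_refl_t.
      by apply: vanish_pd => //; exact: vanish_refl_n.
  have h4 : nrm (pd ri (refl_n b P)) <= 5 * nrm (pd ri P).
    rewrite pd_refl_n//; have sx : sm (pd ri P) by smt.
    have s1 : sm (3%:R * pd ri P) by smt.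
    have s2 : sm (contr b (pd ri P)) by smt.
    have := nrmB h L s1 s2; rewrite nrm_natM//.
    have := nrm_contr h_gt0 L_gt0 (is_face_end Hb) sx; lra.
  have h5 : nrm (pd tau (refl_t b q)) <= 11 * nrm (pd tau q).
    rewrite pd_refl_t_neq//; apply: nrm_refl_t => //; [exact: is_face_end Hb|smt].
  have h6 : nrm (pd ri (refl_n b P)) * nrm (pd tau (refl_t b q)) <=
     5 * nrm (pd ri P) * (11 * nrm (pd tau q)) by apply: ler_pM => //; exact: nrm_ge0.
  have h7 := ler_wpM2l (ltW h_gt0) h6.
  lra.
have H1 := @half (lo h ri) (-1) (kst (hi h L ri) - crd ri) (or_introl (conj erefl (conj erefl erefl))).
have H2 := @half (hi h L ri) 1 (crd ri - kst (lo h ri)) (or_intror (conj erefl (conj erefl erefl))).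
have sumom g : sm g -> ip ((kst (hi h L ri) - crd ri) * m) g + ip ((crd ri - kst (lo h ri)) * m) g = h * ip m g.
  move=> sg; rewrite -ipDl//; try smt.
  rewrite -mulrDl (_ : kst (hi h L ri) - crd ri + (crd ri - kst (lo h ri)) = kst h).
    by rewrite ipZl.
  apply/funext => p; rewrite !(faddE, foppE) /kst /hi /lo /=; lra.
have S1 := sumom _ smm; have S2 := sumom _ sc.
have cs := ip_le h L smm sc.
have yng : nrm m * nrm c <= (nrm m ^+ 2 + nrm c ^+ 2) / 2.
  have := sqr_ge0 (nrm m - nrm c); lra.
rewrite -nrmE in S1.
have hcs := ler_wpM2l (ltW h_gt0) (le_trans cs yng).
set J := `|I (jump (lo h ri) m q)| + _.
have JE : J = _ := erefl J; rewrite {1}/J in JE; clearbody J.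
have key : h * (nrm m ^+ 2) <= h * (2 / h * J + 224 * (nrm (pd ri P) * nrm (pd tau q)) + 53 * nrm c ^+ 2).
  rewrite !mulrDr (_ : h * (2 / h * J) = 2 * J); last by field; rewrite gt_eqF.
  rewrite -JE; lra.
by rewrite ler_pM2l in key.
Qed.

Lemma jump_le b m q : b = lo h ri \/ b = hi h L ri -> sm m -> sm q ->
  `|I (jump b m q)| <= 78 * (nrm m * nrm q).
Proof.
move=> Hb smm sq.
have s1 := sm_refl_n b smm; have s2 := sm_refl_t b sq.
rewrite /jump IboxD; try smo; rewrite IboxN; last smo.
apply: le_trans (ler_normB _ _) _.
have h1 := cauchy_schwarz h L smm sq.
have h2 := cauchy_schwarz h L s1 s2.
have h3 : nrm (refl_n b m) * nrm (refl_t b q) <= 7 * nrm m * (11 * nrm q).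
  by apply: ler_pM; rewrite ?nrm_ge0//; [exact: nrm_refl_n|exact: nrm_refl_t].
rewrite /Submission.ip in h1 h2; lra.
Qed.

(** Korn's inequality for one gradient component that is a tangential
    derivative, on a layer of thickness h without boundary conditions on the
    faces. *)
Lemma korn_layer tau P q : tau != ri -> sm P -> sm q -> admissible tau P q ->
  nrm (pd tau P) ^+ 2 <= 106 * nrm (pd tau P + pd ri q) ^+ 2
    + 448 * (nrm (pd ri P) * nrm (pd tau q)) + (312 * (nrm q / h)) ^+ 2.
Proof.
move=> tr sP sq aPq; have := korn_reflection tr sP sq aPq.
set m := pd tau P; set c := nrm (m + pd ri q).
have smm : sm m by rewrite /m; smt.
have J1 := jump_le (or_introl erefl) smm sq.
have J2 := jump_le (or_intror erefl) smm sq.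
set J := `|_| + `|_|; set T := nrm _ * nrm _ => H.
have J12 : 2 / h * J <= 312 * nrm m * (nrm q / h).
  rewrite (_ : 312 * nrm m * (nrm q / h) = 2 / h * (156 * (nrm m * nrm q))); last by field; rewrite gt_eqF.
  by rewrite ler_wpM2l ?divr_ge0 ?(ltW h_gt0)// /J; lra.
have := sqr_ge0 (nrm m - 312 * (nrm q / h)); clear J1 J2.
lra.
Qed.

End KornReflection.

(** * Smoothing operators *)

Section Smoothing.
Context {R : realType}.
Local Notation pt := (R * R * R)%type.
Local Notation leb := (@lebesgue_measure R).
Variables (h L : R).
Hypotheses (h_gt0 : 0 < h) (L_gt0 : 0 < L).
Local Notation ip := (ip h L).
Local Notation nrm := (nrm h L).
Local Notation admissible := (admissible L).
Implicit Types (f g y F : pt -> R) (p : pt).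

(** The cross term in the squared norm of y + h y_theta is the integral of the
    derivative of a periodic function. *)
Lemma transport_energy y F : sm y -> sm F -> y + kst h * pd ti y = F ->
  nrm y <= nrm F /\ h * nrm (pd ti y) <= nrm F.
Proof.
move=> sy sF E.
have sy' : sm (pd ti y) by smt.
have z : ip (pd ti y) y = 0.
  have := ibp h_gt0 L_gt0 sy sy (or_introl (erefl ti)); rewrite [ip y _]ipC; lra.
have e : nrm F ^+ 2 = nrm y ^+ 2 + (h * nrm (pd ti y)) ^+ 2.
  rewrite exprMn !nrmE -E ipDl; [|smt|smt|smt]; rewrite !ipDr; try smt.
  rewrite !ipZl; try smt; rewrite !ipZr; try smt.
  by rewrite [ip y (pd ti y)]ipC z; ring.
have hy : 0 <= h * nrm (pd ti y) by rewrite mulr_ge0 ?nrm_ge0// ltW.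
split; rewrite -(ler_pXn2r (_ : 0 < 2)%N)// ?nnegrE ?nrm_ge0// e.
  by rewrite lerDl sqr_ge0.
by rewrite lerDr sqr_ge0.
Qed.

(** The periodic solution is explicit: an average of the translates of f with
    exponential weights over one period. *)
Lemma transport_solve f : sm f -> exists y, [/\ sm y, y + kst h * pd ti y = f
  & forall e, vanish e f -> vanish e y].
Proof.
move=> sf; have smf := sm_smooth sf.
have pi0 : 0 < (pi : R) by exact: pi_gt0.
pose k : R := 2 * pi / h.
have k0 : 0 < k by rewrite divr_gt0// mulr_gt0.
have ek : 0 < 1 - expR (- k) by rewrite subr_gt0 -expR0 ltr_expR oppr_lt0.
pose C : R := k / (1 - expR (- k)).
pose w (s : R) : R := expR (- k * s).
pose be (s : R) : R := - (2 * pi) * s.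
pose one (s : R) : R := 1.
have dw (s : R) : is_derive s (1 : R) w (- k * w s).
  have h1 : is_derive s (1 : R) (fun t : R => - k * t) (- k).
    have := is_deriveZ (- k) (is_derive_id s (1 : R)).
    by move/is_derive_eq; apply; rewrite /GRing.scale/= mulr1.
  have := @is_derive1_comp _ expR (fun t => - k * t) _ _ _ (is_derive_expR (- k * s)) h1.
  by move/is_derive_eq; apply; rewrite mulrC.
have cw : continuous w := continuous_is_derive dw.
have cbe : continuous be by move=> s; apply: cvgM; [exact: cvg_cst|exact: cvg_id].
have cone : continuous one by exact: continuous_cst.
pose A g := avg ti one be w g.
have sA g : smooth g -> smooth (A g) by move=> sg; exact: smooth_avg.
exists (kst C * A f); split.
- apply: mk_sm; first by apply: smoothM; [exact: smooth_cst|exact: sA].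
  move=> p; rewrite !fmulE; congr (_ * _); rewrite /A /avg.
  apply: eq_Rintegral => s _; rewrite crd_upd upd_upd; congr (_ * _).
  rewrite /one !mul1r -addrA [2 * pi + _]addrC addrA; exact: per_shift.
- have dA : pd ti (kst C * A f) = kst C * A (pd ti f).
    rewrite pdM; [|exact: smooth_cst|exact: sA].
    rewrite pd_kst mul0r add0r (haspdE (@haspd_avg R ti one be cone cbe w f cw smf)).
    by congr (_ * avg _ _ _ _ _); apply/funext => s /=; rewrite mulr1.
  rewrite dA; apply/funext => p.
  rewrite !(faddE, fmulE) /kst.
  pose G s := w s * f (upd ti p (crd ti p + be s)).
  pose G' s := - k * (w s * f (upd ti p (crd ti p + be s))) - 2 * pi * (w s * pd ti f (upd ti p (crd ti p + be s))).
  have dG (s : R) : is_derive s (1 : R) G (G' s).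
    have h1 : is_derive s (1 : R) (fun t : R => crd ti p + be t) (- (2 * pi)).
      have := is_deriveD (is_derive_cst (crd ti p) s (1 : R)) (is_deriveZ (- (2 * pi)) (is_derive_id s (1 : R))).
      by move/is_derive_eq; apply; rewrite /GRing.scale/= mulr1 add0r.
    have h2 := @is_derive1_comp _ (fun s => f (upd ti p s)) (fun t => crd ti p + be t) _ _ _
      (haspd_line p (crd ti p + be s) (smooth_haspd ti smf)) h1.
    have := is_deriveM (dw s) h2.
    by move/is_derive_eq; apply; rewrite /G' /GRing.scale/=; ring.
  have cl g : continuous g -> continuous (fun s => w s * g (upd ti p (crd ti p + be s))).
    move=> cg s; apply: cvgM; first exact: cw.
    apply: (continuous_comp (f := fun s => crd ti p + be s) (g := fun s => g (upd ti p s))).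
      by apply: cvgD; [exact: cvg_cst|exact: cbe].
    exact: continuous_line.
  have c1 := cl f (smooth_continuous smf).
  have c2 := cl (pd ti f) (smooth_continuous (smooth_pd ti smf)).
  have cG' : continuous G'.
    by move=> s; apply: cvgB; (apply: cvgM; first exact: cvg_cst); [exact: c1|exact: c2].
  have FTC := Rint_FTC ltr01 dG cG'.
  have Ef g : A g p = \int[leb]_(s in `[0, 1]) (w s * g (upd ti p (crd ti p + be s))).
    by apply: eq_Rintegral => s _; rewrite /one mul1r.
  have i1 := continuous_integrable01 c1; have i2 := continuous_integrable01 c2.
  have : \int[leb]_(s in `[0, 1]) G' s = - k * A f p - 2 * pi * A (pd ti f) p.
    rewrite !Ef -!RintegralZl//.
    rewrite -RintegralB//; apply: continuous_integrable01 => s;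
    by apply: cvgM; [exact: cvg_cst|move: s].
  have G0 : G 0 = f p by rewrite /G /w /be !mulr0 addr0 expR0 mul1r upd_crd.
  have G1 : G 1 = expR (- k) * f p.
    rewrite /G /w /be !mulr1; congr (_ * _).
    by have := @per_shift R f p (crd ti p - 2 * pi) sf; rewrite subrK upd_crd => ->.
  rewrite FTC G0 G1.
  move=> E.
  have hk : 2 * pi = h * k by rewrite /k [h * _]mulrC divfK// gt_eqF.
  have alg1 (c x1 x2 k' : R) : k' != 0 ->
      c * x1 + h * (c * x2) = - (h * c / (h * k')) * (- k' * x1 - h * k' * x2).
    by move=> k'0; field; rewrite k'0 gt_eqF.
  have alg2 (e x k' : R) : k' != 0 -> 1 - e != 0 ->
      - (h * (k' / (1 - e)) / (h * k')) * (e * x - x) = x.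
    by move=> k'0 e0; field; rewrite k'0 e0 gt_eqF.
  rewrite (alg1 _ _ _ k); last by rewrite gt_eqF.
  by rewrite -hk -E hk alg2// gt_eqF.
- move=> e He x t; rewrite fmulE /A /avg.
  rewrite (_ : Rintegral _ _ _ = 0) ?mulr0//.
  transitivity (\int[leb]_(s in `[0, 1]) (0 : R)); last exact: Rint01_cst.
  apply: eq_Rintegral => s _.
  by rewrite /upd /= He mulr0.
Qed.

(** The equation is tested with y; either boundary condition removes the
    boundary term, leaving |y|^2 + h^2 |y_z|^2 = (F, y). *)
Lemma resolvent_energy y F : sm y -> sm F -> y - kst (h ^+ 2) * pd zi (pd zi y) = F ->
  admissible zi y (pd zi y) -> nrm y <= nrm F /\ h * nrm (pd zi y) <= nrm F.
Proof.
move=> sy sF E ad.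
have sy' : sm (pd zi y) by smt.
have sy'' : sm (pd zi (pd zi y)) by smt.
have := ibp h_gt0 L_gt0 sy sy' ad; rewrite -nrmE => z.
have e : ip y F = nrm y ^+ 2 + (h * nrm (pd zi y)) ^+ 2.
  rewrite exprMn z nrmE -E ipDr; try smt.
  by rewrite ipNr; try smt; rewrite ipZr; try smt; rewrite mulrN.
have hy : 0 <= h * nrm (pd zi y) by rewrite mulr_ge0 ?nrm_ge0// ltW.
have cs := ip_le h L sy sF; rewrite e in cs.
have y0 := nrm_ge0 h L y; have F0 := nrm_ge0 h L F.
have h1 : nrm y <= nrm F.
  have [->//|N0] := eqVneq (nrm y) 0.
  have Np : 0 < nrm y by rewrite lt_def N0.
  rewrite -(ler_pM2l Np); have := sqr_ge0 (h * nrm (pd zi y)); lra.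
split => //; rewrite -(ler_pXn2r (_ : 0 < 2)%N)// ?nnegrE//.
have : nrm y * nrm F <= nrm F * nrm F by rewrite ler_wpM2r.
have := sqr_ge0 (nrm y); lra.
Qed.

Definition ends_zero f := vanish 0 f /\ vanish L f.

Lemma kstN (a : R) : - kst a = kst (- a). Proof. by []. Qed.

Lemma prim0 i f p : prim i f (upd i p 0) = 0.
Proof. by rewrite /prim fmulE crd_upd mul0r. Qed.

Lemma sm_prim f : sm f -> sm (prim zi f).
Proof.
move=> sf; apply: mk_sm; first exact/smooth_prim/sm_smooth.
move=> p; rewrite /prim !fmulE crd_upd_neq//; congr (_ * _).
apply: eq_Rintegral => s _; congr (_ * _); rewrite crd_upd_neq// upd_comm//.
by rewrite -[RHS](@sm_per R f _ sf) crd_upd_neq.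
Qed.

Lemma axial_exp (c : R) : exists e : pt -> R, [/\ sm e, pd zi e = kst c * e
  & forall q z, e (q, z) = expR (c * z)].
Proof.
exists ((fun x => expR (c * x)) \o crd zi); split => //.
  by apply: sm_comp_crd => //; exact: smooth1_exp.
have dc (x : R) : is_derive x (1 : R) (fun x => expR (c * x)) (c * expR (c * x)).
  have h1 : is_derive x (1 : R) (fun t : R => c * t) c.
    have := is_deriveZ c (is_derive_id x (1 : R)).
    by move/is_derive_eq; apply; rewrite /GRing.scale/= mulr1.
  have := @is_derive1_comp _ expR (fun t => c * t) _ _ _ (is_derive_expR (c * x)) h1.
  by move/is_derive_eq; apply; rewrite mulrC.
rewrite (haspdE (haspd_comp_crd zi zi dc)); apply/funext => p.
by rewrite fmulE /kst /= mul1r.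
Qed.

Lemma axial_prim g : sm g -> exists A : pt -> R, [/\ sm A, pd zi A = g
  & forall q, A (q, 0) = 0].
Proof.
move=> sg; exists (prim zi g); split; first exact: sm_prim.
  exact/haspdE/haspd_prim/sm_smooth.
by move=> q; have := prim0 zi g (q, 0).
Qed.

Lemma axial_freeze g (a : R) : sm g -> exists G : pt -> R, [/\ sm G, pd zi G = 0
  & forall q z, G (q, z) = g (q, a)].
Proof.
move=> sg; exists (sub zi 0 a g); split; first exact: sm_sub.
  rewrite pd_sub; last exact: sm_smooth.
  by apply/funext => p; rewrite fmulE /kst mul0r.
by move=> q z; rewrite /sub /upd /crd /= mul0r add0r.
Qed.

(** Variation of constants: e^(z/h) and e^(-z/h) times primitives, with the
    two free constants fitted to the ends. The sign sg distinguishes the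
    Neumann problem (1) from the Dirichlet problem (-1). *)
Lemma resolvent_solve (sg : R) f : sg = 1 \/ sg = -1 -> sm f ->
  exists y, [/\ sm y, y - kst (h ^+ 2) * pd zi (pd zi y) = f
  & (sg = 1 -> ends_zero (pd zi y)) /\ (sg = -1 -> ends_zero y)].
Proof.
move=> Hsg sf.
have h0 : h != 0 by rewrite gt_eqF.
have [ep [sep dep epE]] := axial_exp h^-1.
have [em [sem dem emE]] := axial_exp (- h^-1).
have epm : ep * em = 1.
  by apply/funext => -[q z]; rewrite fmulE epE emE -expRD mulNr subrr expR0.
have [b bE] : exists b : R, b = (2 * h)^-1 by exists (2 * h)^-1.
have sA0 : sm (kst b * em * f) by smt.
have sB0 : sm (kst b * ep * f) by smt.
have [A [sA dA A0]] := axial_prim sA0.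
have [B [sB dB B0]] := axial_prim sB0.
have [AL [sAL dAL ALE]] := axial_freeze L sA.
have [BL [sBL dBL BLE]] := axial_freeze L sB.
have [eL eLE] : exists eL : R, eL = expR (h^-1 * L) by exists (expR (h^-1 * L)).
have [eN eNE] : exists eN : R, eN = expR (- h^-1 * L) by exists (expR (- h^-1 * L)).
have d0 : 0 < eL - eN.
  rewrite eLE eNE subr_gt0 ltr_expR ltr_pM2r// (@lt_trans _ _ 0)//.
    by rewrite oppr_lt0 invr_gt0.
  by rewrite invr_gt0.
have [al [alE sal dal]] : exists al : pt -> R,
    [/\ forall q z, al (q, z) = (eL - eN)^-1 * (eL * A (q, L) + sg * eN * B (q, L)),
      sm al & pd zi al = 0].
  exists (kst (eL - eN)^-1 * (kst eL * AL + kst (sg * eN) * BL)); split.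
  - by move=> q z; rewrite !(fmulE, faddE) /kst ALE BLE.
  - by smt.
  - rewrite pdM; [|smo|smo]; rewrite pdD; [|smo|smo].
    rewrite pdM; [|smo|smo]; rewrite pdM; [|smo|smo].
    by rewrite !pd_kst dAL dBL !(mul0r, mulr0, addr0).
have [y1 [y1E sy1 dy1]] : exists y1 : pt -> R, [/\ y1 = ep * (al - A), sm y1
    & pd zi y1 = kst h^-1 * y1 - kst b * f].
  exists (ep * (al - A)); split; [reflexivity|smt|].
  rewrite pdM; [|smo|smo]; rewrite pdD; [|smo|smo].
  rewrite pdN; last smo.
  rewrite dep dal dA (_ : ep * (0 - kst b * em * f) = - (ep * em) * (kst b * f)); last by ring.
  rewrite epm; ring.
have [y2 [y2E sy2 dy2]] : exists y2 : pt -> R, [/\ y2 = em * (kst sg * al + B), sm y2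
    & pd zi y2 = kst (- h^-1) * y2 + kst b * f].
  exists (em * (kst sg * al + B)); split; [reflexivity|smt|].
  rewrite pdM; [|smo|smo]; rewrite pdD; [|smo|smo].
  rewrite pdM; [|smo|smo].
  rewrite dem dal dB pd_kst (_ : em * (0 * al + kst sg * 0 + kst b * ep * f) = (ep * em) * (kst b * f)); last by ring.
  rewrite epm; ring.
have dy : pd zi (y1 + y2) = kst h^-1 * (y1 - y2).
  rewrite pdD; [|smo|smo]; rewrite dy1 dy2 -kstN; ring.
have y10 q : y1 (q, 0) = al (q, 0).
  by rewrite y1E !(fmulE, faddE, foppE) epE A0 mulr0 expR0 subr0 mul1r.
have y20 q : y2 (q, 0) = sg * al (q, 0).
  by rewrite y2E !(fmulE, faddE, foppE) emE B0 mulr0 expR0 addr0 mul1r.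
have sgsg : sg * sg = 1 by case: Hsg => ->; rewrite ?mulrNN mulr1.
have yL q : y1 (q, L) = sg * y2 (q, L).
  rewrite y1E y2E !(fmulE, faddE, foppE) epE emE -eLE -eNE /kst.
  rewrite (_ : sg * (eN * (sg * al (q, L) + B (q, L))) =
    (sg * sg) * eN * al (q, L) + sg * eN * B (q, L)); last by ring.
  by rewrite sgsg alE; field; rewrite gt_eqF.
exists (y1 + y2); split; first by smt.
- rewrite dy pdM; [|smo|smo]; rewrite pd_kst mul0r add0r.
  rewrite pdD; [|smo|smo]; rewrite pdN; last smo.
  rewrite dy1 dy2; apply/funext => p; rewrite !(faddE, fmulE, foppE) /kst bE; field.
  by [].
- split=> sE; split=> x t.
  + by rewrite dy !(fmulE, faddE, foppE) y10 y20 sE mul1r subrr mulr0.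
  + by rewrite dy !(fmulE, faddE, foppE) yL sE mul1r subrr mulr0.
  + by rewrite faddE y10 y20 sE mulN1r subrr.
  + by rewrite faddE yL sE mulN1r addNr.
Qed.

End Smoothing.

(** * Membrane, bending and radial estimates *)

(* Abstracts the norms and inner products before calling the arithmetic solver. *)
Ltac alra := solve [repeat match goal with
  | H : context [Submission.nrm ?h ?L ?x] |- _ => generalize dependent (Submission.nrm h L x); intros
  | |- context [Submission.nrm ?h ?L ?x] => generalize (Submission.nrm h L x); intros
  | H : context [Submission.ip ?h ?L ?x ?y] |- _ => generalize dependent (Submission.ip h L x y); intros
  | |- context [Submission.ip ?h ?L ?x ?y] => generalize (Submission.ip h L x y); intros
  | H : context [Ibox ?h ?L ?x] |- _ => generalize dependent (Ibox h L x); intros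
  end; lra] || lra.

Lemma sqr_le {R : realType} (a b : R) : 0 <= a -> a <= b -> a ^+ 2 <= b ^+ 2.
Proof. by move=> a0 ab; rewrite lerXn2r// nnegrE (le_trans a0). Qed.

Section Membrane.
Context {R : realType}.
Local Notation pt := (R * R * R)%type.
Variables (h L : R).
Hypotheses (h_gt0 : 0 < h) (L_gt0 : 0 < L).
Local Notation Q := (shell h L).
Local Notation I := (Ibox h L).
Local Notation ip := (ip h L).
Local Notation nrm := (nrm h L).
Local Notation admissible := (admissible L).
Local Notation ends_zero := (ends_zero L).
Implicit Types (f g y u v w : pt -> R) (p : pt).

(** The integral of the derivative of om y^2 vanishes, and om has slope plus
    or minus one. *)
Lemma poincare_weight i om (s l : R) y : sm om -> sm y -> pd i om = kst s ->
  s = 1 \/ s = -1 -> 0 <= l -> (forall p, Q p -> `|om p| <= l) ->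
  (forall p, om (upd i p (hi h L i)) * y (upd i p (hi h L i)) = 0) ->
  (forall p, om (upd i p (lo h i)) * y (upd i p (lo h i)) = 0) ->
  nrm y <= 2 * l * nrm (pd i y).
Proof.
move=> so sy dom Hs l0 Hl bhi blo.
have sy' : sm (pd i y) by smt.
have : I (pd i (om * y * y)) = 0.
  apply: Ibox_pd => //; first smo.
  by move=> p; rewrite !fmulE bhi blo !mul0r.
rewrite pdM; [|smo|smo]; rewrite pdM; [|smo|smo]; rewrite dom.
rewrite (_ : (kst s * y + om * pd i y) * y + om * y * pd i y =
   kst s * (y * y) + kst 2 * (om * y * pd i y)); last first.
  by apply/funext => p; rewrite !(faddE, fmulE) /kst; ring.
rewrite IboxD; [|smo|smo]; rewrite IboxZ; last smo.
rewrite IboxZ; last smo.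
rewrite -/(Submission.ip h L y y) -nrmE -/(Submission.ip h L (om * y) (pd i y)) => E.
have h1 := ip_weight_le so l0 Hl sy sy'.
have smN : sm (- pd i y) by smt.
have h2 := ip_weight_le so l0 Hl sy smN.
rewrite ipNr in h2; [|smt|smt]; rewrite nrmN in h2.
have h3 : nrm y ^+ 2 <= 2 * (l * (nrm y * nrm (pd i y))).
  by case: Hs => sE; rewrite sE in E; alra.
have [->|N0] := eqVneq (nrm y) 0; first by rewrite !mulr_ge0 ?nrm_ge0.
have Np : 0 < nrm y by rewrite lt_def N0 nrm_ge0.
rewrite -(ler_pM2l Np) -expr2; alra.
Qed.

Lemma crd_zi_bnd (e : R) p : e = 0 \/ e = L -> Q p -> `|(crd zi - kst e) p| <= L.
Proof.
move=> He [_ /=]; rewrite in_itv/= => /andP[z0 zL].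
rewrite faddE foppE /kst /crd /= ler_norml.
by case: He => ->; apply/andP; split; alra.
Qed.

(** The linear weight is centred at the opposite end, so that the product with
    y vanishes at both ends. *)
Lemma poincare_axial (e : R) y : e = 0 \/ e = L -> sm y -> vanish e y ->
  nrm y <= 2 * L * nrm (pd zi y).
Proof.
move=> He sy v0; apply: (@poincare_weight zi (crd zi - kst (L - e)) 1) => //.
- smt.
- rewrite pdD; [|smo|smo]; rewrite pdN; last smo.
  by rewrite pd_kst pd_crd oppr0 addr0.
- by left.
- exact: ltW.
- move=> p; apply: crd_zi_bnd; case: He => ->; [right|left]; alra.
- move=> [[x t] z]; rewrite faddE foppE crd_upd /kst /hi /= /upd /=.
  by case: He v0 => -> v0; rewrite ?v0 ?mulr0//; rewrite subr0 subrr mul0r.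
- move=> [[x t] z]; rewrite faddE foppE crd_upd /kst /lo /= /upd /=.
  by case: He v0 => -> v0; rewrite ?v0 ?mulr0// subrr subr0 mul0r.
Qed.

(** The same argument in r bounds the deviation of u from its contraction by h
    |u_r|; both agree on the face. *)
Lemma nrm_sub_contr b u : b = lo h ri \/ b = hi h L ri -> sm u ->
  nrm (u - contr b u) <= 4 * h * nrm (pd ri u).
Proof.
move=> Hb su.
have [s [om Hf]] : exists s om, is_face h L b s om.
  case: Hb => ->; first by exists (-1), (kst (hi h L ri) - crd ri); left.
  by exists 1, (crd ri - kst (lo h ri)); right.
have sx : sm (pd ri u) by smt.
have j0 p : (u - contr b u) (upd ri p b) = 0.
  by rewrite faddE foppE -refl_contr_face subrr.
have sy : sm (u - contr b u) by smt.
have h1 : nrm (u - contr b u) <= 2 * h * nrm (pd ri (u - contr b u)).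
  apply: (@poincare_weight ri om s) => //.
  - exact: is_face_sm Hf.
  - exact: is_face_pd Hf.
  - by case: Hf => -[_ [-> _]]; [right|left].
  - exact: ltW.
  - by move=> p /(is_face_bnd Hf)/andP[om0 omh]; rewrite ger0_norm.
  - move=> p; case: Hf => -[bE [_ omE]]; last by rewrite -bE j0 mulr0.
    by rewrite omE faddE foppE crd_upd /kst subrr mul0r.
  - move=> p; case: Hf => -[bE [_ omE]]; first by rewrite -bE j0 mulr0.
    by rewrite omE faddE foppE crd_upd /kst subrr mul0r.
have e : pd ri (u - contr b u) = pd ri u - kst 2^-1 * contr b (pd ri u).
  rewrite pdD; [|smo|smo]; rewrite pdN; last smo.
  by rewrite /contr pd_sub//; smo.
have h2 : nrm (pd ri (u - contr b u)) <= 2 * nrm (pd ri u).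
  rewrite e; have s2 : sm (kst 2^-1 * contr b (pd ri u)) by smt.
  apply: le_trans (nrmB h L sx s2) _; rewrite nrmZ; last smt.
  rewrite ger0_norm; last by rewrite invr_ge0.
  have := nrm_contr h_gt0 L_gt0 Hb sx; alra.
have := ler_wpM2l (ltW h_gt0) h2; alra.
Qed.

(** After an integration by parts in the angle, v_theta = f - u with f the
    circumferential strain. The terms in f are as required. What is left is
    u^2 - u~ (4 u^ - 3 u), where u^ is the contraction and u~ = 3 u - 2 u^ the
    reflection of u; this equals (u - u^)(10 u - 8 u^), and u - u^ is of size
    h |u_r|. *)
Lemma jump_bending b u v : b = lo h ri \/ b = hi h L ri -> sm u -> sm v ->
  `|I (jump b (pd ti u) v)| <= 78 * (nrm u * nrm (pd ti v + u))
     + 104 * h * (nrm u * nrm (pd ri u)).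
Proof.
move=> Hb su sv; set f := pd ti v + u.
have sf : sm f by rewrite /f; smt.
have sru := sm_refl_n b su; have srf := sm_refl_t b sf.
have srv := sm_refl_t b sv; have sru' := sm_refl_t b su.
have e1 : I (jump b (pd ti u) v) = - ip u (pd ti v) + ip (refl_n b u) (pd ti (refl_t b v)).
  rewrite /jump -pd_refl_n_neq// IboxD; [|smo|smo]; rewrite IboxN; last smo.
  rewrite -/(Submission.ip h L (pd ti u) v) -/(Submission.ip h L (pd ti (refl_n b u)) (refl_t b v)).
  rewrite !ibp//; [lra|by left|by left].
have e2 : pd ti (refl_t b v) = refl_t b f - refl_t b u.
  rewrite pd_refl_t_neq// /refl_t /f !contrD; ring.
have e4 : ip (u - contr b u) (10%:R * u - 8%:R * contr b u)
    = ip u u - ip (refl_n b u) (refl_t b u).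
  rewrite /Submission.ip -[- Ibox h L _]IboxN; last smo.
  rewrite -IboxD; [|smo|smo]; congr (Ibox h L _); rewrite /refl_n /refl_t; ring.
have e3 : - ip u (pd ti v) + ip (refl_n b u) (pd ti (refl_t b v)) =
   - ip u f + ip (refl_n b u) (refl_t b f) + ip (u - contr b u) (10%:R * u - 8%:R * contr b u).
  rewrite e2 e4 (_ : pd ti v = f - u); last by rewrite /f addrK.
  move: (refl_n b u) (refl_t b f) (refl_t b u) sru srf sru' => rn rf ru srn srf' sru2.
  clear e1 e2 e4; move: f sf => f sf.
  rewrite !ipDr; try smt; rewrite !ipNr; try smt.
  lra.
rewrite e1 e3.
have c1 := cauchy_schwarz h L su sf.
have c2 := cauchy_schwarz h L sru srf.
have sd : sm (u - contr b u) by smt.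
have sd' : sm (10%:R * u - 8%:R * contr b u) by smt.
have c3 := cauchy_schwarz h L sd sd'.
have c4 : nrm (refl_n b u) * nrm (refl_t b f) <= 7 * nrm u * (11 * nrm f).
  by apply: ler_pM; rewrite ?nrm_ge0//; [exact: nrm_refl_n|exact: nrm_refl_t].
have n10 : nrm (10%:R * u - 8%:R * contr b u) <= 26 * nrm u.
  have s1 : sm (10%:R * u) by smt.
  have s2 : sm (8%:R * contr b u) by smt.
  have := nrmB h L s1 s2; rewrite !nrm_natM; [|smt|smt].
  have := nrm_contr h_gt0 L_gt0 Hb su; clear; alra.
have c5 : nrm (u - contr b u) * nrm (10%:R * u - 8%:R * contr b u) <=
   4 * h * nrm (pd ri u) * (26 * nrm u).
  by apply: ler_pM; rewrite ?nrm_ge0//; exact: nrm_sub_contr.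
apply: le_trans (ler_normD _ _) _; apply: le_trans (lerD (ler_normD _ _) (lexx _)) _.
clear - c1 c2 c3 c4 c5; rewrite normrN; alra.
Qed.

(** Rotation about the radius: the mixed products of the tangential
    derivatives agree, since the circumferential field is clamped. *)
Lemma membrane_shear v w : sm v -> sm w -> ends_zero v ->
  ip (pd zi v) (pd ti w) = ip (pd ti v) (pd zi w).
Proof.
move=> sv sw [v0 vL].
have h1 := @ibp R h L h_gt0 L_gt0 zi v (pd ti w) sv (sm_pd ti sw).
have h2 := @ibp R h L h_gt0 L_gt0 ti v (pd zi w) sv (sm_pd zi sw).
rewrite h1; last by right; split => //; split; left.
rewrite h2; last by left.
by rewrite pdC; [|smo].
Qed.

Section Energy.
Variables (u v w : pt -> R) (s : R).
Hypotheses (su : sm u) (sv : sm v) (sw : sm w) (s_ge0 : 0 <= s).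
Hypotheses (zv : ends_zero v).
Hypotheses (h_small : 40 * h <= 1).

Definition strain_bounds := [/\ nrm (pd ri u) <= 3 * s, nrm (pd zi w) <= 3 * s,
  nrm (pd zi u + pd ri w) <= 3 * s, nrm (pd ti v + u) <= 3 * s &
  nrm (pd zi v + pd ti w) <= 3 * s + 2 * h * nrm (pd ti w) /\
  nrm (pd ti u + pd ri v - v) <= 3 * s + 2 * h * nrm (pd ti u) + 2 * h * nrm v].

Hypothesis bnd : strain_bounds.

(** The square of the shear strain v_z + w_theta contains twice the product of
    the two terms, whose integral equals that of v_theta w_z = (f - u) w_z; so
    both terms are controlled up to |u| s. *)
Lemma membrane_bound : nrm (pd zi v) ^+ 2 + nrm (pd ti w) ^+ 2 <= 72 * s ^+ 2 + 12 * (nrm u * s).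
Proof.
have [ba bk bc bf [bg bd]] := bnd.
have svz : sm (pd zi v) by smt.
have swt : sm (pd ti w) by smt.
have swz : sm (pd zi w) by smt.
have sf : sm (pd ti v + u) by smt.
have e1 : nrm (pd zi v + pd ti w) ^+ 2 = nrm (pd zi v) ^+ 2 + nrm (pd ti w) ^+ 2 +
    2 * ip (pd zi v) (pd ti w).
  rewrite !nrmE ipDl; [|smt|smt|smt]; rewrite !ipDr; try smt.
  rewrite [ip (pd ti w) (pd zi v)]ipC; ring.
have e2 : ip (pd zi v) (pd ti w) = ip (pd ti v + u) (pd zi w) - ip u (pd zi w).
  rewrite membrane_shear// -ipNl; [|smt|smt]; rewrite -ipDl; [|smt|smt|smt].
  by rewrite addrK.
have c1 := cauchy_schwarz h L sf swz; have c2 := cauchy_schwarz h L su swz.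
have W0 := nrm_ge0 h L (pd ti w); have U0 := nrm_ge0 h L u.
have c3 : nrm (pd ti v + u) * nrm (pd zi w) <= 3 * s * (3 * s) by apply: ler_pM; rewrite ?nrm_ge0.
have c4 : nrm u * nrm (pd zi w) <= nrm u * (3 * s) by rewrite ler_wpM2l.
have g2 : nrm (pd zi v + pd ti w) ^+ 2 <= (3 * s + nrm (pd ti w) / 20) ^+ 2.
  apply: sqr_le; first exact: nrm_ge0.
  apply: le_trans bg _; rewrite lerD2l.
  have := ler_wpM2r W0 h_small; alra.
move: c1 c2; rewrite !ler_norml => /andP[c1 _] /andP[c2 c2'].
have := sqr_ge0 (3 * s - nrm (pd ti w) / 20).
have := sqr_ge0 (nrm (pd ti w)); have := sqr_ge0 (nrm (pd zi v)).
alra.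
Qed.

(** Korn by reflection for P = u and q = v, the boundary integrals of jump
    being estimated by the circumferential strain instead of by |v|/h. *)
Lemma bending_bound :
  nrm (pd ti u) ^+ 2 <= 6 * 1000 * (s ^+ 2 + nrm u * s / h + nrm v ^+ 2).
Proof.
have [ba bk bc bf [bg bd]] := bnd.
set y := nrm u * s / h.
have := korn_reflection h_gt0 L_gt0 (isT : ti != ri) su sv (or_introl erefl).
have svt : sm (pd ti v) by smt.
have J1 := jump_bending (or_introl erefl) su sv.
have J2 := jump_bending (or_intror erefl) su sv.
have U0 := nrm_ge0 h L u; have V0 := nrm_ge0 h L v; have T0 := nrm_ge0 h L (pd ti u).
have f1 : nrm u * nrm (pd ti v + u) <= nrm u * (3 * s) by rewrite ler_wpM2l.
have f2 : nrm u * nrm (pd ri u) <= nrm u * (3 * s) by rewrite ler_wpM2l.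
have hf2 := ler_wpM2l (ltW h_gt0) f2.
have yE : nrm u * s = h * y by rewrite /y [RHS]mulrC divfK// gt_eqF.
have y0 : 0 <= y by rewrite /y divr_ge0 ?mulr_ge0// ltW.
clearbody y.
have hy : h * y <= y / 40 by have := ler_wpM2r y0 h_small; alra.
set J := `|_| + `|_|.
have JJ : 2 / h * J <= 2 / h * (468 * (h * y) + 624 * h * (h * y)).
  by rewrite ler_wpM2l ?divr_ge0 ?(ltW h_gt0)// /J -yE; alra.
rewrite (_ : 2 / h * (468 * (h * y) + 624 * h * (h * y)) = 936 * y + 1248 * (h * y)) in JJ; last by field; rewrite gt_eqF.
have vt : nrm (pd ti v) <= 3 * s + nrm u.
  rewrite -[pd ti v](addrK u); apply: le_trans (nrmB h L _ su) _; first smt.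
  by rewrite lerD2r.
have T : nrm (pd ri u) * nrm (pd ti v) <= 3 * s * (3 * s + nrm u).
  by apply: ler_pM; rewrite ?nrm_ge0.
have c' : nrm (pd ti u + pd ri v) <= 3 * s + nrm (pd ti u) / 20 + 3 * nrm v.
  rewrite -[pd ti u + pd ri v](subrK v); apply: le_trans (nrmD h L _ sv) _; first smt.
  have a1 := ler_wpM2r V0 h_small; have a2 := ler_wpM2r T0 h_small.
  clear J1 J2 JJ hy T vt f1 f2 hf2 ba bk bc bf; alra.
have c2 : nrm (pd ti u + pd ri v) ^+ 2 <= (3 * s + nrm (pd ti u) / 20 + 3 * nrm v) ^+ 2.
  by apply: sqr_le => //; exact: nrm_ge0.
have q1 := sqr_ge0 (3 * s - nrm (pd ti u) / 20).
have q2 := sqr_ge0 (3 * s - 3 * nrm v).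
have q3 := sqr_ge0 (nrm (pd ti u) / 20 - 3 * nrm v).
have q4 := sqr_ge0 (nrm v); have q5 := sqr_ge0 s.
clear J1 J2 bd bg ba bk bc bf f1 f2 hf2 c' vt svt.
move=> KR; alra.
Qed.

(** The circumferential strain is v_theta + u; it is tested with u, and
    v_theta is integrated by parts. *)
Lemma radial_bound : nrm u ^+ 2 <= 3 * (nrm u * s) + nrm (pd ti u) * nrm v.
Proof.
have [ba bk bc bf [bg bd]] := bnd.
have sf : sm (pd ti v + u) by smt.
have sut : sm (pd ti u) by smt.
have e : ip u u = ip u (pd ti v + u) + ip (pd ti u) v.
  by rewrite ipDr; [|smt|smt|smt]; rewrite ibp//; [lra|left].
rewrite nrmE e; have c1 := ip_le h L su sf; have c2 := ip_le h L sut sv.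
have := ler_wpM2l (nrm_ge0 h L u) bf; alra.
Qed.

End Energy.
End Membrane.

(** * The scaling in the thickness *)

Section Numbers.
Context {R : realType}.

Lemma le_of_sqr (a b : R) : 0 <= b -> a ^+ 2 <= b ^+ 2 -> a <= b.
Proof.
move=> b0; rewrite -[a ^+ 2]real_normK ?num_real// ler_pXn2r ?nnegrE ?normr_ge0//.
exact: le_trans (ler_norm a).
Qed.

Lemma le1_mul (c x : R) : c <= 1 -> 0 <= x -> c * x <= x.
Proof. by move=> c1 x0; rewrite -{2}[x]mul1r ler_wpM2r. Qed.

(** The algebra of the membrane and bending estimates: the powers of t record
    the scaling in the thickness h = t^4. *)
Lemma scaling_bounds (L s t U A Vz W V : R) (l := 1 + 288 * L ^+ 2) :
  0 <= L -> 0 <= s -> 0 < t -> t <= 1 -> 0 <= U -> 0 <= A -> 0 <= Vz -> 0 <= W -> 0 <= V ->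
  Vz ^+ 2 + W ^+ 2 <= 72 * s ^+ 2 + 12 * (U * s) -> V <= 2 * L * Vz ->
  A ^+ 2 <= 6 * 1000 * (s ^+ 2 + U * s / t ^+ 4 + V ^+ 2) ->
  U ^+ 2 <= 3 * (U * s) + A * V ->
  [/\ t ^+ 2 * U <= 166 * l * s, t ^+ 3 * A <= 1001 * l * s,
    t * Vz <= 46 * l * s, t * W <= 46 * l * s & t * V <= 13 * l * s].
Proof.
move=> L0 s0 t0 t1 U0 A0 Vz0 W0 V0 mem poin bend rad.
have l1 : 1 <= l by rewrite /l; have := sqr_ge0 L; lra.
have l0 : 0 <= l := le_trans ler01 l1.
have l10 : 0 <= l - 1 by rewrite subr_ge0.
have ll : l <= l ^+ 2 by rewrite expr2 -{1}[l]mulr1 ler_wpM2l//; lra.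
have t2 : 0 < t ^+ 2 by rewrite exprn_gt0.
have t21 : t ^+ 2 <= 1 by rewrite exprn_ile1// ltW.
have t4 : 0 < t ^+ 4 by rewrite exprn_gt0.
have t41 : t ^+ 4 <= 1 by rewrite exprn_ile1// ltW.
have Us0 : 0 <= U * s by rewrite mulr_ge0.
have [y yE] : exists y, y = U * s / t ^+ 4 by eexists.
rewrite -yE in bend.
have ty : t ^+ 4 * y = U * s by rewrite yE mulrC divfK// gt_eqF.
have y0 : 0 <= y by rewrite yE divr_ge0// ltW.
have Uy : U * s <= y by rewrite -ty le1_mul.
have s2 := sqr_ge0 s.
have V2 : V ^+ 2 <= (l - 1) * (s ^+ 2 + U * s).
  have h1 := sqr_le V0 poin.
  have h2 : L ^+ 2 * Vz ^+ 2 <= L ^+ 2 * (72 * s ^+ 2 + 12 * (U * s)).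
    by rewrite ler_wpM2l ?sqr_ge0//; have := sqr_ge0 W; lra.
  have h3 : 0 <= L ^+ 2 * (U * s) by rewrite mulr_ge0// sqr_ge0.
  rewrite /l; lra.
clearbody l; clear L0 poin.
have A2 : A ^+ 2 <= 6 * 1000 * (l * (s ^+ 2 + y)).
  have : (l - 1) * (s ^+ 2 + U * s) <= (l - 1) * (s ^+ 2 + y).
    by rewrite ler_wpM2l// lerD2l.
  by move=> q; clear -q bend V2; lra.
have key : t ^+ 2 * (A * V) <= 80 * l * (s * (s + U)).
  apply: le_of_sqr; first by rewrite !mulr_ge0 ?addr_ge0 ?ler0n.
  have h1 : A ^+ 2 * V ^+ 2 <= 6 * 1000 * (l * (s ^+ 2 + y)) * (l * (s ^+ 2 + U * s)).
    by apply: ler_pM; rewrite ?sqr_ge0//; clear -V2 s2 Us0; lra.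
  have h2 : t ^+ 4 * (A ^+ 2 * V ^+ 2) <= t ^+ 4 * (6 * 1000 * (l * (s ^+ 2 + y)) * (l * (s ^+ 2 + U * s))).
    by rewrite ler_wpM2l// ltW.
  have h3 : t ^+ 4 * (s ^+ 2 + y) <= s * (s + U).
    by rewrite mulrDr ty; have q := le1_mul t41 s2; clear -q; lra.
  have h4 : t ^+ 4 * (s ^+ 2 + y) * (s * (s + U)) <= (s * (s + U)) * (s * (s + U)).
    by rewrite ler_wpM2r// mulr_ge0// addr_ge0.
  have h5 : l ^+ 2 * (t ^+ 4 * (s ^+ 2 + y) * (s * (s + U))) <= l ^+ 2 * ((s * (s + U)) * (s * (s + U))).
    by rewrite ler_wpM2l// sqr_ge0.
  have h6 : 0 <= (l * (s * (s + U))) ^+ 2 by exact: sqr_ge0.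
  rewrite (_ : (t ^+ 2 * (A * V)) ^+ 2 = t ^+ 4 * (A ^+ 2 * V ^+ 2)); last by ring.
  clear -h2 h5 h6; lra.
have c1 : t ^+ 2 * U <= 166 * l * s.
  rewrite leNgt; apply/negP => H.
  have ls : s <= l * s by rewrite -{1}[s]mul1r ler_wpM2r.
  have sU : s < U by have tU := le1_mul t21 U0; clear -ls H tU s0; lra.
  have Up : 0 < U := le_lt_trans s0 sU.
  have h1 : 166 * l * s * U < t ^+ 2 * U * U by rewrite ltr_pM2r.
  have h2 : t ^+ 2 * U ^+ 2 <= t ^+ 2 * (3 * (U * s) + A * V) by rewrite ler_wpM2l// ltW.
  have h3 := le1_mul t21 Us0.
  have h4 : 0 <= (l - 1) * (U * s) by rewrite mulr_ge0.
  have h5 : 0 <= l * s * (U - s) by rewrite !mulr_ge0// subr_ge0 ltW.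
  clear -h1 h2 h3 h4 h5 key Us0; lra.
have t2s : t ^+ 2 * s ^+ 2 <= s ^+ 2 by exact: le1_mul.
have t2Us : t ^+ 2 * (U * s) <= 166 * l * s ^+ 2 by have q := ler_wpM2r s0 c1; clear -q; lra.
have ls2 : 0 <= (l ^+ 2 - l) * s ^+ 2 by rewrite mulr_ge0// subr_ge0.
have ls1 : 0 <= (l - 1) * s ^+ 2 by rewrite mulr_ge0.
have ls0 : 0 <= l * s by rewrite mulr_ge0.
have tmem : t ^+ 2 * (Vz ^+ 2 + W ^+ 2) <= t ^+ 2 * (72 * s ^+ 2 + 12 * (U * s)).
  by rewrite ler_wpM2l// ltW.
split.
- exact: c1.
- apply: le_of_sqr; first by rewrite !mulr_ge0 ?ler0n.
  have t6 : 0 <= t ^+ 6 by rewrite exprn_ge0// ltW.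
  have h1 : t ^+ 6 * A ^+ 2 <= t ^+ 6 * (6 * 1000 * (l * (s ^+ 2 + y))) by rewrite ler_wpM2l.
  have h2 : t ^+ 6 * y = t ^+ 2 * (U * s) by rewrite -ty; ring.
  have h3 : t ^+ 6 * s ^+ 2 <= s ^+ 2 by apply: le1_mul => //; rewrite exprn_ile1// ltW.
  have h4 : l * (t ^+ 6 * y) <= l * (166 * l * s ^+ 2) by rewrite ler_wpM2l// h2.
  have h5 : l * (t ^+ 6 * s ^+ 2) <= l * s ^+ 2 by rewrite ler_wpM2l.
  rewrite (_ : (t ^+ 3 * A) ^+ 2 = t ^+ 6 * A ^+ 2); last by ring.
  clear -h1 h2 h3 h4 h5 ls1 ls2 s2; lra.
- apply: le_of_sqr; first by rewrite !mulr_ge0 ?ler0n.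
  have q := mulr_ge0 (ltW t2) (sqr_ge0 W); rewrite exprMn.
  clear -q tmem t2s t2Us ls1 ls2 s2; lra.
- apply: le_of_sqr; first by rewrite !mulr_ge0 ?ler0n.
  have q := mulr_ge0 (ltW t2) (sqr_ge0 Vz); rewrite exprMn.
  clear -q tmem t2s t2Us ls1 ls2 s2; lra.
- apply: le_of_sqr; first by rewrite !mulr_ge0 ?ler0n.
  have h1 : t ^+ 2 * V ^+ 2 <= t ^+ 2 * (l * (s ^+ 2 + U * s)).
    by rewrite ler_wpM2l ?(ltW t2)//; clear -V2 s2 Us0; lra.
  have h2 : l * (t ^+ 2 * (s ^+ 2 + U * s)) <= l * (s ^+ 2 + 166 * l * s ^+ 2).
    by rewrite ler_wpM2l// mulrDr lerD.
  have h3 := sqr_ge0 s.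
  rewrite exprMn; clear -h1 h2 h3 ls1 ls2 s2; lra.
Qed.

(** Extracting a norm from the quadratic bound of the layer inequality. *)
Lemma layer_root (m c T q X al be ga : R) : 0 <= X -> 0 <= al -> 0 <= be -> 0 <= ga ->
  m ^+ 2 <= 106 * c ^+ 2 + 448 * T + (312 * q) ^+ 2 ->
  0 <= c -> c <= al * X -> T <= (be * X) ^+ 2 -> 0 <= q -> q <= ga * X ->
  m <= (11 * al + 22 * be + 312 * ga) * X.
Proof.
move=> X0 al0 be0 ga0 H c0 cX TX q0 qX.
have a0 : 0 <= al * X by rewrite mulr_ge0.
have b0 : 0 <= be * X by rewrite mulr_ge0.
have g0 : 0 <= ga * X by rewrite mulr_ge0.
have p0 : 0 <= 11 * al + 22 * be + 312 * ga by lra.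
apply: le_of_sqr; first exact: mulr_ge0.
have h1 := sqr_le c0 cX; have h2 := sqr_le q0 qX.
have h3 := mulr_ge0 a0 b0; have h4 := mulr_ge0 a0 g0; have h5 := mulr_ge0 b0 g0.
have -> : (11 * al + 22 * be + 312 * ga) * X = 11 * (al * X) + 22 * (be * X) + 312 * (ga * X).
  by ring.
move: (al * X) (be * X) (ga * X) => x y z in a0 b0 g0 h1 h2 h3 h4 h5 TX *.
have := sqr_ge0 x; have := sqr_ge0 y; lra.
Qed.

End Numbers.

(** * Smoothed displacement fields *)

Section SmoothKorn.
Context {R : realType}.
Local Notation pt := (R * R * R)%type.
Variables (h L : R).
Hypotheses (h_gt0 : 0 < h) (L_gt0 : 0 < L).
Local Notation Q := (shell h L).
Local Notation ip := (ip h L).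
Local Notation nrm := (nrm h L).
Local Notation admissible := (admissible L).
Local Notation ends_zero := (ends_zero L).
Implicit Types (f g y F u v w : pt -> R) (p : pt) (i : 'I_3) (b : bool).

Definition transp y F := [/\ sm y, sm F & y + kst h * pd ti y = F].

Lemma transpD y F y' F' : transp y F -> transp y' F' -> transp (y + y') (F + F').
Proof.
move=> [sy sF E] [sy' sF' E']; split; [smt|smt|].
rewrite pdD; [|smo|smo]; rewrite -E -E'; ring.
Qed.

Lemma transpN y F : transp y F -> transp (- y) (- F).
Proof.
by move=> [sy sF E]; split; [smt|smt|]; rewrite pdN; [|smo]; rewrite -E; ring.
Qed.

Lemma transp_pd i y F : transp y F -> transp (pd i y) (pd i F).
Proof.
move=> [sy sF E]; split; [smt|smt|]; rewrite -E pdD; [|smo|smo].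
rewrite pdM; [|smo|smo]; rewrite pd_kst mul0r add0r.
by rewrite (pdC i ti); [|smo].
Qed.

(** The flag selects the Neumann condition at both ends, or else Dirichlet's. *)
Definition resolv b y F := [/\ sm y, sm F, y - kst (h ^+ 2) * pd zi (pd zi y) = F
  & if b then ends_zero (pd zi y) else ends_zero y].

Lemma ends_zeroD f g : ends_zero f -> ends_zero g -> ends_zero (f + g).
Proof. by move=> [f0 fL] [g0 gL]; split; exact: vanishD. Qed.

Lemma ends_zeroN f : ends_zero f -> ends_zero (- f).
Proof. by move=> [f0 fL]; split; exact: vanishN. Qed.

Lemma ends_zero_pd i f : i != zi -> ends_zero f -> ends_zero (pd i f).
Proof. by move=> iz [f0 fL]; split; exact: vanish_pd. Qed.

Lemma resolvD b y F y' F' : resolv b y F -> resolv b y' F' -> resolv b (y + y') (F + F').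
Proof.
move=> [sy sF E B] [sy' sF' E' B']; split; [smt|smt| |].
  by do 2 (rewrite pdD; [|smo|smo]); rewrite -E -E'; ring.
case: b B B' => B B'; last exact: ends_zeroD.
by rewrite pdD; [exact: ends_zeroD|smo|smo].
Qed.

Lemma resolvN b y F : resolv b y F -> resolv b (- y) (- F).
Proof.
move=> [sy sF E B]; split; [smt|smt| |].
  by do 2 (rewrite pdN; [|smo]); rewrite -E; ring.
case: b B => B; last exact: ends_zeroN.
by rewrite pdN; [exact: ends_zeroN|smo].
Qed.

Lemma pd_resolv_eq i y : sm y -> pd i (y - kst (h ^+ 2) * pd zi (pd zi y)) =
  pd i y - kst (h ^+ 2) * pd zi (pd zi (pd i y)).
Proof.
move=> sy; rewrite pdD; [|smo|smo]; rewrite pdN; last smo.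
rewrite pdM; [|smo|smo]; rewrite pd_kst mul0r add0r.
rewrite (pdC i zi); last smo.
by rewrite (pdC i zi); last smo.
Qed.

Lemma resolv_pd b i y F : i != zi -> resolv b y F -> resolv b (pd i y) (pd i F).
Proof.
move=> iz [sy sF E B]; split; [smt|smt| |].
  by rewrite -pd_resolv_eq// E.
case: b B => B; last exact: ends_zero_pd.
by rewrite (pdC zi i); [exact: ends_zero_pd|smo].
Qed.

Lemma resolv_axial b y F : (b = false -> ends_zero F) -> resolv b y F ->
  resolv (~~ b) (pd zi y) (pd zi F).
Proof.
move=> HF [sy sF E B]; split; [smt|smt| |].
  by rewrite -pd_resolv_eq// E.
case: b B HF => B HF //=.
have e : kst (h ^+ 2) * pd zi (pd zi y) = y - F by rewrite -E; ring.
have z : ends_zero (y - F) by apply: ends_zeroD => //; exact/ends_zeroN/HF.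
rewrite -e in z; have h0 : h ^+ 2 != 0 by rewrite expf_neq0// gt_eqF.
have can (q : R * R) c : (kst (h ^+ 2) * pd zi (pd zi y)) (q, c) = 0 -> pd zi (pd zi y) (q, c) = 0.
  by rewrite fmulE /kst => /eqP; rewrite mulf_eq0 (negbTE h0) => /eqP.
by case: z => z0 zL; split=> x t; apply: can; [exact: z0|exact: zL].
Qed.

Lemma admissible_l f g : ends_zero f -> admissible zi f g.
Proof. by move=> [f0 fL]; right; split => //; split; left. Qed.

Lemma admissible_r f g : ends_zero g -> admissible zi f g.
Proof. by move=> [f0 fL]; right; split => //; split; right. Qed.

Definition smoothed b y f := exists2 f1, transp f1 f & resolv b y f1.

Lemma smoothed_sm b y f : smoothed b y f -> sm y /\ sm f.
Proof. by move=> [f1 [? ? ?] [? ? ? ?]]. Qed.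

Lemma smoothedD b y f y' f' : smoothed b y f -> smoothed b y' f' -> smoothed b (y + y') (f + f').
Proof.
move=> [f1 a1 b1] [f2 a2 b2]; exists (f1 + f2); [exact: transpD|exact: resolvD].
Qed.

Lemma smoothedN b y f : smoothed b y f -> smoothed b (- y) (- f).
Proof. by move=> [f1 a1 b1]; exists (- f1); [exact: transpN|exact: resolvN]. Qed.

Lemma smoothed_pd b i y f : i != zi -> smoothed b y f -> smoothed b (pd i y) (pd i f).
Proof. by move=> iz [f1 a1 b1]; exists (pd i f1); [exact: transp_pd|exact: resolv_pd]. Qed.

Lemma smoothed_energy b y f : smoothed b y f ->
  [/\ nrm y <= nrm f, h * nrm (pd zi y) <= nrm f & h * nrm (pd ti y) <= nrm f].
Proof.
have en b' y' F' : resolv b' y' F' -> nrm y' <= nrm F' /\ h * nrm (pd zi y') <= nrm F'.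
  move=> [sy sF E B]; apply: resolvent_energy => //.
  by case: b' B => B; [exact: admissible_r|exact: admissible_l].
move=> [f1 [s1 sf E] r].
have [t1 t2] := transport_energy h_gt0 L_gt0 s1 sf E.
have [r1 r2] := en _ _ _ r.
have [r3 _] := en _ _ _ (resolv_pd (isT : ti != zi) r).
split; [exact: le_trans r1 t1|exact: le_trans r2 t1|].
by apply: le_trans t2; rewrite ler_pM2l.
Qed.

(** Smoothing by h in the angle and then along the axis. Dirichlet's condition
    is used for fields that vanish at the ends, Neumann's otherwise; either way
    the axial derivative of the result solves the problem with the other
    condition, so that it is the smoothing of the derivative. *)
Lemma smoothing b f : sm f -> (b = false -> ends_zero f) -> exists y,
  [/\ smoothed b y f, smoothed (~~ b) (pd zi y) (pd zi f),
    (if b then ends_zero (pd zi y) else ends_zero y) &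
    nrm (f - y) <= h * (nrm (pd ti f) + nrm (pd zi f))].
Proof.
move=> sf Hf.
have [f1 [s1 E V]] := transport_solve h_gt0 sf.
have Hf1 : b = false -> ends_zero f1 by move=> /Hf[z0 zL]; split; exact: V.
have tr : transp f1 f by [].
pose sg : R := if b then 1 else -1.
have Hsg : sg = 1 \/ sg = -1 by rewrite /sg; case: (b); [left|right].
have [y [sy Ey [B1 B2]]] := resolvent_solve h_gt0 L_gt0 Hsg s1.
have B : if b then ends_zero (pd zi y) else ends_zero y.
  by move: B1 B2; rewrite /sg; case: (b) => B1 B2; [exact: B1|exact: B2].
have rs : resolv b y f1 by [].
have sz : smoothed (~~ b) (pd zi y) (pd zi f).
  by exists (pd zi f1); [exact: transp_pd|exact: resolv_axial].
have sft : sm (pd ti f1) by smt.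
have syz : sm (pd zi (pd zi y)) by smt.
exists y; split => //; first by exists f1.
have -> : f - y = kst h * pd ti f1 + - (kst (h ^+ 2) * pd zi (pd zi y)).
  by rewrite -E -Ey; ring.
apply: le_trans (nrmB h L _ _) _; [smt|smt|].
rewrite !nrmZ// !ger0_norm ?exprn_ge0 ?(ltW h_gt0)// mulrDr lerD//.
  have [s1' sf' E'] := transp_pd ti tr.
  by rewrite ler_pM2l//; have [] := transport_energy h_gt0 L_gt0 s1' sf' E'.
by rewrite expr2 -mulrA ler_pM2l//; have [] := smoothed_energy sz.
Qed.

End SmoothKorn.

(** * The axial derivative of the radial component *)

Lemma mul_le_sqr {R : realType} (x y a : R) : 0 <= x -> 0 <= y ->
  x <= a -> y <= a -> x * y <= a ^+ 2.
Proof. by move=> x0 y0 xa ya; rewrite expr2; apply: ler_pM. Qed.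

(* Arithmetic steps, kept apart from the large contexts in which they occur. *)
Section Arithmetic.
Context {R : realType}.
Implicit Types (x y z X Y W s G n k : R).

Lemma twice_le_add n X Y : n <= 3 * X -> 0 <= Y -> 2 * n <= 6 * X + Y.
Proof. lra. Qed.

Lemma le_add_pos n X Y : n <= Y -> 0 <= X -> n <= 6 * X + Y.
Proof. lra. Qed.

Lemma le_of_twice n k : 2 * n <= k -> 0 <= n -> n <= k.
Proof. lra. Qed.

Lemma sum_le_twice x y s W : x <= 3 * s -> y <= 3 * s -> 0 <= W -> x + y <= 2 * (3 * s + W).
Proof. lra. Qed.

Lemma chain_arith (uz upz a1 a2 b1 b2 a3 b3 : R) :
  uz = - upz -> a1 = - a2 -> a3 = - a2 -> b1 = - b2 -> b3 = - b2 ->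
  uz = - (a1 + upz) + (a3 + b1) - b3.
Proof. lra. Qed.

Lemma three_terms_le (i1 i2 i3 n1 n2 n3 m1 m2 m3 : R) :
  `|i1| <= n1 -> `|i2| <= n2 -> `|i3| <= n3 -> n1 <= m1 -> n2 <= m2 -> n3 <= m3 ->
  - i1 + i2 - i3 <= m1 + m2 + m3.
Proof.
rewrite !ler_norml => /andP[h1 h1'] /andP[h2 h2'] /andP[h3 h3']; lra.
Qed.

Lemma absorb_half (n i1 i2 d Y : R) : n ^+ 2 = i1 + i2 -> i1 <= d -> i2 <= n * Y ->
  n ^+ 2 <= 2 * d + Y ^+ 2.
Proof. have := sqr_ge0 (n - Y); lra. Qed.
End Arithmetic.

Section AxialBound.
Context {R : realType}.
Local Notation pt := (R * R * R)%type.
Variables (h L : R).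
Hypotheses (h_gt0 : 0 < h) (h_le1 : h <= 1) (L_gt0 : 0 < L).
Local Notation ip := (ip h L).
Local Notation nrm := (nrm h L).
Local Notation admissible := (admissible L).
Local Notation ends_zero := (ends_zero L).
Local Notation smoothed := (smoothed h L).
Variables (u v w : pt -> R) (s G D Mu Mv Wd : R) (b : bool).
Hypotheses (su : sm u) (sv : sm v) (sw : sm w).
Hypotheses (s_ge0 : 0 <= s) (G0 : 0 <= G) (D0 : 0 <= D) (Mu0 : 0 <= Mu) (Mv0 : 0 <= Mv).
Hypothesis (zv : ends_zero v).
Hypothesis (zuw : if b then ends_zero w else ends_zero u).
Hypotheses (na : nrm (pd ri u) <= 3 * s) (nk : nrm (pd zi w) <= 3 * s)
  (nc : nrm (pd zi u + pd ri w) <= 3 * s) (nf : nrm (pd ti v + u) <= 3 * s)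
  (ng : nrm (pd zi v + pd ti w) <= G * s)
  (nd : nrm (pd ti u + pd ri v - v) <= D * s)
  (nu : h * nrm u <= Mu * s) (nvz : h * nrm (pd zi v) <= Mv * s)
  (nwt : nrm (pd ti w) <= Wd).

Variables (X K1 K2 K3 : R).
Hypotheses (hX : h * X = s).
Hypotheses (K1E : K1 = 11 * 3 + 22 * 3 + 312 * 3)
  (K2E : K2 = 11 * (D + Mv + 3) + 22 * (6 + G) + 312 * G)
  (K3E : K3 = 11 * (D + Mu + 6) + 22 * 3 + 312 * 3).

Let X0 : 0 <= X.
Proof. by rewrite -(ler_pM2l h_gt0) mulr0 hX. Qed.

Let sX : s <= X.
Proof. by rewrite -hX; exact: le1_mul. Qed.

Let scale (n c : R) : h * n <= c * s -> n <= c * X.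
Proof.
move=> H; rewrite -(ler_pM2l h_gt0); apply: le_trans H _.
by rewrite mulrCA hX.
Qed.

Let qscale (n c : R) : n <= c * s -> n / h <= c * X.
Proof. by move=> H; rewrite ler_pdivrMr// -mulrA [X * h]mulrC hX. Qed.

(** Let psi be the smoothed u. Integrations by parts turn the inner product of
    u_z and psi_z into products of the membrane strains with psi_zz,
    psi_{theta z} and psi_{theta theta}: the linear compatibility relation between the
    curvatures and the membrane strains. The second derivatives of psi are
    bounded by s/h through the layer inequality, applied to smoothed
    displacements, and u_z - psi_z through the same inequality applied to the
    differences. *)
Lemma axial_bound : nrm (pd zi u) ^+ 2 <=
  2 * (3 * K1 + G * K2 + 3 * K3) * (s * X) + (378 * (3 * s + Wd)) ^+ 2.
Proof.
have Wd0 : 0 <= Wd by apply: le_trans nwt; exact: nrm_ge0.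
have [psi [Su Suz Bu du]] := @smoothing R h L h_gt0 L_gt0 b u su (fun e => ltac:(by move: zuw; rewrite e)).
have [vb [Sv Svz Bv _]] := @smoothing R h L h_gt0 L_gt0 b v sv (fun _ => zv).
have [wb [Sw Swz Bw dw]] := @smoothing R h L h_gt0 L_gt0 (~~ b) w sw
  (fun e => ltac:(by move: zuw; rewrite (negbFE e))).
rewrite negbK in Swz.
have [sp _] := smoothed_sm Su; have [svb _] := smoothed_sm Sv; have [swb _] := smoothed_sm Sw.
have tr : ti != ri by []. have zr : zi != ri by []. have rz : ri != zi by []. have tz : ti != zi by [].
have Sa := smoothed_pd rz Su.
have Sc := smoothedD Suz (smoothed_pd rz Sw).
have Sf := smoothedD (smoothed_pd tz Sv) Su.
have Sg := smoothedD Svz (smoothed_pd tz Sw).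
have Sd := smoothedD (smoothedD (smoothed_pd tz Su) (smoothed_pd rz Sv)) (smoothedN Sv).
have [ea eaz eat] := smoothed_energy h_gt0 L_gt0 Sa.
have [ec ecz ect] := smoothed_energy h_gt0 L_gt0 Sc.
have [ef efz eft] := smoothed_energy h_gt0 L_gt0 Sf.
have [eg egz egt] := smoothed_energy h_gt0 L_gt0 Sg.
have [ed edz edt] := smoothed_energy h_gt0 L_gt0 Sd.
have [ek ekz ekt] := smoothed_energy h_gt0 L_gt0 Swz.
have [eu _ _] := smoothed_energy h_gt0 L_gt0 Su.
have [ev _ _] := smoothed_energy h_gt0 L_gt0 Svz.
have spz : sm (pd zi psi) by smt.
have swbz : sm (pd zi wb) by smt.
have N0 := nrm_ge0 h L.
have qn0 f : 0 <= nrm f / h := divr_ge0 (N0 f) (ltW h_gt0).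
(* the pure axial curvature *)
have P1 : nrm (pd zi (pd zi psi)) <= K1 * X.
  rewrite K1E.
  have A : admissible zi (pd zi psi) (pd zi wb).
    by case: (b) Bu Bw => Bu Bw; [exact: admissible_l|exact: admissible_r].
  have KL := korn_layer h_gt0 L_gt0 zr spz swbz A.
  apply: (layer_root X0 _ _ _ KL); rewrite ?N0 ?qn0 ?ler0n//.
  - have -> : pd zi (pd zi psi) + pd ri (pd zi wb) = pd zi (pd zi psi + pd ri wb).
      by rewrite pdD; [|smo|smo]; rewrite (pdC zi ri); [|smo].
    exact/scale/(le_trans ecz).
  - have -> : pd ri (pd zi psi) = pd zi (pd ri psi) by rewrite pdC; [|smo].
    exact: (mul_le_sqr (N0 _) (N0 _) (scale (le_trans eaz na)) (scale (le_trans ekz nk))).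
  - exact/qscale/(le_trans ek).
(* the twist; both shear rotations enter, so their sum is estimated *)
have P2 : nrm (pd ti (pd zi psi)) <= K2 * X.
  have sP : sm (2%:R * pd zi psi) by smt.
  have sq : sm (pd zi vb + pd ti wb) by smt.
  have KL := korn_layer h_gt0 L_gt0 tr sP sq (or_introl erefl).
  have e2 : pd ti (2%:R * pd zi psi) = 2%:R * pd ti (pd zi psi).
    by rewrite pdM; [|smo|smo]; rewrite pd_nat mul0r add0r.
  have c1 : nrm (pd ti (2%:R * pd zi psi)) <= K2 * X.
    rewrite K2E.
    apply: (layer_root X0 _ _ _ KL); rewrite ?N0 ?qn0 ?ler0n ?G0//.
    - by rewrite !addr_ge0.
    - by rewrite addr_ge0.
    - have -> : pd ti (2%:R * pd zi psi) + pd ri (pd zi vb + pd ti wb) =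
         pd zi (pd ti psi + pd ri vb - vb) + pd zi vb + pd ti (pd zi psi + pd ri wb).
        rewrite e2 pdD; [|smo|smo].
        rewrite [pd zi (_ - _)]pdD; [|smo|smo]; rewrite pdN; last smo.
        rewrite [pd zi (_ + _)]pdD; [|smo|smo]; rewrite [pd ti (_ + _)]pdD; [|smo|smo].
        rewrite (pdC ri zi); last smo. rewrite (pdC ri ti); last smo.
        rewrite (pdC zi ti); last smo.
        ring.
      apply: le_trans (nrmD _ _ _ _) _; [smt|smt|].
      rewrite (_ : (D + Mv + 3) * X = (D * X + Mv * X) + 3 * X); last by ring.
      apply: lerD; last exact/scale/(le_trans ect).
      apply: le_trans (nrmD _ _ _ _) _; [smt|smt|].
      apply: lerD; first exact/scale/(le_trans edz).
      apply: scale; apply: le_trans nvz; by rewrite ler_pM2l.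
    - have -> : pd ri (2%:R * pd zi psi) = 2%:R * pd zi (pd ri psi).
        rewrite pdM; [|smo|smo]; rewrite pd_nat mul0r add0r.
        by rewrite pdC; [|smo].
      rewrite nrm_natM; last smt.
      have GX : 0 <= G * X by exact: mulr_ge0.
      have r1 := scale (le_trans eaz na); have r2 := scale (le_trans egt ng).
      rewrite (_ : (6 + G) * X = 6 * X + G * X); last by ring.
      apply: (mul_le_sqr _ (N0 _)).
      - by apply: mulr_ge0; [exact: ler0n|exact: N0].
      - exact: twice_le_add.
      - exact: le_add_pos.
    - exact/qscale/(le_trans eg).
  move: c1; rewrite e2 nrm_natM; last smt.
  by move=> c1; exact: le_of_twice c1 (N0 _).
(* the circumferential curvature *)
have P3 : nrm (pd ti (pd ti psi)) <= K3 * X.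
  rewrite K3E.
  have sP : sm (pd ti psi) by smt.
  have sq : sm (pd ti vb + psi) by smt.
  have KL := korn_layer h_gt0 L_gt0 tr sP sq (or_introl erefl).
  apply: (layer_root X0 _ _ _ KL); rewrite ?N0 ?qn0 ?ler0n//.
  - by rewrite !addr_ge0.
  - have -> : pd ti (pd ti psi) + pd ri (pd ti vb + psi) =
       pd ti (pd ti psi + pd ri vb - vb) + (pd ti vb + psi) - psi + pd ri psi.
      rewrite pdD; [|smo|smo].
      rewrite [pd ti (_ - _)]pdD; [|smo|smo]; rewrite pdN; last smo.
      rewrite [pd ti (_ + pd ri vb)]pdD; [|smo|smo].
      rewrite (pdC ri ti); last smo.
      ring.
    rewrite (_ : (D + Mu + 6) * X = D * X + 3 * X + Mu * X + 3 * X); last by ring.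
    apply: le_trans (nrmD _ _ _ _) _; [smt|smt|].
    apply: lerD; last by apply: le_trans ea (le_trans na _); rewrite ler_wpM2l.
    apply: le_trans (nrmB _ _ _ _) _; [smt|smt|].
    apply: lerD; last by apply: le_trans eu _; exact: scale.
    apply: le_trans (nrmD _ _ _ _) _; [smt|smt|].
    apply: lerD; first exact/scale/(le_trans edt).
    by apply: le_trans ef (le_trans nf _); rewrite ler_wpM2l.
  - have -> : pd ri (pd ti psi) = pd ti (pd ri psi) by rewrite pdC; [|smo].
    exact: (mul_le_sqr (N0 _) (N0 _) (scale (le_trans eat na)) (scale (le_trans eft nf))).
  - exact/qscale/(le_trans ef).
(* the error of the smoothing *)
have P4 : nrm (pd zi (u - psi)) <= (11 * 2 + 22 * 2 + 312 * 1) * (3 * s + Wd).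
  have Y0 : 0 <= 3 * s + Wd by rewrite addr_ge0// mulr_ge0.
  have sP : sm (u - psi) by smt.
  have sq : sm (w - wb) by smt.
  have A : admissible zi (u - psi) (w - wb).
    case: (b) zuw Bu Bw => zz Bu Bw.
      by apply/admissible_r/ends_zeroD => //; exact: ends_zeroN.
    by apply/admissible_l/ends_zeroD => //; exact: ends_zeroN.
  have KL := korn_layer h_gt0 L_gt0 zr sP sq A.
  have b1 : nrm (pd ri (u - psi)) <= 2 * (3 * s + Wd).
    rewrite pdD; [|smo|smo]; rewrite pdN; last smo.
    apply: le_trans (nrmB _ _ _ _) _; [smt|smt|].
    exact: sum_le_twice na (le_trans ea na) Wd0.
  have b2 : nrm (pd zi (w - wb)) <= 2 * (3 * s + Wd).
    rewrite pdD; [|smo|smo]; rewrite pdN; last smo.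
    apply: le_trans (nrmB _ _ _ _) _; [smt|smt|].
    exact: sum_le_twice nk (le_trans ek nk) Wd0.
  apply: (layer_root Y0 _ _ _ KL); rewrite ?N0 ?qn0 ?ler0n ?ler01//.
  - have -> : pd zi (u - psi) + pd ri (w - wb) = (pd zi u + pd ri w) - (pd zi psi + pd ri wb).
      do 2 (rewrite pdD; [|smo|smo]); do 2 (rewrite pdN; [|smo]); ring.
    apply: le_trans (nrmB _ _ _ _) _; [smt|smt|].
    exact: sum_le_twice nc (le_trans ec nc) Wd0.
  - exact: (mul_le_sqr (N0 _) (N0 _) b1 b2).
  - rewrite mul1r ler_pdivrMr// mulrC; apply: le_trans dw _.
    by rewrite ler_pM2l// addrC lerD.
have Pz : pd zi (u - psi) = pd zi u - pd zi psi by rewrite pdD; [|smo|smo]; rewrite pdN; [|smo].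
have Au : admissible zi u (pd zi psi).
  by case: (b) zuw Bu => zz Bu; [exact: admissible_r|exact: admissible_l].
have spzt : sm (pd ti (pd zi psi)) by smt.
have sptt : sm (pd ti (pd ti psi)) by smt.
have spzz : sm (pd zi (pd zi psi)) by smt.
have Av : admissible zi v (pd ti (pd zi psi)) by exact: admissible_l.
have Aw : admissible zi w (pd ti (pd ti psi)).
  case: (b) zuw Bu => zz Bu; first exact: admissible_l.
  by apply/admissible_r/ends_zero_pd => //; exact: ends_zero_pd.
have chain : ip (pd zi u) (pd zi psi) = - ip (pd ti v + u) (pd zi (pd zi psi))
    + ip (pd zi v + pd ti w) (pd ti (pd zi psi)) - ip (pd zi w) (pd ti (pd ti psi)).
  have i1 := ibp h_gt0 L_gt0 su spz Au.
  have i2 := ibp h_gt0 L_gt0 sv spzz (or_introl erefl).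
  have i3 := ibp h_gt0 L_gt0 sv spzt Av.
  have i4 := ibp h_gt0 L_gt0 sw spzt (or_introl erefl).
  have i5 := ibp h_gt0 L_gt0 sw sptt Aw.
  have e1 : pd ti (pd zi (pd zi psi)) = pd zi (pd ti (pd zi psi)) by rewrite pdC; [|smo].
  have e2 : pd ti (pd ti (pd zi psi)) = pd zi (pd ti (pd ti psi)).
    by rewrite (pdC ti zi); [|smo]; rewrite (pdC ti zi); [|smo].
  rewrite e1 in i2; rewrite e2 in i4.
  rewrite ipDl; [|smt|smt|smt]; rewrite ipDl; [|smt|smt|smt].
  exact: chain_arith i1 i2 i3 i4 i5.
have c1 := cauchy_schwarz h L (smD (sm_pd ti sv) su) spzz.
have c2 := cauchy_schwarz h L (smD (sm_pd zi sv) (sm_pd ti sw)) spzt.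
have c3 := cauchy_schwarz h L (sm_pd zi sw) sptt.
have d1 : nrm (pd ti v + u) * nrm (pd zi (pd zi psi)) <= 3 * s * (K1 * X) by exact: ler_pM (nrm_ge0 h L _) (nrm_ge0 h L _) nf P1.
have d2 : nrm (pd zi v + pd ti w) * nrm (pd ti (pd zi psi)) <= G * s * (K2 * X) by exact: ler_pM (nrm_ge0 h L _) (nrm_ge0 h L _) ng P2.
have d3 : nrm (pd zi w) * nrm (pd ti (pd ti psi)) <= 3 * s * (K3 * X) by exact: ler_pM (nrm_ge0 h L _) (nrm_ge0 h L _) nk P3.
have d4 : ip (pd zi u) (pd zi psi) <= (3 * K1 + G * K2 + 3 * K3) * (s * X).
  rewrite chain (_ : (3 * K1 + G * K2 + 3 * K3) * (s * X) =
    3 * s * (K1 * X) + G * s * (K2 * X) + 3 * s * (K3 * X)); last by ring.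
  exact: three_terms_le c1 c2 c3 d1 d2 d3.
have suz : sm (pd zi u) by smt.
have sdz : sm (pd zi (u - psi)) by smt.
have e : nrm (pd zi u) ^+ 2 = ip (pd zi u) (pd zi psi) + ip (pd zi u) (pd zi (u - psi)).
  rewrite nrmE -ipDr; [|smt|smt|smt]; congr (Submission.ip h L _ _); rewrite Pz; ring.
have c4 := ip_le h L suz sdz.
have d5 : nrm (pd zi u) * nrm (pd zi (u - psi)) <= nrm (pd zi u) * (378 * (3 * s + Wd)).
  by rewrite ler_wpM2l//; apply: le_trans P4 _; rewrite le_eqVlt; apply/orP; left; apply/eqP; ring.
rewrite -[2 * _ * _]mulrA; exact: absorb_half e d4 (le_trans c4 d5).
Qed.
End AxialBound.

(** * The inequalities for smooth fields *)

Section KornConst.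
Context {R : realType}.
Variable L : R.
Definition shell_len : R := 1 + 288 * L ^+ 2.
Local Notation l := shell_len.
Definition strain_G : R := 3 + 92 * l.
Definition strain_D : R := 3 + 2028 * l.
Definition layer_K1 : R := 11 * 3 + 22 * 3 + 312 * 3.
Definition layer_K2 : R := 11 * (strain_D + 46 * l + 3) + 22 * (6 + strain_G) + 312 * strain_G.
Definition layer_K3 : R := 11 * (strain_D + 166 * l + 6) + 22 * 3 + 312 * 3.
Definition korn_const : R :=
  2 * (3 * layer_K1 + strain_G * layer_K2 + 3 * layer_K3) + (378 * (3 + 46 * l)) ^+ 2
  + (1014 * l) ^+ 2 + (46 * l) ^+ 2 + (166 * l) ^+ 2 + (13 * l) ^+ 2.

Lemma shell_len_ge1 : 1 <= l.
Proof. by rewrite /shell_len lerDl; apply: mulr_ge0; [exact: ler0n|exact: sqr_ge0]. Qed.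

Lemma strain_G_ge0 : 0 <= strain_G.
Proof. by have := shell_len_ge1; rewrite /strain_G; lra. Qed.
Lemma strain_D_ge0 : 0 <= strain_D.
Proof. by have := shell_len_ge1; rewrite /strain_D; lra. Qed.

Lemma layer_sum_ge0 : 0 <= 3 * layer_K1 + strain_G * layer_K2 + 3 * layer_K3.
Proof.
have l1 := shell_len_ge1; have G0 := strain_G_ge0; have D0 := strain_D_ge0.
have k1 : 0 <= layer_K1 by rewrite /layer_K1; lra.
have k2 : 0 <= layer_K2 by rewrite /layer_K2; move: strain_G strain_D l l1 G0 D0 => *; lra.
have k3 : 0 <= layer_K3 by rewrite /layer_K3; move: strain_D l l1 D0 => *; lra.
by rewrite !addr_ge0// mulr_ge0.
Qed.

Lemma korn_const_ge :
  [/\ 2 * (3 * layer_K1 + strain_G * layer_K2 + 3 * layer_K3) + (378 * (3 + 46 * l)) ^+ 2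
        <= korn_const, (1014 * l) ^+ 2 <= korn_const, (46 * l) ^+ 2 <= korn_const,
     (166 * l) ^+ 2 <= korn_const & (13 * l) ^+ 2 <= korn_const].
Proof.
rewrite /korn_const.
have := layer_sum_ge0; move: (3 * layer_K1 + _ + _) => S S0.
have := sqr_ge0 (378 * (3 + 46 * l)); have := sqr_ge0 (1014 * l).
have := sqr_ge0 (46 * l); have := sqr_ge0 (166 * l); have := sqr_ge0 (13 * l).
move: ((378 * (3 + 46 * l)) ^+ 2) ((1014 * l) ^+ 2) ((46 * l) ^+ 2) ((166 * l) ^+ 2) ((13 * l) ^+ 2).
by move=> a b c d e *; split; lra.
Qed.
End KornConst.

Section SmoothTheorem.
Context {R : realType}.
Local Notation pt := (R * R * R)%type.
Implicit Types (u v w : pt -> R).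

Lemma sqr_scaled_le (t n c s K : R) : 0 <= t -> 0 <= n -> t * n <= c * s ->
  c ^+ 2 <= K -> t ^+ 2 * n ^+ 2 <= K * s ^+ 2.
Proof.
move=> t0 n0 H cK; rewrite -exprMn; apply: le_trans (sqr_le (mulr_ge0 t0 n0) H) _.
by rewrite exprMn ler_wpM2r// sqr_ge0.
Qed.

Lemma strain_arith (s l x y : R) :
  (x <= 46 * l * s -> 3 * s + 2 * x <= (3 + 92 * l) * s) /\
  (x <= 1001 * l * s -> y <= 13 * l * s -> 3 * s + 2 * x + 2 * y <= (3 + 2028 * l) * s).
Proof.
split=> [|H1 H2]; last by lra.
by move=> H1; lra.
Qed.

Lemma shear_arith (s l x y : R) : x <= 1001 * l * s -> y <= 13 * l * s ->
  x + y <= 1014 * l * s.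
Proof. by move=> *; lra. Qed.

Lemma axial_arith (s l r V : R) : 0 <= s -> r <= 1 -> r * V <= 46 * l * s ->
  r * (378 * (3 * s + V)) <= 378 * (3 + 46 * l) * s.
Proof.
move=> s0 r1 H; have : r * s <= s by exact: le1_mul.
by move: (r * s) => x; nra.
Qed.

(** The scaling t = h^(1/4) gives the bounds of the tangential components, and
    the curvature argument the one of u_z. The bounds of the fields themselves
    serve to show that the energy vanishes for the zero field only. *)
Theorem smooth_korn (h L : R) u v w (s : R) : 0 < L -> 0 < h -> 40 * h <= 1 ->
  sm u -> sm v -> sm w -> 0 <= s -> strain_bounds h L u v w s ->
  ends_zero L v -> vanish 0 w -> ends_zero L w \/ ends_zero L u ->
  [/\ h * Num.sqrt h * nrm h L (pd ti u - v) ^+ 2 <= korn_const L * s ^+ 2,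
      Num.sqrt h * nrm h L (pd zi v) ^+ 2 <= korn_const L * s ^+ 2,
      h * nrm h L (pd zi u) ^+ 2 <= korn_const L * s ^+ 2 &
      [/\ h * nrm h L u ^+ 2 <= korn_const L * s ^+ 2,
          h * nrm h L v ^+ 2 <= korn_const L * s ^+ 2 &
          nrm h L w <= 6 * L * s]].
Proof.
move=> L0 h0 h40 su sv sw s0 bnd zv w0 zuw.
have h1 : h <= 1 by lra.
set r := Num.sqrt h; set t := Num.sqrt r.
have r0 : 0 < r by rewrite sqrtr_gt0.
have t0 : 0 < t by rewrite sqrtr_gt0.
have tr : t ^+ 2 = r by rewrite sqr_sqrtr// ltW.
have rh : r ^+ 2 = h by rewrite sqr_sqrtr// ltW.
have th : h = t ^+ 4 by rewrite -rh -tr -exprM.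
have t1 : t <= 1.
  rewrite leNgt; apply/negP => t1; have : 1 < t ^+ 4 by rewrite exprn_egt1.
  by rewrite -th ltNge h1.
have mem := membrane_bound h0 L0 su sv sw zv h40 bnd.
have bend := bending_bound h0 L0 su sv s0 h40 bnd.
have rad := radial_bound h0 L0 su sv bnd.
have poin := @poincare_axial R h L h0 L0 0 v (or_introl erefl) sv (proj1 zv).
have N0 := nrm_ge0 h L.
rewrite [X in _ / X]th in bend.
have [B1 B2 B3 B4 B5] := scaling_bounds (ltW L0) s0 t0 t1 (N0 u) (N0 (pd ti u)) (N0 (pd zi v))
   (N0 (pd ti w)) (N0 v) mem poin bend rad.
rewrite -/(shell_len L) in B1 B2 B3 B4 B5.
have l1 := shell_len_ge1 L; set l := shell_len L in l1 B1 B2 B3 B4 B5 *.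
have [k1 k2 k3 k4 k5] := korn_const_ge L.
have t' := ltW t0.
have tn n : 0 <= t ^+ n by rewrite exprn_ge0.
have tn1 n : t ^+ n <= 1 by rewrite exprn_ile1.
have ls0 (c : R) : 0 <= c -> 0 <= c * l * s by move=> c0; rewrite !mulr_ge0// (le_trans ler01).
have dn (n : nat) (x y : R) : x <= y -> 0 <= y -> t ^+ n * x <= y.
  move=> xy y0; apply: le_trans (ler_wpM2l (tn n) xy) _; exact: le1_mul.
have hm n m x : (n + m = 4)%N -> h * x = t ^+ n * (t ^+ m * x).
  by move=> nm; rewrite mulrA -exprD nm -th.
have rm x : r * x = t ^+ 1 * (t * x) by rewrite expr1 mulrA -expr2 tr.
have hW : h * nrm h L (pd ti w) <= 46 * l * s.
  by rewrite (hm 3%N 1%N _ erefl) expr1; apply: (dn _ _ _ B4); exact: (ls0 _ (ler0n _ _)).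
have hA : h * nrm h L (pd ti u) <= 1001 * l * s.
  by rewrite (hm 1%N 3%N _ erefl); apply: (dn _ _ _ B2); exact: (ls0 _ (ler0n _ _)).
have hV : h * nrm h L v <= 13 * l * s.
  by rewrite (hm 3%N 1%N _ erefl) expr1; apply: (dn _ _ _ B5); exact: (ls0 _ (ler0n _ _)).
have hU : h * nrm h L u <= 166 * l * s.
  by rewrite (hm 2%N 2%N _ erefl); apply: (dn _ _ _ B1); exact: (ls0 _ (ler0n _ _)).
have hVz : h * nrm h L (pd zi v) <= 46 * l * s.
  by rewrite (hm 3%N 1%N _ erefl) expr1; apply: (dn _ _ _ B3); exact: (ls0 _ (ler0n _ _)).
have [ba bk bc bf [bg bd]] := bnd.
have ng : nrm h L (pd zi v + pd ti w) <= strain_G L * s.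
  apply: le_trans bg _; rewrite /strain_G -/l; rewrite -mulrA; exact: (strain_arith _ _ _ 0).1.
have nd : nrm h L (pd ti u + pd ri v - v) <= strain_D L * s.
  apply: le_trans bd _; rewrite /strain_D -/l.
  by rewrite -!(mulrA 2 h); exact: (strain_arith _ _ _ _).2.
pose bb := `[< ends_zero L w >].
have zz : if bb then ends_zero L w else ends_zero L u.
  by rewrite /bb; case: ifPn => [/asboolP//|/asboolPn]; case: zuw.
have Mu0 : 0 <= 166 * l by rewrite mulr_ge0 ?ler0n// (le_trans ler01).
have Mv0 : 0 <= 46 * l by rewrite mulr_ge0 ?ler0n// (le_trans ler01).
have hX : h * (s / h) = s by rewrite mulrC divfK// gt_eqF.
have AB := axial_bound h0 h1 L0 su sv sw s0 (strain_G_ge0 L) (strain_D_ge0 L) Mu0 Mv0 zv zz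
  ba bk bc bf ng nd hU hVz (lexx _) hX erefl erefl erefl.
rewrite -/layer_K1 -/(layer_K2 L) -/(layer_K3 L) in AB.
split.
- have -> : h * r = (t ^+ 3) ^+ 2 by rewrite {1}th -tr -exprD -exprM.
  apply: sqr_scaled_le k2 => //; rewrite -/l.
  have := nrmB h L (sm_pd ti su) sv => H.
  have H' := ler_wpM2l (tn 3) H.
  apply: le_trans H' _; rewrite mulrDr.
  have t3V : t ^+ 3 * nrm h L v <= 13 * l * s.
    by rewrite (exprSr t 2) -mulrA; apply: (dn _ _ _ B5); exact: (ls0 _ (ler0n _ _)).
  exact: (shear_arith B2 t3V).
- by rewrite -tr; apply: sqr_scaled_le k3.
- have S0 := layer_sum_ge0 L.
  apply: le_trans (_ : (2 * (3 * layer_K1 + strain_G L * layer_K2 L + 3 * layer_K3 L)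
     + (378 * (3 + 46 * l)) ^+ 2) * s ^+ 2 <= _); last by rewrite ler_wpM2r// sqr_ge0.
  apply: le_trans (ler_wpM2l (ltW h0) AB) _.
  rewrite mulrDr [leRHS]mulrDl; apply: lerD.
    rewrite mulrCA (_ : h * (s * (s / h)) = s ^+ 2)//.
    by rewrite mulrCA hX expr2.
  rewrite -{1}rh -!exprMn; apply: sqr_le.
    apply: mulr_ge0 (ltW r0) (mulr_ge0 (ler0n _ _) (addr_ge0 _ (N0 _))).
    exact: mulr_ge0 (ler0n _ _) s0.
  apply: axial_arith => //; first by rewrite -tr.
  by rewrite rm; apply: (dn _ _ _ B4); exact: (ls0 _ (ler0n _ _)).
- split.
  + rewrite -{1}rh; apply: sqr_scaled_le k4 => //; first exact: ltW.
    by rewrite -tr.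
  + rewrite -{1}rh; apply: sqr_scaled_le k5 => //; first exact: ltW.
    by rewrite rm; apply: (dn _ _ _ B5); exact: (ls0 _ (ler0n _ _)).
  + have pw := @poincare_axial R h L h0 L0 0 w (or_introl erefl) sw w0.
    apply: le_trans pw _.
    apply: le_trans (ler_wpM2l (mulr_ge0 (ler0n _ 2) (ltW L0)) bk) _.
    by rewrite (_ : 2 * L * (3 * s) = 6 * L * s)//; ring.
Qed.
End SmoothTheorem.

(** * The weighted L^2 norm *)

Section WeightedNorm.
Context {R : realType}.
Local Notation pt := (R * R * R)%type.
Local Notation mR := (measurableTypeR R).
Variables (h L : R).
Hypotheses (h_gt0 : 0 < h) (h_lt1 : h < 1).
Local Notation Q := (shell h L).
Implicit Types (f g : pt -> R) (p : pt) (a b c k : R).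

Definition meas f := measurable_fun (Q : set (mR * mR * mR)) (f : mR * mR * mR -> mR).

Definition bnd c f := meas f /\ (sqnorm h L f <= c%:E)%E.

Lemma radius_bounds p : Q p -> 1 / 2 <= p.1.1 <= 3 / 2.
Proof.
move=> [[/= + _] _]; rewrite /Ih /= in_itv/= => /andP[a b].
by move: h_lt1 => h1; apply/andP; split; lra.
Qed.

Lemma radius_ge0 p : Q p -> 0 <= p.1.1.
Proof. by move=> /radius_bounds/andP[r1 _]; apply: le_trans r1; rewrite divr_ge0. Qed.

Lemma continuous_meas f : continuous f -> meas f.
Proof. by move=> cf; apply: measurable_funS (continuous_measurable3 cf). Qed.

Lemma meas_radius : meas (fun p => p.1.1).
Proof. by apply: continuous_meas; exact: (@continuous_crd R ri). Qed.

Lemma meas_dens f : meas f -> meas (fun p => f p ^+ 2 * p.1.1).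
Proof.
move=> mf; apply: measurable_funM; last exact: meas_radius.
exact: measurable_funX.
Qed.

Lemma measE_dens f : meas f ->
  measurable_fun (Q : set (mR * mR * mR)) (fun p : mR * mR * mR => (f p ^+ 2 * p.1.1)%:E).
Proof. by move=> mf; apply/measurable_EFinP; exact: meas_dens. Qed.

Lemma dens_ge0 f p : Q p -> (0 <= (f p ^+ 2 * p.1.1)%:E)%E.
Proof. by move=> Qp; rewrite lee_fin mulr_ge0 ?sqr_ge0// radius_ge0. Qed.

Lemma sqnorm_ge0 f : (0 <= sqnorm h L f)%E.
Proof. by apply: integral_ge0 => p Qp; exact: dens_ge0. Qed.

Lemma sqnorm_comb f g1 g2 a b : meas f -> meas g1 -> meas g2 -> 0 <= a -> 0 <= b ->
  (forall p, Q p -> f p ^+ 2 <= a * g1 p ^+ 2 + b * g2 p ^+ 2) ->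
  (sqnorm h L f <= a%:E * sqnorm h L g1 + b%:E * sqnorm h L g2)%E.
Proof.
move=> mf m1 m2 a0 b0 H; rewrite /sqnorm.
have mQ := measurable_shell h L.
rewrite -!ge0_integralZl_EFin//; last first.
- exact: measE_dens.
- by move=> p; exact: dens_ge0.
- exact: measE_dens.
- by move=> p; exact: dens_ge0.
have e0 c g p : 0 <= c -> Q p -> (0 <= c%:E * (g p ^+ 2 * p.1.1)%:E)%E.
  by move=> c0 Qp; rewrite mule_ge0 ?lee_fin//; exact: (dens_ge0 g).
have em c g : meas g -> measurable_fun (Q : set (mR * mR * mR))
    (fun p : mR * mR * mR => (c%:E * (g p ^+ 2 * p.1.1)%:E)%E).
  by move=> mg; apply: measurable_funeM; exact: measE_dens.
rewrite -ge0_integralD//; [|by move=> p; exact: e0|exact: em|by move=> p; exact: e0|exact: em].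
apply: ge0_le_integral => //.
all: try by move=> p; exact: dens_ge0.
all: try exact: measE_dens.
all: try by apply: emeasurable_funD; exact: em.
move=> p Qp; rewrite -!EFinM -EFinD lee_fin (mulrA a) (mulrA b) -mulrDl.
by apply: ler_wpM2r; [exact: radius_ge0|exact: H].
Qed.

Lemma bnd_comb f g1 g2 a b c1 c2 : meas f -> 0 <= a -> 0 <= b ->
  (forall p, Q p -> f p ^+ 2 <= a * g1 p ^+ 2 + b * g2 p ^+ 2) ->
  bnd c1 g1 -> bnd c2 g2 -> bnd (a * c1 + b * c2) f.
Proof.
move=> mf a0 b0 H [m1 l1] [m2 l2]; split => //.
apply: (le_trans (sqnorm_comb mf m1 m2 a0 b0 H)).
by rewrite EFinD !EFinM leeD// lee_wpmul2l// lee_fin.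
Qed.

Lemma bndW c c' f : c <= c' -> bnd c f -> bnd c' f.
Proof. by move=> cc [mf lf]; split=> //; apply: le_trans lf _; rewrite lee_fin. Qed.

Lemma bnd_ge0 c f : bnd c f -> 0 <= c.
Proof. by move=> [_ /(le_trans (sqnorm_ge0 f))]; rewrite lee_fin. Qed.

Lemma bnd_scale f g a c : meas f -> 0 <= a ->
  (forall p, Q p -> f p ^+ 2 <= a * g p ^+ 2) -> bnd c g -> bnd (a * c) f.
Proof.
move=> mf a0 H bg; have := @bnd_comb f g g a 0 c c mf a0 (lexx _).
by rewrite !mul0r addr0; apply => // p /H; rewrite mul0r addr0.
Qed.

Lemma sqrD_le a b : (a + b) ^+ 2 <= 2 * a ^+ 2 + 2 * b ^+ 2.
Proof. by have := sqr_ge0 (a - b); lra. Qed.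

Lemma bndD f g a b : bnd a f -> bnd b g -> bnd (2 * (a + b)) (fun p => f p + g p).
Proof.
move=> bf bg; rewrite mulrDr; apply: (bnd_comb _ _ _ _ bf bg) => //.
  by apply: measurable_funD; [exact: bf.1|exact: bg.1].
by move=> p _; exact: sqrD_le.
Qed.

Lemma bndB f g a b : bnd a f -> bnd b g -> bnd (2 * (a + b)) (fun p => f p - g p).
Proof.
move=> bf bg; rewrite mulrDr; apply: (bnd_comb _ _ _ _ bf bg) => //.
  by apply: measurable_funB; [exact: bf.1|exact: bg.1].
by move=> p _; have := sqr_ge0 (f p + g p); lra.
Qed.

Lemma eq_bnd f g c : (forall p, f p = g p) -> bnd c f -> bnd c g.
Proof. by move=> /funext ->. Qed.

Lemma integrable_dens f c : bnd c f ->
  (leb3 R).-integrable Q (EFin \o (fun p => f p ^+ 2 * p.1.1)).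
Proof.
move=> [mf lf]; apply/integrableP; split; first exact: measE_dens.
rewrite (_ : (\int[_]_(p in _) _)%E = sqnorm h L f).
  by apply: le_lt_trans lf _; rewrite ltry.
apply: eq_integral => p; rewrite inE => Qp.
by rewrite gee0_abs//; exact: dens_ge0.
Qed.

Lemma Ibox_le_bnd (F : pt -> R) g k c : continuous F -> 0 <= k ->
  (forall p, Q p -> F p <= k * g p ^+ 2) -> bnd c g -> Ibox h L F <= 2 * k * c.
Proof.
move=> cF k0 H bg; have ig := integrable_dens bg.
have mQ := measurable_shell h L.
rewrite -lee_fin EFinM /Ibox /Rintegral fineK; last first.
  by apply: integrable_fin_num => //; exact: continuous_integrable3.
apply: le_trans (_ : (\int[leb3 R]_(p in Q) ((2 * k)%:E * (g p ^+ 2 * p.1.1)%:E) <= _)%E).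
  apply: le_integral => //; first exact: continuous_integrable3.
    exact: (@integrableZl _ _ _ (leb3 R) Q mQ (2 * k) _ ig).
  move=> p; rewrite inE => Qp; rewrite -EFinM lee_fin (le_trans (H p Qp))//.
  have /andP[r1 _] := radius_bounds Qp.
  have : 0 <= k * g p ^+ 2 by rewrite mulr_ge0// sqr_ge0.
  rewrite (_ : 2 * k * _ = 2 * p.1.1 * (k * g p ^+ 2)); last by ring.
  by move=> x0; rewrite -{1}[_ * _]mul1r ler_wpM2r//; lra.
rewrite ge0_integralZl_EFin//; last by rewrite mulr_ge0.
- by rewrite lee_wpmul2l ?lee_fin ?mulr_ge0//; exact: bg.2.
- by move=> p; exact: dens_ge0.
- by apply: measE_dens; exact: bg.1.
Qed.

Lemma bnd_Ibox f : continuous f -> bnd (2 * Ibox h L (f * f)) f.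
Proof.
move=> cf; split; first exact: continuous_meas.
have mQ := measurable_shell h L.
have cff : continuous (f * f) by move=> p; apply: cvgM; exact: cf.
have iff := continuous_integrable3 h L cff.
rewrite EFinM /Ibox /Rintegral fineK; last exact: integrable_fin_num.
rewrite -ge0_integralZl_EFin//; last 2 first.
- by move=> p Qp; rewrite lee_fin; exact: sqr_ge0.
- by apply/measurable_EFinP; exact: continuous_meas.
apply: ge0_le_integral => //.
- by move=> p; exact: dens_ge0.
- by apply: measE_dens; exact: continuous_meas.
- by apply: measurable_funeM; apply/measurable_EFinP; exact: continuous_meas.
move=> p Qp; rewrite -EFinM lee_fin mulrC.
have /andP[_ r2] := radius_bounds Qp.
by rewrite fmulE -expr2 ler_wpM2r ?sqr_ge0//; lra.
Qed.

End WeightedNorm.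

(** * Strain bounds from the energy *)

Section StrainEnergy.
Context {R : realType}.
Local Notation pt := (R * R * R)%type.
Variables (h L : R).
Hypotheses (h_gt0 : 0 < h) (h_lt1 : h < 1) (L_gt0 : 0 < L).
Local Notation Q := (shell h L).
Local Notation nrm := (nrm h L).
Local Notation bnd := (bnd h L).
Local Notation meas := (meas h L).
Implicit Types (f g u v w G : pt -> R) (p : pt) (k E : R).

Lemma nrm_sqr_le f g G k b E : sm f -> sm g -> 0 <= k ->
  (forall p, Q p -> f p ^+ 2 <= k * G p ^+ 2 + b * g p ^+ 2) -> bnd E G ->
  nrm f ^+ 2 <= 2 * k * E + b * nrm g ^+ 2.
Proof.
move=> sf sg k0 H bG; rewrite !nrmE /ip.
have cf : continuous (f * f) by apply: sm_cont; smt.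
have cg : continuous (g * g) by apply: sm_cont; smt.
have cg' : continuous (kst b * (g * g)) by apply: sm_cont; smt.
have cn : continuous (- (kst b * (g * g))) by apply: sm_cont; smt.
have cF : continuous (f * f - kst b * (g * g)) by apply: sm_cont; smt.
have := Ibox_le_bnd h_lt1 cF k0 _ bG.
rewrite IboxD// IboxN// IboxZ// lerBlDr; apply.
move=> p Qp; rewrite faddE foppE !fmulE /kst -!expr2 lerBlDr.
exact: H.
Qed.

Lemma inv_radius p : Q p -> [/\ 0 < p.1.1, p.1.1^-1 ^+ 2 <= 4, p.1.1 ^+ 2 <= 9 / 4 &
  (1 - p.1.1^-1) ^+ 2 <= h ^+ 2].
Proof.
move=> Qp; have /andP[r1 r2] := radius_bounds h_lt1 Qp.
have r0 : 0 < p.1.1 by lra.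
have i0 : 0 < p.1.1^-1 by rewrite invr_gt0.
have i2 : p.1.1^-1 <= 2.
  by rewrite -[leRHS]invrK lef_pV2 ?posrE ?invr_gt0//; lra.
have ri1 : p.1.1 * p.1.1^-1 = 1 by rewrite mulfV// gt_eqF.
move: Qp => [[/= + _] _]; rewrite /Ih /= in_itv/= => /andP[a b].
move: p.1.1 p.1.1^-1 r0 r1 r2 i0 i2 ri1 a b => r i r0 r1 r2 i0 i2 ri a b; split => //.
- by rewrite !expr2; nra.
- by rewrite !expr2; nra.
- have e : 1 - i = i * (r - 1) by rewrite mulrBr (mulrC i) ri mulr1.
  have b1 : - h <= 1 - i by rewrite e; nra.
  have b2 : 1 - i <= h by rewrite e; nra.
  have b3 : 0 <= (h - (1 - i)) * (h + (1 - i)) by apply: mulr_ge0; lra.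
  by rewrite -subr_ge0 subr_sqr.
Qed.

Lemma sqrt_bound (x s y : R) : 0 <= s -> 0 <= y -> x ^+ 2 <= 9 * s ^+ 2 + 2 * y ^+ 2 ->
  x <= 3 * s + 2 * y.
Proof.
move=> s0 y0 H; apply: le_of_sqr; first by rewrite addr_ge0// mulr_ge0.
by apply: (le_trans H); have := mulr_ge0 s0 y0; have := sqr_ge0 y; lra.
Qed.

(** The energy weighs by r and divides angular derivatives by r; since r is
    within h/2 of 1, this changes the strains only by h times the derivatives
    themselves. *)
Lemma strain_bounds_energy u v w E : sm u -> sm v -> sm w ->
  bnd E (pd ri u) -> bnd E (pd zi w) -> bnd E (fun p => pd zi u p + pd ri w p) ->
  bnd E (fun p => (pd ti v p + u p) / p.1.1) ->
  bnd E (fun p => pd zi v p + pd ti w p / p.1.1) ->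
  bnd E (fun p => (pd ti u p - v p) / p.1.1 + pd ri v p) ->
  strain_bounds h L u v w (Num.sqrt E).
Proof.
move=> su sv sw ba bk bc bf bg bd.
have E0 : 0 <= E by exact: bnd_ge0 ba.
set s := Num.sqrt E; have s0 : 0 <= s := sqrtr_ge0 _.
have sE : s ^+ 2 = E by rewrite sqr_sqrtr.
have N0 := nrm_ge0 h L.
have small f G k : sm f -> 0 <= k -> 2 * k <= 9 -> (forall p, Q p -> f p ^+ 2 <= k * G p ^+ 2) ->
    bnd E G -> nrm f <= 3 * s.
  move=> sf k0 k9 H bG; rewrite -[leRHS]addr0 -[X in _ <= _ + X](mulr0 2).
  apply: sqrt_bound => //; rewrite expr0n/= mulr0 addr0 sE.
  have := @nrm_sqr_le f f G k 0 E sf sf k0 _ bG; rewrite mul0r addr0 => H2.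
  apply: le_trans (H2 _) _; last exact: ler_wpM2r.
  by move=> p Qp; rewrite mul0r addr0; exact: H.
have sqE (x : R) : x ^+ 2 <= 1 * x ^+ 2 by rewrite mul1r.
have perturb f g G : sm f -> sm g -> bnd E G ->
    (forall p, f p = G p + (1 - p.1.1^-1) * g p) -> nrm f <= 3 * s + 2 * (h * nrm g).
  move=> sf sg bG fE; apply: sqrt_bound => //; first by rewrite mulr_ge0// ltW.
  have h2 : 0 <= h ^+ 2 := sqr_ge0 h.
  apply: le_trans (@nrm_sqr_le f g G 2 (2 * h ^+ 2) E sf sg _ _ bG) _ => //.
    move=> p Qp; rewrite fE; apply: le_trans (sqrD_le _ _) _.
    rewrite lerD2l -mulrA ler_pM2l// exprMn; apply: ler_wpM2r; first exact: sqr_ge0.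
    by have [] := inv_radius Qp.
  by rewrite sE exprMn; lra.
split.
- by apply: (small _ (pd ri u) 1) => //; [smt|lra].
- by apply: (small _ (pd zi w) 1) => //; [smt|lra].
- by apply: (small _ (fun p => pd zi u p + pd ri w p) 1) => //; [smt|lra].
- apply: (small _ (fun p => (pd ti v p + u p) / p.1.1) (9 / 4)) => //; [smt|lra|].
  move=> p Qp; have [r0 _ r9 _] := inv_radius Qp.
  rewrite faddE exprMn mulrCA -{1}[(_ + _) ^+ 2]mulr1.
  apply: ler_wpM2l; first exact: sqr_ge0.
  by rewrite exprVn ler_pdivlMr ?mul1r// exprn_gt0.
split.
- rewrite -mulrA; apply: perturb bg _; [smt|smt|] => p.
  by rewrite faddE; ring.
- rewrite -!(mulrA 2 h) -[leRHS]addrA -[X in _ <= _ + X]mulrDr -[X in 2 * X]mulrDr.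
  apply: le_trans (perturb (pd ti u + pd ri v - v) (pd ti u - v) _ _ _ bd _) _; [smt|smt| |].
    by move=> p; rewrite !faddE !foppE; ring.
  rewrite lerD2l ler_pM2l// ler_pM2l//; apply: nrmB => //; smt.
Qed.
End StrainEnergy.

(** * Passage to the limit *)

Section Limit.
Context {R : realType}.
Local Notation pt := (R * R * R)%type.
Variables (h L : R).
Hypotheses (h_gt0 : 0 < h) (h_lt1 : h < 1) (L_gt0 : 0 < L).
Local Notation Q := (shell h L).
Local Notation nrm := (nrm h L).
Local Notation bnd := (bnd h L).
Local Notation meas := (meas h L).
Implicit Types (f g u v w G : pt -> R) (p : pt) (k E : R).

Definition approximable (P : (pt -> R) -> Prop) (U : pt -> R) (dU : 'I_3 -> pt -> R) :=
  forall eta : R, 0 < eta -> exists s, [/\ sm s, P s, bnd eta (fun p => s p - U p) &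
    forall i, bnd eta (fun p => pd i s p - dU i p)].

Lemma bnd_closed c k f : 0 <= k -> (forall eta, 0 < eta -> bnd (c + k * eta) f) -> bnd c f.
Proof.
move=> k0 H; split; first by have [] := H 1 ltr01.
apply/lee_addgt0Pr => e e0.
have e1 : 0 < e / (k + 1) by rewrite divr_gt0// ltr_wpDl.
have [_ le] := H _ e1; apply: le_trans le _.
rewrite -EFinD lee_fin lerD2l mulrCA ger_pMr// ler_pdivrMr ?mul1r ?lerDl//.
by rewrite ltr_wpDl.
Qed.

Lemma limit_bound X a b E : 0 <= a -> 0 <= b -> (forall eta, 0 < eta -> exists2 Y,
    bnd (a * (2 * (E + 34 * eta))) Y & bnd (b * eta) (fun p => Y p - X p)) ->
  bnd (4 * a * E) X.
Proof.
move=> a0 b0 H; apply: (@bnd_closed _ (136 * a + 2 * b)).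
  by apply: addr_ge0; apply: mulr_ge0 => //; exact: ler0n.
move=> eta e0; have [Y bY bYX] := H eta e0.
have := bndB h_lt1 bY bYX; rewrite (_ : 2 * (_ + _ * eta) = 4 * a * E + (136 * a + 2 * b) * eta); last by ring.
by apply: eq_bnd => p; rewrite opprB addrC subrK.
Qed.

Lemma bnd_near f g c eta : bnd c g -> bnd eta (fun p => f p - g p) -> bnd (2 * (c + eta)) f.
Proof. by move=> bg bfg; apply: eq_bnd (bndD h_lt1 bg bfg) => p; rewrite addrC subrK. Qed.

Lemma meas_inv_radius : meas (fun p => p.1.1^-1).
Proof.
have c : continuous (fun p : pt => Num.max (p.1.1) (1 / 2)).
  move=> p; apply: (@continuous_max R _ (fun p : pt => p.1.1) (fun=> 1 / 2)).
    exact: (@continuous_crd R ri).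
  exact: cvg_cst.
have c' : continuous (fun p : pt => (Num.max (p.1.1) (1 / 2))^-1).
  move=> p; apply: cvgV; last exact: c.
  by rewrite gt_eqF// lt_max orbC divr_gt0.
apply: eq_measurable_fun (@continuous_meas R h L _ c') => p.
rewrite inE => Qp; have /andP[r1 _] := radius_bounds h_lt1 Qp.
by rewrite max_l.
Qed.

Lemma bnd_div f c : bnd c f -> bnd (4 * c) (fun p => f p / p.1.1).
Proof.
move=> bf; apply: (bnd_scale h_lt1 _ _ _ bf) => //.
  by apply: measurable_funM; [exact: bf.1|exact: meas_inv_radius].
move=> p Qp; rewrite exprMn mulrC; apply: ler_wpM2r; first exact: sqr_ge0.
by have [] := inv_radius h_lt1 Qp.
Qed.

Lemma bnd_nrm f c : sm f -> nrm f ^+ 2 <= c -> bnd (2 * c) f.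
Proof.
move=> sf fc; apply: bndW _ (bnd_Ibox L h_lt1 (sm_cont sf)).
by rewrite ler_pM2l// -/(ip h L f f) -nrmE.
Qed.

(** Approximants have energy at most twice E plus a small term, uniformly
    controlled after h is fixed. The bounds for them do not depend on the
    approximant and pass to the limit in L^2. *)
Theorem limit_korn U V W dU dV dW E (Pu Pw : (pt -> R) -> Prop) : 40 * h <= 1 ->
  approximable Pu U dU -> approximable (ends_zero L) V dV -> approximable Pw W dW ->
  (forall w, Pw w -> vanish 0 w) ->
  (forall u w, Pu u -> Pw w -> ends_zero L w \/ ends_zero L u) ->
  bnd E (dU ri) -> bnd E (dW zi) -> bnd E (fun p => dU zi p + dW ri p) ->
  bnd E (fun p => (dV ti p + U p) / p.1.1) ->
  bnd E (fun p => dV zi p + dW ti p / p.1.1) ->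
  bnd E (fun p => (dU ti p - V p) / p.1.1 + dV ri p) ->
  let K := 32 * korn_const L in
  [/\ bnd (K / (h * Num.sqrt h) * E) (fun p => (dU ti p - V p) / p.1.1),
      bnd (K / Num.sqrt h * E) (dV zi),
      bnd (K / h * E) (dU zi) &
      [/\ bnd (K / h * E) U, bnd (K / h * E) V & bnd (288 * L ^+ 2 * E) W]].
Proof.
move=> h40 aU aV aW Pw0 Puw bA bK bC bF bG bD K.
have E0 := bnd_ge0 h_lt1 bA.
have [k1 _ _ k4 _] := korn_const_ge L.
have K0 : 0 <= korn_const L by apply: le_trans k4; exact: sqr_ge0.
have sh : 0 < Num.sqrt h by rewrite sqrtr_gt0.
have main eta : 0 < eta -> exists u v w, [/\ [/\ sm u, sm v & sm w],
  [/\ bnd eta (fun p => u p - U p), bnd eta (fun p => v p - V p) & bnd eta (fun p => w p - W p)],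
  [/\ bnd eta (fun p => pd ti u p - dU ti p), bnd eta (fun p => pd zi v p - dV zi p) &
      bnd eta (fun p => pd zi u p - dU zi p)] &
  let s := 2 * (E + 34 * eta) in
  [/\ nrm (pd ti u - v) ^+ 2 <= korn_const L / (h * Num.sqrt h) * s,
      nrm (pd zi v) ^+ 2 <= korn_const L / Num.sqrt h * s,
      nrm (pd zi u) ^+ 2 <= korn_const L / h * s &
      [/\ nrm u ^+ 2 <= korn_const L / h * s, nrm v ^+ 2 <= korn_const L / h * s
       & nrm w ^+ 2 <= 36 * L ^+ 2 * s]]].
  move=> e0; have [u [su pu uU duU]] := aU _ e0; have [v [sv pv vV dvV]] := aV _ e0.
  have [w [sw pw wW dwW]] := aW _ e0; exists u, v, w; split => //.
  move=> s; have s0 : 0 <= s by rewrite mulr_ge0// addr_ge0// mulr_ge0// ltW.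
  have es (c : R) : c <= 34 -> 2 * (E + c * eta) <= s.
    by move=> c34; rewrite ler_pM2l// lerD2l ler_wpM2r// ltW.
  have near f g (c : R) : c <= 34 -> bnd E g -> bnd (c * eta) (fun p => f p - g p) -> bnd s f.
    by move=> c34 bg bfg; apply: bndW (es _ c34) (bnd_near bg bfg).
  have one f : bnd eta f -> bnd (1 * eta) f by rewrite mul1r.
  have n1 : (1 : R) <= 34 by rewrite ler1n.
  have two f g : bnd eta f -> bnd eta g -> bnd (4 * eta) (fun p => f p + g p).
    by move=> bf bg; apply: bndW _ (bndD h_lt1 bf bg); lra.
  have twoB f g : bnd eta f -> bnd eta g -> bnd (4 * eta) (fun p => f p - g p).
    by move=> bf bg; apply: bndW _ (bndB h_lt1 bf bg); lra.
  have B : strain_bounds h L u v w (Num.sqrt s).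
    apply: strain_bounds_energy => //.
    - by apply: (near _ _ 1) bA _ => //; apply: one; exact: duU.
    - by apply: (near _ _ 1) bK _ => //; apply: one; exact: dwW.
    - apply: (near _ _ 4) bC _; first by rewrite ler_nat.
      by apply: eq_bnd (two _ _ (duU zi) (dwW ri)) => p; ring.
    - apply: (near _ _ 16) bF _; first by rewrite ler_nat.
      apply: bndW (_ : 4 * (4 * eta) <= _) _; first by lra.
      by apply: eq_bnd (bnd_div (two _ _ (dvV ti) uU)) => p; ring.
    - apply: (near _ _ 10) bG _; first by rewrite ler_nat.
      apply: bndW (_ : 2 * (eta + 4 * eta) <= _) _; first by lra.
      by apply: eq_bnd (bndD h_lt1 (dvV zi) (bnd_div (dwW ti))) => p; ring.
    - apply: (near _ _ 34) bD _; first by rewrite ler_nat.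
      apply: bndW (_ : 2 * (4 * (4 * eta) + eta) <= _) _; first by lra.
      by apply: eq_bnd (bndD h_lt1 (bnd_div (twoB _ _ (duU ti) vV)) (dvV ri)) => p; ring.
  have [] := smooth_korn L_gt0 h_gt0 h40 su sv sw (sqrtr_ge0 s) B pv (Pw0 _ pw) (Puw _ _ pu pw).
  rewrite (sqr_sqrtr s0) => B1 B2 B3 [B4 B5 B6].
  have div (c n : R) : 0 < c -> c * n <= korn_const L * s -> n <= korn_const L / c * s.
    by move=> c0 H; rewrite mulrAC ler_pdivlMr// mulrC.
  split; [apply: div => //; exact: mulr_gt0|exact: div|exact: div|].
  split; [exact: div|exact: div|].
  have := sqr_le (nrm_ge0 h L w) B6; rewrite !exprMn (sqr_sqrtr s0).
  by rewrite (_ : 6 ^+ 2 = 36 :> R)// -natrX.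
have Kh (c : R) : 0 < c -> 0 <= korn_const L / c by move=> c0; rewrite divr_ge0// ltW.
have lim X a b c : 0 <= a -> 0 <= b -> 4 * a <= c -> (forall eta, 0 < eta -> exists2 Y,
    bnd (a * (2 * (E + 34 * eta))) Y & bnd (b * eta) (fun p => Y p - X p)) -> bnd (c * E) X.
  move=> a0 b0 ac H; apply: bndW _ (limit_bound a0 b0 H).
  exact: ler_wpM2r.
have KE (c : R) : K / c = 32 * (korn_const L / c) by rewrite /K mulrA.
have shh : 0 < h * Num.sqrt h by rewrite mulr_gt0.
split.
- apply: (lim _ (8 * (korn_const L / (h * Num.sqrt h))) 16) => //.
  + by rewrite mulr_ge0// Kh.
  + by rewrite KE; lra.
  move=> eta e0; have [u [v [w [[su sv sw] [uU vV wW] [d1 d2 d3] [B1 _ _ _]]]]] := main eta e0.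
  exists (fun p => (pd ti u - v) p / p.1.1).
    apply: bndW _ (bnd_div (bnd_nrm _ B1)); last smt.
    by move: (korn_const L / _) (2 * (E + _)) => x y; rewrite (_ : 4 * (2 * (x * y)) = 8 * x * y)//; ring.
  apply: bndW (_ : 4 * (2 * (eta + eta)) <= _) _; first by lra.
  apply: eq_bnd (bnd_div (bndB h_lt1 d1 vV)) => p.
  by rewrite faddE foppE; ring.
- apply: (lim _ (2 * (korn_const L / Num.sqrt h)) 1) => //.
  + by rewrite mulr_ge0// Kh.
  + by rewrite KE; have := Kh _ sh; lra.
  move=> eta e0; have [u [v [w [[su sv sw] [uU vV wW] [d1 d2 d3] [_ B2 _ _]]]]] := main eta e0.
  by exists (pd zi v); rewrite ?mul1r// -mulrA; apply: bnd_nrm B2; smt.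
- apply: (lim _ (2 * (korn_const L / h)) 1) => //.
  + by rewrite mulr_ge0// Kh.
  + by rewrite KE; have := Kh _ h_gt0; lra.
  move=> eta e0; have [u [v [w [[su sv sw] [uU vV wW] [d1 d2 d3] [_ _ B3 _]]]]] := main eta e0.
  by exists (pd zi u); rewrite ?mul1r// -mulrA; apply: bnd_nrm B3; smt.
split.
- apply: (lim _ (2 * (korn_const L / h)) 1) => //.
  + by rewrite mulr_ge0// Kh.
  + by rewrite KE; have := Kh _ h_gt0; lra.
  move=> eta e0; have [u [v [w [[su sv sw] [uU vV wW] _ [_ _ _ [B4 B5 B6]]]]]] := main eta e0.
  by exists u; rewrite ?mul1r// -mulrA; apply: bnd_nrm B4; smt.
- apply: (lim _ (2 * (korn_const L / h)) 1) => //.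
  + by rewrite mulr_ge0// Kh.
  + by rewrite KE; have := Kh _ h_gt0; lra.
  move=> eta e0; have [u [v [w [[su sv sw] [uU vV wW] _ [_ _ _ [B4 B5 B6]]]]]] := main eta e0.
  by exists v; rewrite ?mul1r// -mulrA; apply: bnd_nrm B5; smt.
- have L2 := sqr_ge0 L.
  apply: (lim _ (2 * (36 * L ^+ 2)) 1) => //; [lra|lra|].
  move=> eta e0; have [u [v [w [[su sv sw] [uU vV wW] _ [_ _ _ [B4 B5 B6]]]]]] := main eta e0.
  by exists w; rewrite ?mul1r// -mulrA; apply: bnd_nrm B6; smt.
Qed.
End Limit.

(** * Boundary layers *)

Section Tonelli.
Context d1 d2 (T1 : measurableType d1) (T2 : measurableType d2) (R : realType).
Variables (m1 : {sigma_finite_measure set T1 -> \bar R})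
          (m2 : {sigma_finite_measure set T2 -> \bar R}).
Variables (A : set T1) (B : set T2) (f : T1 * T2 -> \bar R).
Hypotheses (mA : measurable A) (mB : measurable B).
Hypothesis mf : measurable_fun (A `*` B) f.
Hypothesis f0 : forall p, (A `*` B) p -> (0 <= f p)%E.

Let mF : measurable_fun setT (f \_ (A `*` B)).
Proof. by apply/(measurable_restrictT _ _).1 => //; exact: measurableX. Qed.
Let F0 p : (0 <= (f \_ (A `*` B)) p)%E.
Proof. by rewrite patchE; case: ifPn => // /set_mem /f0. Qed.

Lemma tonelli_rect1 : (\int[m1 \x m2]_(p in A `*` B) f p =
  \int[m1]_(x in A) \int[m2]_(y in B) f (x, y))%E.
Proof.
rewrite integral_mkcond (@fubini_tonelli1 _ _ _ _ _ m1 m2 _ mF F0) [RHS]integral_mkcond.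
apply: eq_integral => x _; rewrite /fubini_F patchE.
have [Ax|nAx] := pselect (A x); last first.
  rewrite memNset// integral0_eq// => y _; rewrite patchE memNset// => -[].
  by [].
rewrite mem_set// [RHS]integral_mkcond; apply: eq_integral => y _; rewrite !patchE.
by have [By|nBy] := pselect (B y); [rewrite !mem_set|rewrite !memNset// => -[]].
Qed.

Lemma tonelli_rect2 : (\int[m1 \x m2]_(p in A `*` B) f p =
  \int[m2]_(y in B) \int[m1]_(x in A) f (x, y))%E.
Proof.
rewrite integral_mkcond (@fubini_tonelli2 _ _ _ _ _ m1 m2 _ mF F0) [RHS]integral_mkcond.
apply: eq_integral => y _; rewrite /fubini_G patchE.
have [By|nBy] := pselect (B y); last first.
  rewrite memNset// integral0_eq// => x _; rewrite patchE memNset// => -[].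
  by [].
rewrite mem_set// [RHS]integral_mkcond; apply: eq_integral => x _; rewrite !patchE.
by have [Ax|nAx] := pselect (A x); [rewrite !mem_set|rewrite !memNset// => -[]].
Qed.
End Tonelli.

Lemma cvg0_near {R : realType} (u : nat -> \bar R) (eta : R) : u n @[n --> \oo] --> 0%E ->
  0 < eta -> \forall n \near \oo, (u n < eta%:E)%E.
Proof.
move=> H e0; apply: (H [set y | (y < eta%:E)%E]); apply: open_nbhs_nbhs; split; first exact: open_ereal_lt_ereal.
by rewrite /= lte_fin.
Qed.

Section BoundaryLayer.
Context {R : realType}.
Local Notation pt := (R * R * R)%type.
Local Notation leb := (@lebesgue_measure R).
Local Notation mR := (measurableTypeR R).
Variables (h L : R).
Hypotheses (h_gt0 : 0 < h) (h_lt1 : h < 1) (L_gt0 : 0 < L).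
Local Notation Q := (shell h L).
Local Notation bnd := (bnd h L).
Local Notation meas := (meas h L).
Local Notation Ibox := (Ibox h L).
Implicit Types (f g u v w G : pt -> R) (p : pt).

(** Here e is exp(-m|z - c|). Up to the sign sg, the derivative of m e^2 a^2
    is 2 m^2 e^2 a^2 + 2 sg m e^2 a a_z; the product is absorbed by half of
    the first term, and the boundary term at the other end has the favourable
    sign. The integral over the face is written as a box integral of a
    function constant in z, whence the division by L. *)
Lemma layer_bound (c sg m : R) (a e : pt -> R) : c = 0 /\ sg = -1 \/ c = L /\ sg = 1 ->
  0 <= m -> sm a -> sm e -> pd zi e = kst (sg * m) * e -> (forall q, e (q, c) = 1) ->
  Ibox (kst m * e * a * (kst m * e * a)) <=
  m / L * Ibox (sub zi 0 c (a * a)) + Ibox (e * pd zi a * (e * pd zi a)).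
Proof.
move=> Hc m0 sa se de e1.
have [A [sA dA AE]] := axial_freeze c (smM sa sa).
have AEs : sub zi 0 c (a * a) = A.
  by apply/funext => -[q z]; rewrite AE /sub /upd /crd /= mul0r add0r.
rewrite AEs -IboxZ; last smo.
rewrite -/(kst (m / L)).
rewrite -subr_ge0 -IboxD; [|smo|smo]; rewrite -IboxN; last smo.
rewrite -IboxD; [|smo|smo].
pose G := kst (m / L) * A * crd zi - kst (sg * m) * (e * a * (e * a)).
have sG : sm G by rewrite /G; smt.
apply: (@Ibox_slice_ge0 _ _ _ zi); first smo.
move=> p; rewrite /lo /hi /=.
have dG (x : R) : is_derive x (1 : R) (fun s => G (upd zi p s)) (pd zi G (upd zi p x)).
  exact: haspd_line (smooth_haspd zi (sm_smooth sG)).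
have cdG : continuous (fun s => pd zi G (upd zi p s)).
  by apply: continuous_line; smo.
apply: le_trans (_ : \int[leb]_(s in `[0, L]) pd zi G (upd zi p s) <= _).
  rewrite (Rint_FTC L_gt0 dG)// /G.
  rewrite !(faddE, foppE, fmulE) /kst /upd /crd /= !AE !mulr0 (mulrAC _ _ L) divfK ?gt_eqF//.
  case: Hc => -[cE ->]; rewrite cE !fmulE.
    have -> : e (p.1, 0) = 1 by rewrite -(e1 p.1) cE.
    by have := mulr_ge0 m0 (sqr_ge0 (e (p.1, L) * a (p.1, L))); rewrite expr2; lra.
  have -> : e (p.1, L) = 1 by rewrite -(e1 p.1) cE.
  by have := mulr_ge0 m0 (sqr_ge0 (e (p.1, 0) * a (p.1, 0))); rewrite expr2; lra.
apply: le_Rintegral => //.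
- exact: continuous_integrable_itv.
- by apply/continuous_integrable_itv/continuous_line; smo.
move=> s _; move: (upd zi p s) => q.
have -> : pd zi G = kst (m / L) * A - kst (sg * m) * (kst 2 * e * a *
    (kst (sg * m) * e * a + e * pd zi a)).
  rewrite /G pdD; [|smo|smo]; rewrite pdN; last smo.
  do 5! (rewrite pdM; [|smo|smo]); rewrite !pd_kst dA pd_crd eqxx de (_ : (true%:R : pt -> R) = 1)//.
  have -> : (kst 2 : pt -> R) = 2 by apply/funext.
  ring.
rewrite !(faddE, foppE, fmulE) /kst.
have := sqr_ge0 (sg * m * (e q * a q) + e q * pd zi a q).
move: (m / L * A q) (e q) (a q) (pd zi a q) => mA x y z H.
rewrite -subr_ge0; apply: le_trans H _; rewrite le_eqVlt; apply/orP; left; apply/eqP.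
by case: Hc => -[_ ->]; ring.
Qed.


Lemma Ibox_face c a eta : continuous a ->
  (sqnorm_face h (fun q => a (q, c)) <= eta%:E)%E ->
  Ibox (sub zi 0 c (a * a)) <= 2 * L * eta.
Proof.
move=> ca Hf; have caa : continuous (a * a) by move=> p; apply: cvgM; exact: ca.
have cA := @continuous_sub R zi 0 c _ caa.
have iA := continuous_integrable3 h L cA.
have mI (x y : R) : measurable (`[x, y] : set mR) by exact: measurable_itv.
have mF : measurable (Ih h `*` `[0, 2 * pi] : set (mR * mR)%type).
  by apply: measurableX; exact: measurable_itv.
rewrite -lee_fin /Submission.Ibox /Rintegral fineK; last first.
  by apply: integrable_fin_num => //; exact: measurable_shell.
pose F (p : mR * mR * mR) : \bar R := (sub zi 0 c (a * a) p)%:E.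
have F0 p : (0 <= F p)%E by rewrite lee_fin /sub fmulE -expr2 sqr_ge0.
have mFF : measurable_fun (Q : set (mR * mR * mR)) F.
  by apply/measurable_EFinP; exact: continuous_meas.
have cq : measurable_fun (Ih h `*` `[0, 2 * pi] : set (mR * mR)%type) (fun q : mR * mR => a (q, c) : mR).
  apply: (@measurable_funS _ _ _ _ setT) => //.
  apply: (@measurableT_comp _ _ _ _ _ _ (a : mR * mR * mR -> mR) _ (fun q : mR * mR => (q, c : mR))).
    exact: continuous_measurable3.
  exact: measurable_fun_pair.
have r0 (q : R * R) : (Ih h `*` `[0, 2 * pi]) q -> 1 / 2 <= q.1.
  by move=> [/= + _]; rewrite /Ih /= in_itv/= => /andP[r1 _]; move: h_lt1 => h1; lra.
rewrite (_ : (\int[leb3 R]_(p in Q) _)%E = (\int[leb3 R]_(p in Q) F p)%E)//.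
rewrite (tonelli_rect1 (leb2 R) leb mF (mI _ _) mFF (fun p _ => F0 p)).
rewrite EFinM; apply: le_trans (_ : ((2 * L)%:E * sqnorm_face h (fun q => a (q, c)) <= _)%E); last first.
  by apply: lee_wpmul2l; rewrite // lee_fin mulr_ge0// ltW.
rewrite /sqnorm_face -ge0_integralZl_EFin//; last 3 first.
- move=> q /r0 q2; rewrite lee_fin mulr_ge0 ?sqr_ge0//; lra.
- apply/measurable_EFinP; apply: measurable_funM; first exact: measurable_funX.
  exact: measurable_funS (measurable_fst).
- by rewrite mulr_ge0// ltW.
have lebL : leb `[0%R, L] = L%:E.
  by rewrite lebesgue_measure_itv/= lte_fin L_gt0 -EFinB subr0.
have slice q : (\int[leb]_(y in `[0%R, L]) F (q, y) = (L * a (q, c) ^+ 2)%:E)%E.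
  rewrite (_ : (fun y => F (q, y)) = cst (a (q, c) ^+ 2)%:E).
    by rewrite integral_cst//; rewrite [X in (_ * X)%E]lebL -EFinM mulrC.
  by apply/funext => y; rewrite /F /sub /crd /upd /= mul0r add0r fmulE -expr2.
apply: ge0_le_integral => //.
- by move=> q _; apply: integral_ge0 => z _; exact: F0.
- apply: (eq_measurable_fun (fun q : mR * mR => (L * a (q, c) ^+ 2)%:E)).
    by move=> q _; rewrite slice.
  by apply/measurable_EFinP; apply: measurable_funM => //; exact: measurable_funX.
- apply/measurable_EFinP; apply: measurable_funM => //; apply: measurable_funM; first exact: measurable_funX.
  exact: measurable_funS (measurable_fst).
move=> q /r0 q2; rewrite slice -EFinM lee_fin.
rewrite (_ : 2 * L * _ = L * a (q, c) ^+ 2 * (2 * q.1)); last by ring.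
apply: ler_peMr; last by lra.
by rewrite mulr_ge0 ?sqr_ge0// ltW.
Qed.

Lemma plane_negligible (c : R) : (leb3 R).-negligible [set p : mR * mR * mR | p.2 = c].
Proof.
exists (setT `*` [set c]); split => //; first by apply: measurableX.
  by rewrite [LHS]product_measure1E//= lebesgue_measure_set1 mule0.
Qed.

(** Dominated convergence: the exponential tends to zero off the plane z = c.
    *)
Lemma layer_vanishes (sg c : R) U b eta : bnd b U -> 0 < eta ->
  (forall z, 0 <= z <= L -> sg * (z - c) <= 0) -> sg != 0 ->
  \forall n \near \oo, bnd eta (fun p => expR (sg * n%:R * (p.2 - c)) * U p).
Proof.
move=> bU e0 Hsg sg0.
have mE n : meas (fun p => expR (sg * n%:R * (p.2 - c))).
  apply: continuous_meas => p.
  apply: (continuous_comp (f := fun p : pt => sg * n%:R * (p.2 - c)) (g := expR)); last exact: continuous_expR.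
  apply: cvgM; first exact: cvg_cst.
  by apply: cvgB; [exact: (@continuous_crd R zi)|exact: cvg_cst].
have mf n : meas (fun p => expR (sg * n%:R * (p.2 - c)) * U p).
  by apply: measurable_funM; [exact: mE|exact: bU.1].
pose f_ n (p : mR * mR * mR) := ((expR (sg * n%:R * (p.2 - c)) * U p) ^+ 2 * p.1.1)%:E.
have eE n p : expR (sg * n%:R * (p.2 - c)) = expR (sg * (p.2 - c)) ^+ n.
  by rewrite mulrAC -expRM_natl mulr_natr mulr_natl.
have le1 p : Q p -> expR (sg * (p.2 - c)) <= 1.
  by move=> [_ /=]; rewrite in_itv/= => /Hsg ?; rewrite expR_le1.
have fcvg : {ae leb3 R, forall p, Q p -> f_ ^~ p @ \oo --> cst 0%E p}.
  have [N [mN N0 sN]] := plane_negligible c.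
  exists N; split => // p /= np; apply: sN => /=; apply: contrapT => pc; apply: np => Qp.
  have lt1 : expR (sg * (p.2 - c)) < 1.
    rewrite lt_neqAle le1// andbT -expR0; apply/eqP => /expR_inj/eqP.
    by rewrite mulf_eq0 (negbTE sg0) subr_eq0 => /eqP.
  rewrite /f_ /=; apply: cvg_EFin; first by near=> n.
  have ee : (fun n : nat => expR (sg * (p.2 - c)) ^+ n) @ \oo --> (0 : R).
    by apply: cvg_expr; rewrite ger0_norm ?expR_ge0.
  have -> : (fine \o (fun n : nat => ((expR (sg * n%:R * (p.2 - c)) * U p) ^+ 2 * p.1.1)%:E)) =
    (fun n : nat => (expR (sg * (p.2 - c)) ^+ n * U p) ^+ 2 * p.1.1).
    by apply/funext => n /=; rewrite eE.
  rewrite /= -[X in _ --> X](mul0r p.1.1); apply: cvgMl.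
  rewrite -[X in _ --> X](_ : (0 * U p) * (0 * U p) = 0); last by rewrite mul0r mul0r.
  by under eq_fun do rewrite expr2; apply: cvgM; apply: cvgMl.
have fdom : {ae leb3 R, forall p n, Q p -> (`|f_ n p| <= (U p ^+ 2 * p.1.1)%:E)%E}.
  apply: aeW => p n Qp; rewrite /f_ gee0_abs; last exact: (dens_ge0 h_lt1 (fun p => expR (sg * n%:R * (p.2 - c)) * U p) Qp).
  rewrite lee_fin ler_wpM2r ?(radius_ge0 h_lt1 Qp)// exprMn eE.
  rewrite -[leRHS]mul1r ler_wpM2r ?sqr_ge0//.
  by rewrite exprn_ile1// ?exprn_ge0 ?expR_ge0// exprn_ile1 ?expR_ge0// le1.
have [_ _ H] := @dominated_convergence _ _ R (leb3 R) Q (measurable_shell h L) f_ (cst 0%E)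
  (fun p => (U p ^+ 2 * p.1.1)%:E)
  (fun n => measE_dens (mf n)) (measurable_cst _) fcvg (integrable_dens h_lt1 bU) fdom.
have {H} : sqnorm h L (fun p => expR (sg * n%:R * (p.2 - c)) * U p) @[n --> \oo] --> 0%E.
  by rewrite -[X in _ --> X](integral0 (leb3 R) Q).
move=> /cvg0_near/(_ e0).
by apply: filterS => n Hn; split => //; exact: ltW.
Unshelve. all: by end_near. Qed.

End BoundaryLayer.

(** * Smooth approximation with boundary values *)

Section Traces.
Context {R : realType}.
Local Notation pt := (R * R * R)%type.
Local Notation leb := (@lebesgue_measure R).
Local Notation mR := (measurableTypeR R).
Variables (h L : R).
Hypotheses (h_gt0 : 0 < h) (h_lt1 : h < 1) (L_gt0 : 0 < L).
Local Notation Q := (shell h L).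
Local Notation bnd := (bnd h L).
Local Notation meas := (meas h L).
Local Notation Ibox := (Ibox h L).
Local Notation approximable := (approximable h L).
Implicit Types (f g u v w G : pt -> R) (p : pt).

Lemma in_L2_bnd u : in_L2 h L u -> exists c, bnd c u.
Proof.
move=> [mu lu]; exists (fine (sqnorm h L u)); split => //.
by rewrite fineK// ge0_fin_numE//; exact: sqnorm_ge0.
Qed.

Lemma weak_partial_spec i u : (exists v, is_weak_partial h L i u v) ->
  is_weak_partial h L i u (weak_partial h L i u).
Proof. by move=> [v Hv]; exact: (xgetPex (fun=> 0) (ex_intro _ v Hv)). Qed.

Lemma weak_partial_bnd i u : W12 h L u -> exists c, bnd c (weak_partial h L i u).
Proof. by move=> [_ _ /(_ i)/weak_partial_spec[Hv _]]; exact: in_L2_bnd. Qed.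

(** A smooth function with small values on an end face is made to vanish there
    by the factor 1 - exp(-m|z - c|). The derivative of that factor costs no more
    than m times the boundary values, and m is fixed before the approximation. *)
Theorem zero_trace_approximable c u : c = 0 \/ c = L -> W12 h L u ->
  zero_trace h L c u -> approximable (vanish c) u (fun i => weak_partial h L i u).
Proof.
move=> Hc Wu [un [sun cu cdu cf]] eta eta0.
have [sg Hsg] : exists sg : R, c = 0 /\ sg = -1 \/ c = L /\ sg = 1.
  by case: Hc => ->; [exists (-1); left|exists 1; right].
have sg0 : sg != 0 by case: Hsg => -[_ ->]; rewrite ?oppr_eq0 oner_eq0.
have Hz z : 0 <= z <= L -> sg * (z - c) <= 0.
  by case: Hsg => -[-> ->] /andP[z0 zL]; lra.
pose d := eta / 60; have d0 : 0 < d by rewrite divr_gt0.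
have [_ /in_L2_bnd[bu Bu] _] := Wu.
have [m [mu mr mt mz]] : exists m : nat, let e p := expR (sg * m%:R * (p.2 - c)) in
    [/\ bnd d (fun p => e p * u p), bnd d (fun p => e p * weak_partial h L ri u p),
        bnd d (fun p => e p * weak_partial h L ti u p) &
        bnd d (fun p => e p * weak_partial h L zi u p)].
  have [b1 B1] := weak_partial_bnd ri Wu; have [b2 B2] := weak_partial_bnd ti Wu.
  have [b3 B3] := weak_partial_bnd zi Wu.
  have H0 := layer_vanishes h_lt1 Bu d0 Hz sg0; have H1 := layer_vanishes h_lt1 B1 d0 Hz sg0.
  have H2 := layer_vanishes h_lt1 B2 d0 Hz sg0; have H3 := layer_vanishes h_lt1 B3 d0 Hz sg0.
  by have [m [[? ?] [? ?]]] := filter_ex (filterI (filterI H0 H1) (filterI H2 H3)); exists m.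
have m1 : 0 < d / (m%:R + 1) by rewrite divr_gt0// ltr_wpDl.
have [a [sa au adu af]] : exists a, [/\ sm a, bnd d (fun p => a p - u p),
    (forall i, bnd d (fun p => pd i a p - weak_partial h L i u p)) &
    (sqnorm_face h (fun q => a (q, c)) <= (d / (m%:R + 1))%:E)%E].
  have H0 := cvg0_near cu d0; have H1 := cvg0_near (cdu ri) d0.
  have H2 := cvg0_near (cdu ti) d0; have H3 := cvg0_near (cdu zi) d0.
  have H4 := cvg0_near cf m1.
  have [n [[N0 N1] [[N2 N3] N4]]] := filter_ex (filterI (filterI H0 H1) (filterI (filterI H2 H3) H4)).
  have sn := sun n; exists (un n); split; first exact: sn.
  - split; first by apply: measurable_funB; [exact: continuous_meas (sm_cont sn)|exact: Bu.1].
    exact: ltW.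
  - move=> i; have [b Bi] := weak_partial_bnd i Wu.
    split; first by apply: measurable_funB; [exact: continuous_meas (sm_cont (sm_pd i sn))|exact: Bi.1].
    rewrite pd_def; apply: ltW; move: i {b Bi} => i.
    by case: (ord3P i) => ->; [exact: N1|exact: N2|exact: N3].
  - rewrite (_ : (fun q => _) = (fun q => un n (q, c) - 0)); last by apply/funext => q; rewrite subr0.
    exact: ltW.
have [e0 [se0 de0 e0E]] := axial_exp (sg * m%:R : R).
pose e := kst (expR (- (sg * m%:R * c))) * e0.
have se : sm e by rewrite /e; smt.
have eE p : e p = expR (sg * m%:R * (p.2 - c)).
  by case: p => q z; rewrite /e fmulE /kst e0E -expRD mulrBr addrC.
have de : pd zi e = kst (sg * m%:R) * e.
  rewrite /e pdM; [|smo|smo]; rewrite pd_kst de0; ring.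
have dej i : i != zi -> pd i e = 0.
  move=> iz; have -> : e = (fun x => expR (sg * m%:R * (x - c))) \o crd zi.
    by apply/funext => p; rewrite eE.
  have dc (x : R) : is_derive x (1 : R) (fun x => expR (sg * m%:R * (x - c)))
      (sg * m%:R * expR (sg * m%:R * (x - c))).
    have h1 : is_derive x (1 : R) (fun t : R => sg * m%:R * (t - c)) (sg * m%:R).
      have := is_deriveZ (sg * m%:R) (is_deriveB (is_derive_id x (1 : R)) (is_derive_cst c x (1 : R))).
      by move/is_derive_eq; apply; rewrite /GRing.scale/= subr0 mulr1.
    have := @is_derive1_comp _ expR (fun t : R => sg * m%:R * (t - c)) _ _ _ (is_derive_expR _) h1.
    by move/is_derive_eq; apply; rewrite mulrC.
  rewrite (haspdE (haspd_comp_crd i zi dc)) (negbTE iz).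
  by apply/funext => p; rewrite /= mul0r.
have e1 q : e (q, c) = 1 by rewrite eE /= subrr mulr0 expR0.
have e_le1 p : Q p -> e p ^+ 2 <= 1.
  move=> [_ /=]; rewrite in_itv/= => /Hz z0.
  by rewrite eE exprn_ile1 ?expR_ge0// expR_le1 mulrAC; apply: mulr_le0_ge0.
clearbody e.
have eb f b : bnd b f -> bnd b (fun p => e p * f p).
  move=> bf; rewrite -[b]mul1r; apply: (bnd_scale h_lt1 _ ler01 _ bf).
    by apply: measurable_funM; [exact: continuous_meas (sm_cont se)|exact: bf.1].
  by move=> p Qp; rewrite exprMn ler_wpM2r ?sqr_ge0// e_le1.
have cut f F : bnd d (fun p => f p - F p) -> bnd d (fun p => e p * F p) ->
    bnd (4 * d) (fun p => e p * f p).
  move=> fF eF; rewrite (_ : 4 * d = 2 * (d + d)); last by ring.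
  by apply: eq_bnd (bndD h_lt1 (eb _ _ fF) eF) => p; ring.
have cutB f F : bnd d (fun p => f p - F p) -> bnd d (fun p => e p * F p) ->
    bnd (10 * d) (fun p => f p - e p * f p - F p).
  move=> fF eF; rewrite (_ : 10 * d = 2 * (d + 4 * d)); last by ring.
  by apply: eq_bnd (bndB h_lt1 fF (cut _ _ fF eF)) => p; ring.
have mE (F : pt -> R) : bnd d (fun p => expR (sg * m%:R * (p.2 - c)) * F p) ->
    bnd d (fun p => e p * F p).
  by apply: eq_bnd => p; rewrite eE.
have {}mu := mE _ mu; have {}mr := mE _ mr; have {}mt := mE _ mt; have {}mz := mE _ mz.
have d60 : 10 * d <= eta by rewrite /d; lra.
exists (a - e * a); split.
- smt.
- by move=> x t; rewrite faddE foppE fmulE e1 mul1r subrr.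
- apply: bndW d60 _; apply: eq_bnd (cutB _ _ au mu) => p.
  by rewrite faddE foppE fmulE.
have tang i : i != zi -> bnd d (fun p => e p * weak_partial h L i u p) ->
    bnd eta (fun p => pd i (a - e * a) p - weak_partial h L i u p).
  move=> iz mi; apply: bndW d60 _; apply: eq_bnd (cutB _ _ (adu i) mi) => p.
  rewrite pdD; [|smo|smo]; rewrite pdN; last smo.
  rewrite pdM; [|smo|smo]; rewrite dej// mul0r add0r.
  by rewrite faddE foppE fmulE.
move=> i; case: (ord3P i) => ->; [exact: tang|exact: tang|].
have Hl := layer_bound h L_gt0 Hsg (ler0n R m) sa se de e1.
have Hf := Ibox_face h_lt1 L_gt0 (sm_cont sa) af.
have I1 : Ibox (e * pd zi a * (e * pd zi a)) <= 8 * d.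
  rewrite (_ : 8 * d = 2 * 1 * (4 * d)); last by ring.
  apply: (Ibox_le_bnd h_lt1 _ ler01 _ (cut _ _ (adu zi) mz)); first smo.
  by move=> p _; rewrite !fmulE mul1r expr2.
have I2 : Ibox (kst m%:R * e * a * (kst m%:R * e * a)) <= 10 * d.
  apply: le_trans Hl _; rewrite (_ : 10 * d = 2 * d + 8 * d); last by ring.
  apply: lerD => //.
  apply: le_trans (ler_wpM2l _ Hf) _; first by rewrite divr_ge0// ltW.
  rewrite (_ : m%:R / L * _ = 2 * (d * (m%:R / (m%:R + 1)))).
    by rewrite ler_pM2l// ger_pMr// ler_pdivrMr ?mul1r ?lerDl// ltr_wpDl.
  by field; rewrite (gt_eqF L_gt0) /= gt_eqF// ltr_wpDl.
have B2 : bnd (20 * d) (kst m%:R * e * a).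
  by apply: bndW _ (bnd_Ibox L h_lt1 _); [rewrite (_ : 20 * d = 2 * (10 * d)) ?ler_pM2l//; ring|smo].
have sgm : bnd (20 * d) (fun p => sg * (kst m%:R * e * a) p).
  rewrite -[20 * d]mul1r; apply: (bnd_scale h_lt1 _ ler01 _ B2).
    by apply: measurable_funM => //; exact: B2.1.
  by move=> p _; rewrite exprMn; case: Hsg => -[_ ->]; rewrite ?sqrrN expr1n.
apply: bndW (_ : 2 * (10 * d + 20 * d) <= _) _; first by rewrite /d; lra.
apply: eq_bnd (bndB h_lt1 (cutB _ _ (adu zi) mz) sgm) => p.
rewrite pdD; [|smo|smo]; rewrite pdN; last smo.
rewrite pdM; [|smo|smo]; rewrite de !(faddE, foppE, fmulE) /kst; ring.
Qed.

(** Linear interpolation in z between functions that vanish on one end each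
    has the limit u and vanishes on both. *)
Lemma ends_approximable u (du : 'I_3 -> pt -> R) : approximable (vanish 0) u du ->
  approximable (vanish L) u du -> approximable (ends_zero L) u du.
Proof.
move=> A0 AL eta eta0.
pose K : R := 8 * (1 + (L^-1) ^+ 2); have K0 : 0 < K.
  by rewrite mulr_gt0// ltr_wpDr// sqr_ge0.
pose d := eta / K; have d0 : 0 < d by rewrite divr_gt0.
have [a [sa a0 au adu]] := A0 _ d0; have [b [sb bL bu bdu]] := AL _ d0.
pose t := kst L^-1 * (crd zi : pt -> R).
have st : sm t by rewrite /t; apply: smM; [exact: sm_kst|exact: sm_crd].
have dt i : pd i t = (i == zi)%:R * kst L^-1.
  rewrite /t pdM; [|exact: smooth_cst|exact: smooth_crd]; rewrite pd_kst pd_crd; ring.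
have t01 p : Q p -> 0 <= t p <= 1.
  move=> [_ /=]; rewrite in_itv/= => /andP[z0 zL].
  rewrite /t fmulE /kst /crd /= mulr_ge0 ?invr_ge0 ?(ltW L_gt0)//=.
  by rewrite mulrC ler_pdivrMr// mul1r.
have mix f g F x y : bnd x (fun p => f p - F p) -> bnd y (fun p => g p - F p) ->
    bnd (2 * (x + y)) (fun p => f p - t p * f p + t p * g p - F p).
  move=> bf bg.
  have k f' z : bnd z f' -> bnd z (fun p => t p * f' p) /\ bnd z (fun p => (1 - t p) * f' p).
    move=> bf'; have mt : meas t by exact: continuous_meas (sm_cont st).
    rewrite -[z]mul1r; split; apply: (bnd_scale h_lt1 _ ler01 _ bf').
    - by apply: measurable_funM => //; exact: bf'.1.
    - move=> p /t01/andP[q0 q1]; rewrite exprMn ler_wpM2r ?sqr_ge0//.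
      by rewrite exprn_ile1.
    - by apply: measurable_funM; [exact: measurable_funB|exact: bf'.1].
    - move=> p /t01/andP[q0 q1]; rewrite exprMn ler_wpM2r ?sqr_ge0//.
      by rewrite exprn_ile1// ?subr_ge0// lerBlDr lerDl.
  by apply: eq_bnd (bndD h_lt1 (k _ _ bf).2 (k _ _ bg).1) => p; ring.
have Kd : K * d = eta by rewrite mulrC divfK// gt_eqF.
have L2 : 0 <= (L^-1) ^+ 2 := sqr_ge0 _.
have kd : 8 * d <= eta.
  by rewrite -Kd ler_wpM2r ?(ltW d0)// /K ler_peMr// lerDl.
have s1 : sm (a - t * a + t * b) by smt.
have dz i p : pd i (a - t * a + t * b) p = (pd i a p - t p * pd i a p + t p * pd i b p)
    + (i == zi)%:R * (L^-1 * (b p - a p)).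
  rewrite pdD; [|smo|smo]; rewrite pdD; [|smo|smo]; rewrite pdN; last smo.
  rewrite pdM; [|smo|smo]; rewrite pdM; [|smo|smo]; rewrite dt.
  rewrite !(faddE, foppE, fmulE) /kst.
  have -> : ((i == zi)%:R : pt -> R) p = (i == zi)%:R by case: eqP.
  ring.
exists (a - t * a + t * b); split => //.
- split=> x y; rewrite !(faddE, foppE, fmulE) /t fmulE /kst /crd /=.
    by rewrite a0; ring.
  by rewrite bL mulVf ?gt_eqF//; ring.
- apply: bndW (_ : 2 * (d + d) <= _) _; first by lra.
  exact: mix.
move=> i; have [->|iz] := eqVneq i zi; last first.
  apply: bndW (_ : 2 * (d + d) <= _) _; first by lra.
  by apply: eq_bnd (mix _ _ _ _ _ (adu i) (bdu i)) => p; rewrite dz (negbTE iz) mul0r addr0.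
have Bab : bnd ((L^-1) ^+ 2 * (2 * (d + d))) (fun p => L^-1 * (b p - a p)).
  apply: (bnd_scale h_lt1 (g := fun p => b p - a p)) => //.
  - have sba : sm (kst L^-1 * (b - a)) by smt.
    exact: continuous_meas (sm_cont sba).
  - by move=> p _; rewrite exprMn.
  - by apply: eq_bnd (bndB h_lt1 bu au) => p; ring.
apply: bndW (_ : 2 * (2 * (d + d) + (L^-1) ^+ 2 * (2 * (d + d))) <= _) _.
  by rewrite -Kd /K (_ : 2 * (2 * (d + d) + (L^-1) ^+ 2 * (2 * (d + d))) = 8 * (1 + (L^-1) ^+ 2) * d)//; ring.
by apply: eq_bnd (bndD h_lt1 (mix _ _ _ _ _ (adu zi) (bdu zi)) Bab) => p; rewrite dz eqxx mul1r; ring.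
Qed.
End Traces.

(** * Flat functions of one variable *)

Section SmoothOneVariable.
Context {R : realType}.
Local Notation leb := (@lebesgue_measure R).
Implicit Types (u v g : R -> R) (x y t : R) (n : nat).

Lemma smooth1_coind (S : (R -> R) -> Prop) :
  (forall u, S u -> exists2 v, (forall x, is_derive x (1 : R) u (v x)) & S v) ->
  forall u, S u -> smooth1 u.
Proof.
move=> HS u Su.
have HS' (w : {u | S u}) : {v : {u | S u} | forall x, is_derive x (1 : R) (sval w) (sval v x)}.
  by apply: cid; case: w => w Sw; have [v dv Sv] := HS w Sw; exists (exist _ v Sv).
exists (fun n => sval (iter n (fun w => sval (HS' w)) (exist _ u Su))); split => //.
by move=> n x /=; exact: (svalP (HS' _)).
Qed.

(** The functions x^{-n} exp(-1/x), extended by zero to the left half-line: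
    each derivative is a combination of two others. *)
Definition flat n x : R := if 0 < x then x^-1 ^+ n * expR (- x^-1) else 0.

Lemma flat_ge0 n x : 0 <= flat n x.
Proof.
rewrite /flat; case: ifP => // x0.
by rewrite mulr_ge0 ?expR_ge0// exprn_ge0// invr_ge0 ltW.
Qed.

Lemma flat_bound n : exists2 C : R, 0 <= C & forall x, 0 < x -> x^-1 ^+ n * expR (- x^-1) <= C.
Proof.
exists (n.+1`!%:R + 1); first by rewrite addr_ge0.
move=> x x0; have i0 : 0 < x^-1 by rewrite invr_gt0.
rewrite expRN ler_pdivrMr ?expR_gt0//.
have H := expR_ge1Dxn n (ltW i0).
have f0 : 0 < n.+1`!%:R :> R by rewrite ltr0n fact_gt0.
have H2 : x^-1 ^+ n.+1 <= n.+1`!%:R * expR x^-1.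
  rewrite mulrC -ler_pdivrMr//; apply: le_trans H; by rewrite lerDr.
have E1 : 1 <= expR x^-1 by apply: le_trans (expR_ge1Dx _); rewrite lerDl ltW.
rewrite mulrDl mul1r; have [ix|ix] := leP x^-1 1.
  rewrite (le_trans (exprn_ile1 _ (ltW i0) ix))// (le_trans E1)// lerDr.
  by rewrite mulr_ge0 ?expR_ge0.
have : x^-1 ^+ n <= x^-1 ^+ n.+1 by rewrite exprS ler_peMl ?exprn_ge0 ?(ltW i0)// ltW.
by have := expR_ge0 x^-1; lra.
Qed.

Lemma is_derive_flat n x : is_derive x (1 : R) (flat n) (- n%:R * flat n.+1 x + flat n.+2 x).
Proof.
have [x0|x0|x0] := ltgtP 0 x.
- have i0 : x != 0 by rewrite gt_eqF.
  apply: (@near_eq_is_derive _ _ _ (fun y => y^-1 ^+ n * expR (- y^-1))).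
    near=> y; rewrite /flat ifT//; near: y; exact: lt_nbhsr.
  have dV : is_derive x (1 : R) (fun y : R => y^-1) (- x ^- 2).
    have := is_deriveV (f := @id R) i0 (is_derive_id x (1 : R)).
    by move/is_derive_eq; apply; rewrite /GRing.scale/= mulr1.
  have dX := is_deriveX n dV; rewrite exprfctE in dX.
  have dN := is_deriveN dV.
  have dE := @is_derive1_comp _ expR (fun y : R => - y^-1) _ _ _ (is_derive_expR _) dN.
  have := is_deriveM dX dE; move/is_derive_eq; apply.
  rewrite /flat x0 /GRing.scale/= opprK.
  by case: n {dX} => [|n]; rewrite ?mul0r ?mulr0 ?expr0 /= ?exprS ?expr0 ?invfM ?invr1 -?exprVn; ring.
- have z k : flat k x = 0 by rewrite /flat ltNge (ltW x0).
  rewrite !z mulr0 addr0.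
  apply: (@near_eq_is_derive _ _ _ (fun=> 0)).
  by near=> y; rewrite /flat ifF//; apply/negbTE; rewrite -leNgt ltW//; near: y; exact: lt_nbhsl.
- subst x; have z k : flat k 0 = 0 by rewrite /flat ltxx.
  rewrite !z mulr0 addr0.
  have [C C0 HC] := flat_bound n.+2.
  have c0 : (fun h : R => h^-1 *: ((flat n \o shift 0) (h *: (1 : R)) - flat n 0)) @ 0^' --> (0 : R).
    apply/cvgr0Pnorm_le => e e0; near=> h.
    have h0 : h != 0 by near: h; exact: nbhs_dnbhs_neq.
    rewrite /= addr0 /GRing.scale/= mulr1 z subr0 /flat.
    case: ifPn => [hp|_]; last by rewrite mulr0 normr0 ltW.
    rewrite ger0_norm; last by rewrite !mulr_ge0 ?exprn_ge0 ?expR_ge0// invr_ge0 ltW.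
    have -> : h^-1 * (h^-1 ^+ n * expR (- h^-1)) = h * (h^-1 ^+ n.+2 * expR (- h^-1)).
      by rewrite !exprS; field.
    apply: le_trans (ler_wpM2l (ltW hp) (HC _ hp)) _.
    have hC : h <= e / (C + 1).
      rewrite (le_trans (ler_norm h))//; near: h; apply: dnbhs0_le.
      by rewrite divr_gt0// ltr_wpDl.
    apply: le_trans (ler_wpM2r C0 hC) _.
    rewrite mulrAC -mulrA ger_pMr// ler_pdivrMr ?mul1r ?lerDl//.
    by rewrite ltr_wpDl.
  by split; [apply: cvgP c0|apply: cvg_lim c0].
Unshelve. all: by end_near. Qed.

Inductive alg1 : (R -> R) -> Prop :=
| alg1_base u : smooth1 u -> alg1 u
| alg1_flat n : alg1 (flat n)
| alg1_add u v : alg1 u -> alg1 v -> alg1 (u \+ v)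
| alg1_mul u v : alg1 u -> alg1 v -> alg1 (u \* v)
| alg1_comp u g : smooth1 u -> smooth1 g -> alg1 (u \o g).

Lemma smooth1_deriv u : smooth1 u -> exists2 v, (forall x, is_derive x (1 : R) u (v x)) & smooth1 v.
Proof.
move=> [d [<- dd]]; exists (d 1%N) => //.
by exists (fun n => d n.+1).
Qed.

Lemma smooth1_cst (c : R) : smooth1 (fun=> c).
Proof.
apply: (@smooth1_coind (fun u => exists c : R, u = fun=> c)); last by exists c.
by move=> _ [a ->]; exists (fun=> 0); [move=> x; exact: is_derive_cst|exists 0].
Qed.

Lemma alg1_smooth1 u : alg1 u -> smooth1 u.
Proof.
apply: smooth1_coind => {}u; elim=> {u}.
- by move=> u /smooth1_deriv[v dv sv]; exists v => //; exact: alg1_base.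
- move=> n; exists ((fun=> - n%:R) \* flat n.+1 \+ flat n.+2); first exact: is_derive_flat.
  by do !constructor; exact: smooth1_cst.
- move=> u v _ [u' du au] _ [v' dv av]; exists (u' \+ v'); last exact: alg1_add.
  by move=> x; exact: is_deriveD.
- move=> u v au [u' du au'] av [v' dv av'].
  exists ((v \* u') \+ (u \* v')); last by apply: alg1_add; exact: alg1_mul.
  move=> x; have := is_deriveM (du x) (dv x); move/is_derive_eq; apply.
  by rewrite /GRing.scale/=; ring.
- move=> u g su sg; have [u' du su'] := smooth1_deriv su; have [g' dg sg'] := smooth1_deriv sg.
  exists ((u' \o g) \* g'); last by apply: alg1_mul; [exact: alg1_comp|exact: alg1_base].
  by move=> x; exact: (@is_derive1_comp _ u g).
Qed.

Lemma smooth1_flat n : smooth1 (flat n). Proof. exact/alg1_smooth1/alg1_flat. Qed.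

Lemma smooth1_comp u g : smooth1 u -> smooth1 g -> smooth1 (u \o g).
Proof. by move=> su sg; apply/alg1_smooth1/alg1_comp. Qed.

Lemma smooth1D u g : smooth1 u -> smooth1 g -> smooth1 (u \+ g).
Proof. by move=> su sg; apply/alg1_smooth1/alg1_add; exact: alg1_base. Qed.

Lemma smooth1M u g : smooth1 u -> smooth1 g -> smooth1 (u \* g).
Proof. by move=> su sg; apply/alg1_smooth1/alg1_mul; exact: alg1_base. Qed.

Lemma smooth1_cos : smooth1 (@cos R).
Proof.
apply: (@smooth1_coind (fun u => exists a b : R, u = fun x => a * cos x + b * sin x)); last first.
  by exists 1, 0; apply/funext => x; rewrite mul1r mul0r addr0.
move=> _ [a [b ->]]; exists (fun x => b * cos x + - a * sin x); last by exists b, (- a).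
move=> x; have := is_deriveD (is_deriveZ a (is_derive_cos x)) (is_deriveZ b (is_derive_sin x)).
by move/is_derive_eq; apply; rewrite /GRing.scale/=; ring.
Qed.

Lemma smooth1_continuous u : smooth1 u -> continuous u.
Proof. by move=> [d [<- dd]]; exact: continuous_is_derive (dd 0%N). Qed.

Lemma smooth1_primitive b : smooth1 b -> exists B, forall x, is_derive x (1 : R) B (b x).
Proof.
move=> sb; exists (fun x => prim ri (b \o crd ri) ((x, 0), 0)) => x.
exact: (haspd_prim ri (smooth_comp_crd ri sb) ((x, 0), 0)).
Qed.

Section Primitive.
Variables (B b : R -> R).
Hypothesis dB : forall x, is_derive x (1 : R) B (b x).

Lemma primitive_mvt x y : x < y -> exists2 c, x < c < y & B y - B x = b c * (y - x).
Proof.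
move=> xy; have [c + ->] := @MVT R B b x y xy (fun c _ => dB c)
  (continuous_subspaceT (continuous_is_derive dB)).
by rewrite in_itv/= => cxy; exists c.
Qed.

Lemma primitive_le x y : (forall c, 0 <= b c) -> x <= y -> B x <= B y.
Proof.
move=> b0; rewrite le_eqVlt => /predU1P[->//|xy]; rewrite -subr_ge0.
have [c _ ->] := primitive_mvt xy.
by rewrite mulr_ge0// subr_ge0 ltW.
Qed.

Lemma primitive_lt x y : (forall c, x < c < y -> 0 < b c) -> x < y -> B x < B y.
Proof.
move=> b0 xy; rewrite -subr_gt0; have [c /b0 bc ->] := primitive_mvt xy.
by rewrite mulr_gt0// subr_gt0.
Qed.

Lemma primitive_cst x y : (forall c, x < c < y -> b c = 0) -> x <= y -> B x = B y.
Proof.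
move=> b0; rewrite le_eqVlt => /predU1P[->//|xy].
by have [c /b0 -> /eqP] := primitive_mvt xy; rewrite mul0r subr_eq0 => /eqP.
Qed.
End Primitive.

End SmoothOneVariable.

(** * Mollifying kernels *)

Section Kernels.
Context {R : realType}.
Local Notation leb := (@lebesgue_measure R).
Implicit Types (u v g : R -> R) (x y t : R) (n : nat).

(** The composition of g with the flat function exp(-1/x). The primitive makes
    the integrals of the kernels explicit. *)
Lemma cutoff g : smooth1 g -> exists b B : R -> R, [/\ smooth1 b,
  (forall x, is_derive x (1 : R) B (b x)), (forall x, 0 <= b x),
  (forall x, g x <= 0 -> b x = 0) &
  [/\ (forall x, 0 < g x -> 0 < b x) & forall x y, g x = g y -> b x = b y]].
Proof.
move=> sg; have sb : smooth1 (flat 0 \o g) := smooth1_comp (smooth1_flat 0) sg.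
have [B dB] := smooth1_primitive sb.
exists (flat 0 \o g), B; split => //.
- by move=> x; exact: flat_ge0.
- by move=> x g0 /=; rewrite /flat ltNge g0.
- split=> [x g0|x y e] /=; last by rewrite e.
  by rewrite /flat g0 expr0 mul1r expR_gt0.
Qed.

Lemma scale_kernel b B (N : R) : 0 < N -> smooth1 b ->
  (forall x, is_derive x (1 : R) B (b x)) ->
  smooth1 (fun x => N^-1 * b x) /\ forall x, is_derive x (1 : R) (fun x => N^-1 * B x) (N^-1 * b x).
Proof.
move=> N0 sb dB; split; first exact: (smooth1M (smooth1_cst N^-1) sb).
by move=> x; have := is_deriveZ N^-1 (dB x).
Qed.

Lemma bump (d : R) : 0 < d -> exists b B : R -> R, [/\ smooth1 b,
  (forall x, is_derive x (1 : R) B (b x)), (forall x, 0 <= b x),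
  (forall x, d <= `|x| -> b x = 0) &
  forall x y, x <= - d -> d <= y -> B y - B x = 1].
Proof.
move=> d0.
have sg : smooth1 (fun x : R => d ^+ 2 - x ^+ 2).
  have := smooth1D (smooth1_cst (d ^+ 2)) (smooth1M (smooth1_cst (-1 : R)) (smooth1M (@smooth1_id R) (@smooth1_id R))).
  by congr smooth1; apply/funext => x /=; ring.
have [b [B [sb dB b0 bz [bp _]]]] := cutoff sg.
have d0' := ltW d0.
have z x : d <= `|x| -> b x = 0.
  move=> dx; apply: bz; rewrite subr_le0 -(real_normK (num_real x)).
  by rewrite lerXn2r ?nnegrE.
have lt : B (- d) < B d.
  apply: (primitive_lt dB); last by rewrite gtrN.
  move=> c /andP[c1 c2]; apply: bp; rewrite subr_gt0 -(real_normK (num_real c)).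
  by rewrite ltrXn2r ?nnegrE// ltr_norml c1.
pose N := B d - B (- d); have N0 : 0 < N by rewrite subr_gt0.
have [sN dN] := scale_kernel N0 sb dB.
exists (fun x => N^-1 * b x), (fun x => N^-1 * B x); split => //.
- by move=> x; rewrite mulr_ge0// invr_ge0 ltW.
- by move=> x /z ->; rewrite mulr0.
move=> x y xd dy.
have -> : B x = B (- d).
  apply: (primitive_cst dB) => // c /andP[_ c2]; apply: z.
  by rewrite ler_normr; apply/orP; right; rewrite lerNr ltW.
have <- : B d = B y.
  apply: (primitive_cst dB) => // c /andP[c1 _]; apply: z.
  by rewrite ler_normr ltW.
by rewrite -mulrBr mulVf// gt_eqF.
Qed.

Lemma cos_abs (t : R) : cos `|t| = cos t.
Proof. by case: (ger0P t) => // _; rewrite cosN. Qed.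

Lemma cos_le_cos (d t : R) : 0 < d -> d < pi -> d <= `|t| -> `|t| <= 2 * pi - d -> cos t <= cos d.
Proof.
move=> d0 dp; rewrite -(cos_abs t); move: `|t| => s ds s2.
have [sp|ps] := leP s pi.
  by rewrite leNgt; apply/negP; rewrite ltr_cos ?in_itv/= ?(ltW d0) ?(ltW dp)//; [lra|rewrite sp andbT; lra].
have -> : cos s = cos (2 * pi - s).
  by rewrite -(cosN (2 * pi - s)) opprB -[RHS]cosD2pi mulr_natl subrK.
rewrite leNgt; apply/negP; rewrite ltr_cos ?in_itv/=; [lra|lra|].
by rewrite (ltW d0) (ltW dp).
Qed.

Lemma periodic_bump (d : R) : 0 < d -> d < pi -> exists b B : R -> R, [/\ smooth1 b,
  (forall x, is_derive x (1 : R) B (b x)), (forall x, 0 <= b x),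
  (forall x, d <= `|x| -> `|x| <= 2 * pi - d -> b x = 0) &
  (forall x, B (x + 2 * pi) - B x = 1) /\ forall x, b (x + 2 * pi) = b x].
Proof.
move=> d0 dp.
have sg : smooth1 (fun x : R => cos x - cos d).
  exact: (smooth1D (@smooth1_cos R) (smooth1_cst (- cos d))).
have [b [B [sb dB b0 bz [bp be]]]] := cutoff sg.
have per x : b (x + 2 * pi) = b x.
  by apply: be; rewrite mulr_natl cosD2pi.
pose D x := B (x + 2 * pi) - B x.
have dD x : is_derive x (1 : R) D 0.
  have h1 : is_derive x (1 : R) (fun s : R => s + 2 * pi) 1.
    have := is_deriveD (is_derive_id x (1 : R)) (is_derive_cst (2 * pi : R) x (1 : R)).
    by move/is_derive_eq; apply; rewrite addr0.
  have h2 := @is_derive1_comp _ B (fun s : R => s + 2 * pi) _ _ _ (dB (x + 2 * pi)) h1.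
  have := is_deriveB h2 (dB x); move/is_derive_eq; apply.
  by rewrite mulr1 per subrr.
have cD x : D x = D (- d) by apply: (is_derive_0_is_cst (f := D)).
have lt : 0 < D (- d).
  rewrite subr_gt0; apply: (@lt_le_trans _ _ (B d)).
    apply: (primitive_lt dB); last by rewrite gtrN.
    move=> c /andP[c1 c2]; apply: bp; rewrite subr_gt0 -(cos_abs c).
    by rewrite ltr_cos ?in_itv/= ?(ltW d0) ?(ltW dp)// ?ltr_norml ?c1// normr_ge0 (le_trans _ (ltW dp))// ltW// ltr_norml c1.
  by apply: (primitive_le dB) => //; lra.
have [sN dN] := scale_kernel lt sb dB.
exists (fun x => (D (- d))^-1 * b x), (fun x => (D (- d))^-1 * B x); split => //.
- by move=> x; rewrite mulr_ge0// invr_ge0 ltW.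
- move=> x x1 x2; rewrite bz ?mulr0// subr_le0; exact: cos_le_cos.
split=> x; last by rewrite per.
by rewrite -mulrBr -/(D x) cD mulVf// gt_eqF.
Qed.

(** A mollifying kernel b(y - mu x - c) on the interval [a, e], of width d. In
    the non-periodic case x is first moved away from the ends, so that the
    kernel has compact support in y. *)
Record kernel1 (per : bool) (a e d : R) := Kernel1 {
  kb : R -> R;
  kmu : R;
  kc : R;
  kb_smooth : smooth1 kb;
  kb_ge0 : forall t, 0 <= kb t;
  kmu_half : 1 / 2 <= kmu;
  kmu_le1 : kmu <= 1;
  kmu_near1 : 1 - kmu <= 4 * d / (e - a);
  kb_mass : forall x, a <= x <= e -> \int[leb]_(y in `[a, e]) kb (y - kmu * x - kc) = 1;
  kb_mass' : forall y, a <= y <= e -> \int[leb]_(x in `[a, e]) kb (y - kmu * x - kc) <= 2;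
  kb_near : forall x y, a <= x <= e -> a <= y <= e -> kb (y - kmu * x - kc) != 0 ->
    `|y - x| <= 3 * d \/ e - a - 3 * d <= `|y - x|;
  kb_bc : if per then kmu = 1 /\ forall t, kb (t + 2 * pi) = kb t
    else forall x y, a <= x <= e -> kb (y - kmu * x - kc) != 0 -> a + d <= y <= e - d }.

Lemma kernel_int_y B b (s a e : R) : a < e -> smooth1 b ->
  (forall x, is_derive x (1 : R) B (b x)) ->
  \int[leb]_(y in `[a, e]) b (y - s) = B (e - s) - B (a - s).
Proof.
move=> ae sb dB; apply: (@Rint_FTC _ (fun y => B (y - s))) => // [x|].
  have h1 : is_derive x (1 : R) (fun y : R => y - s) 1.
    have := is_deriveB (is_derive_id x (1 : R)) (is_derive_cst s x (1 : R)).
    by move/is_derive_eq; apply; rewrite subr0.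
  have := @is_derive1_comp _ B (fun y : R => y - s) _ _ _ (dB _) h1.
  by rewrite mulr1.
move=> x; apply: (continuous_comp (f := fun y : R => y - s) (g := b)); last exact: smooth1_continuous.
by apply: cvgB; [exact: cvg_id|exact: cvg_cst].
Qed.

Lemma kernel_int_x B b (m c y a e : R) : a < e -> 0 < m -> smooth1 b ->
  (forall x, is_derive x (1 : R) B (b x)) ->
  \int[leb]_(x in `[a, e]) b (y - m * x - c) = m^-1 * (B (y - m * a - c) - B (y - m * e - c)).
Proof.
move=> ae m0 sb dB.
have -> : m^-1 * (B (y - m * a - c) - B (y - m * e - c)) =
  - m^-1 * B (y - m * e - c) - - m^-1 * B (y - m * a - c) by ring.
apply: (@Rint_FTC _ (fun x => - m^-1 * B (y - m * x - c))) => // [x|].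
  have h1 : is_derive x (1 : R) (fun x : R => y - m * x - c) (- m).
    have := is_deriveB (is_deriveB (is_derive_cst y x (1 : R)) (is_deriveZ m (is_derive_id x (1 : R))))
      (is_derive_cst c x (1 : R)).
    by move/is_derive_eq; apply; rewrite /GRing.scale/= mulr1 subr0 sub0r.
  have h2 := @is_derive1_comp _ B (fun x : R => y - m * x - c) _ _ _ (dB _) h1.
  have := is_deriveZ (- m^-1) h2; move/is_derive_eq; apply.
  by rewrite /GRing.scale/= mulrN mulrNN mulrCA mulVf ?mulr1 ?gt_eqF.
move=> x; apply: (continuous_comp (f := fun x : R => y - m * x - c) (g := b)); last exact: smooth1_continuous.
apply: cvgB; last exact: cvg_cst.
apply: cvgB; first exact: cvg_cst.
by apply: cvgM; [exact: cvg_cst|exact: cvg_id].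
Qed.

Lemma interval_kernel (a e d : R) : 0 < d -> 8 * d <= e - a -> kernel1 false a e d.
Proof.
move=> d0 dl; have l0 : 0 < e - a by apply: lt_le_trans dl; rewrite mulr_gt0.
have ae : a < e by rewrite -subr_gt0.
have /cid[b /cid[B [sb dB b0 bz B1]]] := bump d0.
pose q := 4 * d / (e - a).
have q0 : 0 <= q by rewrite divr_ge0 ?mulr_ge0 ?ltW.
have q2 : q <= 1 / 2 by rewrite ler_pdivrMr//; lra.
have ql : q * (e - a) = 4 * d by rewrite divfK// gt_eqF.
pose m := 1 - q; pose c := a + 2 * d - m * a.
have m0 : 0 < m by rewrite /m; lra.
(* the moved point m x + c lies in [a + 2d, e - 2d], within 2d of x *)
have mid x : a <= x <= e -> [/\ a + 2 * d <= m * x + c, m * x + c <= e - 2 * d &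
    `|m * x + c - x| <= 2 * d].
  move=> /andP[ax xe].
  have h1 : 0 <= m * (x - a) by rewrite mulr_ge0 ?(ltW m0)// subr_ge0.
  have h2 : 0 <= m * (e - x) by rewrite mulr_ge0 ?(ltW m0)// subr_ge0.
  have h3 : 0 <= q * (x - a) by rewrite mulr_ge0 ?subr_ge0.
  have h4 : 0 <= q * (e - x) by rewrite mulr_ge0 ?subr_ge0.
  rewrite ler_norml /c; split; [|move: h2; rewrite /m|apply/andP; split; rewrite /m]; lra.
have near x y : b (y - m * x - c) != 0 -> `|y - (m * x + c)| < d.
  by move=> bn; rewrite ltNge; apply: contra bn => dn; rewrite bz// -addrA -opprD.
have Bmon x y : B y - B x <= 1.
  pose y' := Num.max y d; pose x' := Num.min x (- d).
  rewrite -(B1 x' y'); [|by rewrite ge_min lexx orbT|by rewrite le_max lexx orbT].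
  by apply: lerB; apply: (primitive_le dB b0); rewrite ?le_max ?ge_min lexx.
apply: (@Kernel1 false a e d b m c) => //.
- by rewrite /m; lra.
- by rewrite /m; lra.
- by rewrite /m opprB addrC subrK.
- move=> x /mid[x1 x2 _].
  under eq_Rintegral do rewrite -addrA -opprD.
  rewrite (kernel_int_y _ ae sb dB) B1//; lra.
- move=> y _; rewrite (kernel_int_x _ _ ae m0 sb dB).
  apply: le_trans (ler_wpM2l _ (Bmon _ _)) _; first by rewrite invr_ge0 ltW.
  by rewrite mulr1 -[leRHS]invrK lef_pV2 ?posrE ?invr_gt0// /m; lra.
- move=> x y /mid[_ _ x3] _ /near yx; left.
  rewrite (_ : y - x = y - (m * x + c) + (m * x + c - x)); last by ring.
  by apply: le_trans (ler_normD _ _) _; lra.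
- move=> x y /mid[x1 x2 _] /near; rewrite ltr_norml => /andP[y1 y2].
  by apply/andP; split; lra.
Qed.

Lemma circle_kernel (d : R) : 0 < d -> 8 * d <= 2 * pi -> kernel1 true 0 (2 * pi) d.
Proof.
move=> d0 dl; have p0 : 0 < 2 * pi :> R by rewrite mulr_gt0// pi_gt0.
have dp : d < pi by lra.
have /cid[b /cid[B [sb dB b0 bz [B1 bp]]]] := periodic_bump d0 dp.
apply: (@Kernel1 true 0 (2 * pi) d b 1 0) => //.
- by lra.
- by rewrite subrr divr_ge0 ?mulr_ge0 ?subr0 ?ltW.
- move=> x _; under eq_Rintegral do rewrite mul1r subr0.
  by rewrite (kernel_int_y _ p0 sb dB) sub0r (addrC _ (- x)) B1.
- move=> y _; rewrite (kernel_int_x _ _ p0 ltr01 sb dB) invr1 !mul1r !subr0.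
  by rewrite -[X in B X - _](subrK (2 * pi) y) B1 ler1n.
move=> x y /andP[x0 x1] /andP[y0 y1]; rewrite mul1r !subr0 => bn.
have [n1|n1] := leP `|y - x| d; first by left; lra.
right; rewrite leNgt; apply: contra bn => n2.
by rewrite bz//; lra.
Qed.

End Kernels.

(** * Mollification on the shell *)

Section ParamShell.
Context {R : realType}.
Local Notation pt := (R * R * R)%type.
Local Notation mR := (measurableTypeR R).
Variables (h L : R).
Local Notation Q := (shell h L).
Implicit Types (f g : pt -> R) (p q : pt) (i j : 'I_3).

Definition intg f := (leb3 R).-integrable Q (EFin \o f).

Lemma intg_mul f g : intg f -> continuous g -> intg (fun q => f q * g q).
Proof.
move=> If cg; apply: (integrableMl (measurable_shell h L) If).
  by apply: measurable_funS (continuous_measurable3 cg).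
have [M M0 HM] := compact_bound (@compact_shell R h L) cg.
exists M; split; first exact: num_real.
by move=> N MN p Qp; apply: (le_trans (HM p Qp)); exact: ltW.
Qed.

Lemma intg_norm f : intg f -> intg (fun q => `|f q|).
Proof. by move=> /integrable_norm. Qed.

Lemma intgB f g : intg f -> intg g -> intg (fun q => f q - g q).
Proof. by move=> If Ig; exact: (integrableB (measurable_shell h L) If Ig). Qed.

Variable f : pt -> R.
Hypothesis If : intg f.
Implicit Types F G : pt -> pt -> R.

Lemma continuous_section F p : continuous (fun pq : pt * pt => F pq.1 pq.2) -> continuous (F p).
Proof. by move=> cF q; exact: (continuous_comp (@continuous_pairr _ _ p q) (cF (p, q))). Qed.

Lemma continuous_paramQ F : continuous (fun pq : pt * pt => F pq.1 pq.2) ->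
  continuous (fun p => Rintegral (leb3 R) Q (fun q => f q * F p q)).
Proof.
move=> cF p0; have mQ := measurable_shell h L.
have cFp p : continuous (F p) by exact: continuous_section.
have If' := intg_norm If.
pose J := Rintegral (leb3 R) Q (fun q => `|f q|).
have J0 : 0 <= J by apply: Rintegral_ge0.
apply/cvgrPdist_le => e e0.
pose e' := e / (J + 1); have e'0 : 0 < e' by rewrite divr_gt0// ltr_wpDl.
have : \forall p \near p0, Q `<=` (fun q => `|F p0 q - F p q| <= e').
  have /compact_near_coveringP ncov := @compact_shell R h L.
  apply: (ncov pt (nbhs p0) (fun p q => `|F p0 q - F p q| <= e')) => q _.
  have e20 : 0 < e' / 2 by rewrite divr_gt0.
  have /cvgrPdist_le/(_ _ e20) := cF (p0, q).
  have /cvgrPdist_le/(_ _ e20) := cFp p0 q.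
  move=> H1 H2.
  have H1' : \forall q' \near q & p \near p0, `|F p0 q - F p0 q'| <= e' / 2.
    exists ([set q' | `|F p0 q - F p0 q'| <= e' / 2], setT) => //=; last by case=> q' p [].
    by split => /=; [exact: H1|exact: filterT].
  have H2' : \forall q' \near q & p \near p0, `|F p0 q - F p q'| <= e' / 2.
    case: H2 => -[U V] /= [nU nV] UV; exists (V, U) => //= -[q' p] [/= Vs Up].
    exact: (UV (p, q')).
  move: H1' H2'; apply: filterS2 => -[q' p] /= h1 h2.
  rewrite (_ : F p0 q' - F p q' = (F p0 q - F p q') - (F p0 q - F p0 q')); last by ring.
  by rewrite (le_trans (ler_normB _ _))// [leRHS](splitr e') lerD.
apply: filterS => p Hp.
have I0 p' := intg_mul If (cFp p').
rewrite -(RintegralB mQ (I0 _) (I0 _)).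
apply: le_trans (le_normr_Rintegral mQ (intgB (I0 _) (I0 _))) _.
apply: (@le_trans _ _ (Rintegral (leb3 R) Q (fun q => `|f q| * e'))); last first.
  rewrite RintegralZr// -/J /e' mulrCA ger_pMr// ler_pdivrMr ?mul1r ?lerDl//.
  by rewrite ltr_wpDl.
apply: le_Rintegral => //.
- exact: (intg_norm (intgB (I0 p0) (I0 p))).
- by apply: (intg_mul If' (g := fun=> e')) => ?; exact: cvg_cst.
- move=> q /Hp; rewrite -mulrBr normrM => Hq; exact: ler_wpM2l.
Qed.

Lemma haspd_paramQ i F G :
  continuous (fun pq : pt * pt => F pq.1 pq.2) ->
  continuous (fun pq : pt * pt => G pq.1 pq.2) ->
  (forall q, haspd i (F ^~ q) (G ^~ q)) ->
  haspd i (fun p => Rintegral (leb3 R) Q (fun q => f q * F p q))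
          (fun p => Rintegral (leb3 R) Q (fun q => f q * G p q)).
Proof.
move=> cF cG FG p; have mQ := measurable_shell h L.
have cFp q : continuous (F q) by exact: continuous_section.
set c := crd i p; pose k (x : R) (q : mR * mR * mR) : R := f q * F (upd i p x) q.
have df x q : is_derive x (1 : R) (k ^~ q) (f q * G (upd i p x) q).
  have := is_deriveZ (f q) (haspd_line p x (FG q)).
  by move/is_derive_eq; apply.
have [M M0 HM] : exists2 M, 0 < M & forall xq : R * pt,
    (`[c - 1, c + 1] `*` Q) xq -> `|G (upd i p xq.1) xq.2| <= M.
  apply: (@compact_bound _ _ _ (fun xq : R * pt => G (upd i p xq.1) xq.2)).
    by apply: compact_setX; [exact: segment_compact|exact: compact_shell].
  move=> xq; apply: (continuous_comp (f := fun xq : R * pt => (upd i p xq.1, xq.2))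
    (g := fun pq => G pq.1 pq.2)); last exact: cG.
  apply: continuous_pair; last exact: continuous_snd.
  apply: (@continuous_upd _ i _ (fun=> p)) => ys; first exact: cvg_cst.
  exact: continuous_fst.
have cI : `]c - 1, c + 1[%classic c.
  by rewrite /= in_itv/= ltrDl ltr01 andbT ltrBlDr ltrDl ltr01.
have Ik x : `]c - 1, c + 1[%classic x -> (leb3 R).-integrable Q (EFin \o k x).
  by move=> _; exact: (intg_mul If (cFp _)).
have Df x q : `]c - 1, c + 1[%classic x -> Q q ->
   derivable (k ^~ q) x 1 by move=> _ _; have [] := df x q.
pose M' (q : mR * mR * mR) : R := `|f q| * M.
have IM : (leb3 R).-integrable Q (EFin \o M').
  by apply: (intg_mul (intg_norm If) (g := fun=> M)) => ?; exact: cvg_cst.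
have Bf x q : `]c - 1, c + 1[%classic x -> Q q ->
   `|partial1of2 k x q| <= M' q.
  move=> xI sI; rewrite partial1of2E; have [_ ->] := df x q.
  rewrite normrM ler_wpM2l//; apply: (HM (x, q)); split => //=.
  by move: xI; rewrite /= !in_itv/= => /andP[/ltW -> /ltW ->].
have M0' : forall q, 0 <= M' q by move=> q; rewrite mulr_ge0// ltW.
have H1 := @derivable_under_integral _ _ _ (leb3 R) k Q mQ _ _ _ cI Ik Df _ M0' IM Bf.
have H2 := @differentiation_under_integral _ _ _ (leb3 R) k Q mQ _ _ _ cI Ik Df _ M0' IM Bf.
split; first exact H1.
rewrite -derive1E; rewrite /k in H2; rewrite [LHS]H2 {H1 H2}.
apply: eq_Rintegral => q _; rewrite partial1of2E.
by have [_ ->] := df c q; rewrite upd_crd.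
Qed.
End ParamShell.

Section Mollifier.
Context {R : realType}.
Local Notation pt := (R * R * R)%type.
Local Notation mR := (measurableTypeR R).
Variables (h L : R).
Local Notation Q := (shell h L).
Local Notation intg := (intg h L).
Implicit Types (f g : pt -> R) (p q : pt) (i j : 'I_3).

Variable w : 'I_3 -> R.
Variable K : forall i, kernel1 (i == ti) (lo h i) (hi h L i) (w i).

Let D i : nat -> R -> R := sval (cid (kb_smooth (K i))).
Let D0 i : D i 0%N = kb (K i).
Proof. by rewrite /D; case: cid => d []. Qed.
Let dD i n (x : R) : is_derive x (1 : R) (D i n) (D i n.+1 x).
Proof. by rewrite /D; case: cid => d []. Qed.

Let arg i p q := crd i q - kmu (K i) * crd i p - kc (K i).

(** The product kernel, each factor replaced by a derivative of given order. *)
Definition kern (N : 'I_3 -> nat) p q : R :=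
  D ri (N ri) (arg ri p q) * D ti (N ti) (arg ti p q) * D zi (N zi) (arg zi p q).

Definition bumpup j (N : 'I_3 -> nat) i := if i == j then (N i).+1 else N i.

Lemma continuous_kern N : continuous (fun pq : pt * pt => kern N pq.1 pq.2).
Proof.
have c i : continuous (fun pq : pt * pt => D i (N i) (arg i pq.1 pq.2)).
  move=> pq; apply: (continuous_comp (f := fun pq : pt * pt => arg i pq.1 pq.2) (g := D i (N i))).
    apply: cvgB; last exact: cvg_cst.
    apply: cvgB; first exact: (continuous_comp (@continuous_snd _ _ pq) (@continuous_crd _ i _)).
    apply: cvgM; first exact: cvg_cst.
    exact: (continuous_comp (@continuous_fst _ _ pq) (@continuous_crd _ i _)).
  exact: continuous_is_derive (dD i (N i)) _.
by move=> pq; apply: cvgM; [apply: cvgM|]; exact: c.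
Qed.

Lemma is_derive_affine i n (a b x : R) :
  is_derive x (1 : R) (fun x => D i n (a + b * x)) (b * D i n.+1 (a + b * x)).
Proof.
have h1 : is_derive x (1 : R) (fun x : R => a + b * x) b.
  have := is_deriveD (is_derive_cst a x (1 : R)) (is_deriveZ b (is_derive_id x (1 : R))).
  by move/is_derive_eq; apply; rewrite add0r /GRing.scale/= mulr1.
have := @is_derive1_comp _ (D i n) (fun x : R => a + b * x) _ _ _ (dD i n _) h1.
by move/is_derive_eq; apply; rewrite mulrC.
Qed.

Lemma haspd_kern_l j N q : haspd j (kern N ^~ q)
  (fun p => - kmu (K j) * kern (bumpup j N) p q).
Proof.
have F i : haspd j (fun p => D i (N i) (arg i p q))
    (fun p => (j == i)%:R * (- kmu (K i) * D i (N i).+1 (arg i p q))).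
  have := haspd_comp_crd j i (is_derive_affine i (N i) (crd i q - kc (K i)) (- kmu (K i))).
  have e n p : D i n (crd i q - kc (K i) + - kmu (K i) * crd i p) = D i n (arg i p q).
    by congr (D i n _); rewrite /arg; ring.
  move=> H p; have /is_derive_eq := H p.
  rewrite e; under eq_fun do rewrite /= e; exact.
have H := haspdM (haspdM (F ri) (F ti)) (F zi).
move=> p; have /is_derive_eq := H p; apply.
rewrite /kern /bumpup !(faddE, fmulE).
by case: (ord3P j) => -> /=; ring.
Qed.

Lemma haspd_kern_r j N p : haspd j (kern N p) (kern (bumpup j N) p).
Proof.
have F i : haspd j (fun q => D i (N i) (arg i p q))
    (fun q => (j == i)%:R * (1 * D i (N i).+1 (arg i p q))).
  have := haspd_comp_crd j i (is_derive_affine i (N i) (- kmu (K i) * crd i p - kc (K i)) 1).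
  have e n q : D i n (- kmu (K i) * crd i p - kc (K i) + 1 * crd i q) = D i n (arg i p q).
    by congr (D i n _); rewrite /arg; ring.
  move=> H q; have /is_derive_eq := H q.
  rewrite e; under eq_fun do rewrite /= e; exact.
have H := haspdM (haspdM (F ri) (F ti)) (F zi).
move=> q; have /is_derive_eq := H q; apply.
rewrite /kern /bumpup !(faddE, fmulE).
by case: (ord3P j) => -> /=; ring.
Qed.

Definition N0 : 'I_3 -> nat := fun=> 0%N.

Lemma kern0E p q : kern N0 p q = kb (K ri) (arg ri p q) * kb (K ti) (arg ti p q) * kb (K zi) (arg zi p q).
Proof. by rewrite /kern /N0 !D0. Qed.

Definition moll f p : R := Rintegral (leb3 R) Q (fun q => f q * kern N0 p q).

Lemma smooth_moll f : intg f -> smooth (moll f).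
Proof.
move=> If; apply: (@smooth_coind _ (fun g => exists (c : R) N,
    g = fun p => c * Rintegral (leb3 R) Q (fun q => f q * kern N p q))); last first.
  by exists 1, N0; apply/funext => p; rewrite mul1r.
move=> _ [c [N ->]]; split.
  move=> p; apply: cvgM; first exact: cvg_cst.
  exact: (continuous_paramQ If (@continuous_kern N)).
move=> i; exists (fun p => c * (- kmu (K i)) * Rintegral (leb3 R) Q (fun q => f q * kern (bumpup i N) p q)); last first.
  by exists (c * (- kmu (K i))), (bumpup i N).
have H : haspd i (fun p => Rintegral (leb3 R) Q (fun q => f q * kern N p q))
    (fun p => Rintegral (leb3 R) Q (fun q => f q * (- kmu (K i) * kern (bumpup i N) p q))).
  apply: (haspd_paramQ If (@continuous_kern N)); last by move=> q; exact: haspd_kern_l.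
  by move=> pq; apply: cvgM; [exact: cvg_cst|exact: continuous_kern].
have H2 := haspdM (haspd_cst i c) H.
move=> p; have /is_derive_eq := H2 p; apply.
rewrite faddE !fmulE mul0r add0r -mulrA; congr (c * _).
under eq_Rintegral do rewrite mulrCA.
rewrite RintegralZl//; first exact: measurable_shell.
by apply: intg_mul => //; apply: continuous_section (@continuous_kern _).
Qed.

Lemma moll_pd f i p : intg f -> pd i (moll f) p =
  - kmu (K i) * Rintegral (leb3 R) Q (fun q => f q * pd i (kern N0 p) q).
Proof.
move=> If.
have H : haspd i (moll f)
    (fun p => Rintegral (leb3 R) Q (fun q => f q * (- kmu (K i) * kern (bumpup i N0) p q))).
  apply: (haspd_paramQ If (@continuous_kern N0)); last by move=> q; exact: haspd_kern_l.
  by move=> pq; apply: cvgM; [exact: cvg_cst|exact: continuous_kern].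
rewrite (haspdE H) (haspdE (haspd_kern_r i N0 p)).
under eq_Rintegral do rewrite mulrCA.
rewrite RintegralZl//; first exact: measurable_shell.
by apply: intg_mul => //; apply: continuous_section (@continuous_kern _).
Qed.

Lemma kern_periodic N p q : kern N (upd ti p (crd ti p + 2 * pi)) q = kern N p q /\
  kern N p (upd ti q (crd ti q + 2 * pi)) = kern N p q.
Proof.
have [mu1 bp] := kb_bc (K ti).
have Dp n x : D ti n (x + 2 * pi) = D ti n x.
  elim: n x => [|n IH] x; first by rewrite D0 bp.
  have := is_derive_affine ti n (2 * pi) 1 x.
  rewrite (_ : (fun x => _) = D ti n); last by apply/funext => y; rewrite mul1r addrC IH.
  by move=> [_]; have [_ ->] := dD ti n x; rewrite !mul1r addrC => ->.
split; rewrite /kern; congr (_ * _ * _); try by congr (D _ _ _); rewrite /arg !crd_upd_neq.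
  rewrite -[LHS]Dp; congr (D _ _ _); rewrite /arg crd_upd mu1; ring.
by rewrite -[RHS]Dp; congr (D _ _ _); rewrite /arg crd_upd; ring.
Qed.

Lemma sm_moll f : intg f -> sm (moll f).
Proof.
move=> If; apply: mk_sm; first exact: smooth_moll.
by move=> p; apply: eq_Rintegral => q _; rewrite (kern_periodic N0 p q).1.
Qed.

Lemma shell_crd p i : Q p -> lo h i <= crd i p <= hi h L i.
Proof.
move=> [[/= + +] +]; rewrite /Ih /= !in_itv/= => r t z.
by case: (ord3P i) => ->.
Qed.

Lemma kern_test p : (forall i, 0 < w i) -> Q p -> test_function h L (kern N0 p).
Proof.
move=> w0 Qp; split.
  apply: mk_sm; last by move=> q; rewrite (kern_periodic N0 p q).2.
  apply: (@smooth_coind _ (fun g => exists N, g = kern N p)); last by exists N0.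
  move=> _ [N ->]; split; first by apply: continuous_section (@continuous_kern N).
  by move=> i; exists (kern (bumpup i N) p); [exact: haspd_kern_r|exists (bumpup i N)].
have [br bz] := (kb_bc (K ri), kb_bc (K zi)).
exists (Num.min (w ri) (w zi)); first by rewrite lt_min !w0.
move=> q; rewrite kern0E !mulf_eq0 !negb_or => /andP[/andP[nr _] nz].
have /andP[r1 r2] := br _ _ (shell_crd ri Qp) nr.
have /andP[z1 z2] := bz _ _ (shell_crd zi Qp) nz.
have m1 : Num.min (w ri) (w zi) <= w ri by rewrite ge_min lexx.
have m2 : Num.min (w ri) (w zi) <= w zi by rewrite ge_min lexx orbT.
move: (Num.min _ _) m1 m2 r1 r2 z1 z2 => m m1 m2.
rewrite /lo /hi /crd /= => r1 r2 z1 z2.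
by split; apply/andP; split; lra.
Qed.

(** The kernel depends on y - mu x, so a derivative in x is -mu times the
    derivative in y, and for x in the shell the kernel is a test function in
    y, compactly supported away from the ends. *)
Lemma moll_weak_partial i u v p : (forall i, 0 < w i) -> Q p -> intg u ->
  is_weak_partial h L i u v -> pd i (moll u) p = kmu (K i) * moll v p.
Proof.
move=> w0 Qp Iu [_ /(_ _ (kern_test w0 Qp)) H].
by rewrite moll_pd// pd_def H mulrNN.
Qed.
End Mollifier.

(** * Mollifiers are bounded on L^2 *)

Section ProductIntegral.
Context d1 d2 (T1 : measurableType d1) (T2 : measurableType d2) (R : realType).
Variables (m1 : {sigma_finite_measure set T1 -> \bar R})
          (m2 : {sigma_finite_measure set T2 -> \bar R}).
Variables (A : set T1) (B : set T2) (f : T1 -> R) (g : T2 -> R) (a b : R).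
Hypotheses (mA : measurable A) (mB : measurable B).
Hypotheses (mf : measurable_fun A f) (mg : measurable_fun B g).
Hypotheses (f0 : forall x, A x -> 0 <= f x) (g0 : forall y, B y -> 0 <= g y).
Hypotheses (ia : (\int[m1]_(x in A) (f x)%:E = a%:E)%E) (ib : (\int[m2]_(y in B) (g y)%:E = b%:E)%E).

Lemma product_integral : (\int[m1 \x m2]_(p in A `*` B) (f p.1 * g p.2)%:E = (a * b)%:E)%E.
Proof.
have mfg : measurable_fun (A `*` B) (fun p : T1 * T2 => (f p.1 * g p.2)%:E).
  apply/measurable_EFinP; apply: measurable_funM.
    by apply: (@measurable_comp _ _ _ _ _ _ A) => //; [move=> _ [p [? ?] <-]|exact: measurable_funS measurable_fst].
  by apply: (@measurable_comp _ _ _ _ _ _ B) => //; [move=> _ [p [? ?] <-]|exact: measurable_funS measurable_snd].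
rewrite (tonelli_rect1 m1 m2 mA mB mfg); last first.
  by move=> p [Ap Bp]; rewrite lee_fin mulr_ge0 ?f0 ?g0.
transitivity (\int[m1]_(x in A) (b%:E * (f x)%:E))%E.
  apply: eq_integral => x; rewrite inE => Ax.
  rewrite (_ : (fun y => _) = (fun y => (f x)%:E * (g y)%:E)%E)//.
  rewrite ge0_integralZl_EFin//; [|exact/measurable_EFinP|exact: f0].
  by rewrite ib muleC.
have b0 : 0 <= b by rewrite -lee_fin -ib; apply: integral_ge0 => y By; rewrite lee_fin g0.
rewrite ge0_integralZl_EFin//; [|exact/measurable_EFinP].
by rewrite ia -EFinM mulrC.
Qed.
End ProductIntegral.

Section MollifierBound.
Context {R : realType}.
Local Notation pt := (R * R * R)%type.
Local Notation mR := (measurableTypeR R).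
Local Notation leb := (@lebesgue_measure R).
Variables (h L : R).
Hypotheses (h_lt1 : h < 1).
Local Notation Q := (shell h L).
Local Notation intg := (intg h L).
Local Notation bnd := (bnd h L).
Local Notation meas := (meas h L).
Implicit Types (f g : pt -> R) (p q : pt) (i j : 'I_3).

Lemma bnd_intg2 f c : bnd c f -> intg (fun p => f p ^+ 2).
Proof.
move=> bf; have [mf _] := bf.
have i2 : intg (fun p => 2 * (f p ^+ 2 * p.1.1)).
  exact: (@integrableZl _ _ _ (leb3 R) Q (measurable_shell h L) 2 _ (integrable_dens h_lt1 bf)).
apply: (le_integrable (measurable_shell h L) _ _ i2).
  by apply/measurable_EFinP; exact: measurable_funX.
move=> p Qp /=; have /andP[r1 _] := radius_bounds h_lt1 Qp.
have := sqr_ge0 (f p); rewrite lee_fin => f0.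
have r0 := radius_ge0 h_lt1 Qp.
rewrite !ger0_norm ?sqr_ge0//; last by apply: mulr_ge0 => //; apply: mulr_ge0 => //; exact: sqr_ge0.
rewrite mulrCA -{1}[f p ^+ 2]mulr1 ler_wpM2l//; lra.
Qed.

Lemma bnd_intg f c : bnd c f -> intg f.
Proof.
move=> bf; have [mf _] := bf.
have i1 : intg (fun=> 1) by apply: continuous_integrable3 => p; exact: cvg_cst.
have i2 : intg (fun p => 1 + f p ^+ 2).
  exact: (integrableD (measurable_shell h L) i1 (bnd_intg2 bf)).
apply: (le_integrable (measurable_shell h L) _ _ i2); first exact/measurable_EFinP.
move=> p Qp /=; rewrite lee_fin [leRHS]ger0_norm ?addr_ge0 ?sqr_ge0//.
by rewrite ler_norml; have := sqr_ge0 (f p - 1); have := sqr_ge0 (f p + 1); lra.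
Qed.

Variable w : 'I_3 -> R.
Variable K : forall i, kernel1 (i == ti) (lo h i) (hi h L i) (w i).
Local Notation kern := (kern K N0).
Local Notation moll := (moll K).
Let arg i p q := crd i q - kmu (K i) * crd i p - kc (K i).

Lemma kern_ge0 p q : 0 <= kern p q.
Proof. by rewrite kern0E !mulr_ge0// kb_ge0. Qed.

Lemma continuous_kern0 p : continuous (kern p).
Proof. exact: continuous_section (@continuous_kern _ _ _ _ K N0). Qed.

Lemma continuous_kern_l q : continuous (kern^~ q).
Proof.
move=> p; apply: (continuous_comp (f := fun p : pt => (p, q)) (g := fun pq => kern pq.1 pq.2)).
  by apply: continuous_pair; [exact: cvg_id|exact: cvg_cst].
exact: continuous_kern.
Qed.

Lemma shell_integral (F : 'I_3 -> R -> R) (a : 'I_3 -> R) :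
  (forall i, continuous (F i)) -> (forall i x, 0 <= F i x) ->
  (forall i, \int[leb]_(x in `[lo h i, hi h L i]) F i x = a i) ->
  (\int[leb3 R]_(p in Q) (F ri p.1.1 * F ti p.1.2 * F zi p.2)%:E = (a ri * a ti * a zi)%:E)%E.
Proof.
move=> cF F0 Fa; have mI (x y : R) : measurable (`[x, y] : set mR) by exact: measurable_itv.
have ai i : (\int[leb]_(x in `[lo h i, hi h L i]) (F i x)%:E = (a i)%:E)%E.
  rewrite -(Fa i) /Rintegral fineK//; apply: integrable_fin_num => //.
  exact: continuous_integrable_itv.
have mF i D : measurable_fun D (F i : mR -> mR).
  by apply: measurable_funS (continuous_measurable_fun (cF i)).
have mQ2 : measurable (Ih h `*` `[0, 2 * pi] : set (mR * mR)%type).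
  by apply: measurableX; exact: mI.
have H2 := product_integral (mI _ _) (mI _ _) (mF ri _) (mF ti _)
  (fun x _ => F0 ri x) (fun x _ => F0 ti x) (ai ri) (ai ti).
pose F2 (x : mR * mR) : R := F ri x.1 * F ti x.2.
have mF2 : measurable_fun (Ih h `*` `[0, 2 * pi] : set (mR * mR)%type) F2.
  apply: measurable_funM.
    exact: (measurableT_comp (mF ri setT) (measurable_funS _ _ measurable_fst)).
  exact: (measurableT_comp (mF ti setT) (measurable_funS _ _ measurable_snd)).
have F20 x : (Ih h `*` `[0, 2 * pi]) x -> 0 <= F2 x by move=> _; exact: mulr_ge0.
exact: (@product_integral _ _ _ _ R (leb2 R) leb _ _ F2 (F zi) _ _ mQ2 (mI _ _) mF2 (mF zi _) F20
  (fun x _ => F0 zi x) H2 (ai zi)).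
Qed.

Lemma continuous_kb_r i (x : R) : continuous (fun y => kb (K i) (y - kmu (K i) * x - kc (K i))).
Proof.
move=> y; apply: (continuous_comp (f := fun y : R => y - kmu (K i) * x - kc (K i)) (g := kb (K i))).
  by apply: cvgB; [apply: cvgB; [exact: cvg_id|exact: cvg_cst]|exact: cvg_cst].
exact: (smooth1_continuous (kb_smooth (K i))).
Qed.

Lemma continuous_kb_l i (y : R) : continuous (fun x => kb (K i) (y - kmu (K i) * x - kc (K i))).
Proof.
move=> x; apply: (continuous_comp (f := fun x : R => y - kmu (K i) * x - kc (K i)) (g := kb (K i))).
  apply: cvgB; last exact: cvg_cst.
  by apply: cvgB; [exact: cvg_cst|apply: cvgM; [exact: cvg_cst|exact: cvg_id]].
exact: (smooth1_continuous (kb_smooth (K i))).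
Qed.

Lemma kern_mass p : Q p -> Rintegral (leb3 R) Q (kern p) = 1.
Proof.
move=> Qp; rewrite /Rintegral -[RHS]/(fine (1%:E)); congr fine.
have := @shell_integral (fun i y => kb (K i) (y - kmu (K i) * crd i p - kc (K i))) (fun=> 1)
  (fun i => @continuous_kb_r i _) (fun i x => kb_ge0 (K i) _)
  (fun i => kb_mass (K i) (shell_crd i Qp)).
rewrite !mulr1 => <-.
by apply: eq_integral => q _; rewrite kern0E.
Qed.

(** In the first variable the contractions change the mass, by a factor at
    most 2 in each coordinate. *)
Lemma kern_mass' q : Q q -> (\int[leb3 R]_(p in Q) (kern p q)%:E <= 8%:E)%E.
Proof.
move=> Qq.
pose F i x := kb (K i) (crd i q - kmu (K i) * x - kc (K i)).
have S := @shell_integral F (fun i => \int[leb]_(x in `[lo h i, hi h L i]) F i x)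
  (fun i => @continuous_kb_l i _) (fun i x => kb_ge0 (K i) _) (fun i => erefl).
rewrite (eq_integral (fun p : mR * mR * mR => (F ri p.1.1 * F ti p.1.2 * F zi p.2)%:E)); last first.
  by move=> p _; rewrite kern0E.
rewrite [X in (X <= _)%E]S lee_fin /F {S}.
have H i := kb_mass' (K i) (shell_crd i Qq).
have H0 i : 0 <= \int[leb]_(x in `[lo h i, hi h L i]) kb (K i) (crd i q - kmu (K i) * x - kc (K i)).
  by apply: Rintegral_ge0 => x _; exact: kb_ge0.
rewrite (_ : 8 = 2 * 2 * 2 :> R); last by ring.
apply: ler_pM; [exact: mulr_ge0|exact: H0| |exact: H].
by apply: ler_pM; [exact: H0|exact: H0|exact: H|exact: H].
Qed.

(** The kernel has mass one, so this is the nonnegativity of a variance. *)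
Lemma moll_sqr_le f c p : bnd c f -> Q p -> moll f p ^+ 2 <= moll (fun q => f q ^+ 2) p.
Proof.
move=> bf Qp; have mQ := measurable_shell h L.
set t := moll f p.
have I1 : intg (fun q => f q * kern p q) by apply: intg_mul (bnd_intg bf) _; exact: continuous_kern0.
have I2 : intg (fun q => f q ^+ 2 * kern p q) by apply: intg_mul (bnd_intg2 bf) _; exact: continuous_kern0.
have I0 : intg (kern p) by apply: continuous_integrable3; exact: continuous_kern0.
have I3 : intg (fun q => t ^+ 2 * kern p q).
  exact: (@integrableZl _ _ _ (leb3 R) Q mQ (t ^+ 2) _ I0).
have I4 : intg (fun q => (2 * t) * (f q * kern p q)).
  exact: (@integrableZl _ _ _ (leb3 R) Q mQ (2 * t) _ I1).
have : 0 <= Rintegral (leb3 R) Q (fun q => (f q - t) ^+ 2 * kern p q).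
  by apply: Rintegral_ge0 => q _; rewrite mulr_ge0 ?sqr_ge0// kern_ge0.
rewrite (_ : (fun q => _) = (fun q => f q ^+ 2 * kern p q -
  ((2 * t) * (f q * kern p q) - t ^+ 2 * kern p q))); last by apply/funext => q; ring.
rewrite (RintegralB mQ I2 (intgB I4 I3)) (RintegralB mQ I4 I3).
rewrite RintegralZl// RintegralZl// kern_mass// -/(Submission.moll K f p) -/t.
rewrite -/(Submission.moll K (fun q => f q ^+ 2) p).
move: (Submission.moll K _ p) => y; lra.
Qed.

(** Schur's test: the kernel has bounded mass in each of its two variables,
    and the order of integration is exchanged. *)
Theorem moll_bound f c : bnd c f -> bnd (24 * c) (moll f).
Proof.
move=> bf; have mQ := measurable_shell h L; have [mf _] := bf.
have I2 := bnd_intg2 bf.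
have cm : continuous (moll f) := smooth_continuous (smooth_moll K (bnd_intg bf)).
have cm2 : continuous (moll (fun q => f q ^+ 2)) := smooth_continuous (smooth_moll K I2).
split; first exact: continuous_meas.
pose F (pq : (mR * mR * mR) * (mR * mR * mR)) : \bar R := (f pq.2 ^+ 2 * kern pq.1 pq.2)%:E.
have F0 pq : (0 <= F pq)%E by rewrite lee_fin mulr_ge0 ?sqr_ge0 ?kern_ge0.
have mF : measurable_fun (Q `*` Q : set ((mR * mR * mR) * (mR * mR * mR))) F.
  apply/measurable_EFinP; apply: measurable_funM.
    apply: measurable_funX.
    by apply: (@measurable_comp _ _ _ _ _ _ Q (f : mR * mR * mR -> mR) _ snd) => //;
      [move=> _ [pq [? ?] <-]|exact: measurable_funS measurable_snd].
  have mk i : measurable_fun (Q `*` Q : set ((mR * mR * mR) * (mR * mR * mR)))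
      (fun pq : (mR * mR * mR) * (mR * mR * mR) => kb (K i) (arg i pq.1 pq.2) : mR).
    have mc : measurable_fun setT (crd i : mR * mR * mR -> mR).
      by apply: continuous_measurable3; exact: continuous_crd.
    apply: (@measurable_funS _ _ _ _ setT) => //.
    apply: (@measurableT_comp _ _ _ _ _ _ (kb (K i) : mR -> mR)).
      exact: continuous_measurable_fun (smooth1_continuous (kb_smooth (K i))).
    apply: measurable_funB => //; apply: measurable_funB.
      exact: (measurableT_comp mc measurable_snd).
    apply: measurable_funM => //; exact: (measurableT_comp mc measurable_fst).
  rewrite (_ : (fun pq => kern pq.1 pq.2) = (fun pq => kb (K ri) (arg ri pq.1 pq.2) *
    kb (K ti) (arg ti pq.1 pq.2) * kb (K zi) (arg zi pq.1 pq.2))).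
    exact: measurable_funM (measurable_funM (mk ri) (mk ti)) (mk zi).
  by apply/funext => pq; rewrite kern0E.
have e1 p : (moll (fun q => f q ^+ 2) p)%:E = (\int[leb3 R]_(q in Q) F (p, q))%E.
  rewrite /Submission.moll /Rintegral fineK//; apply: integrable_fin_num => //.
  by apply: intg_mul I2 _; exact: continuous_kern0.
have m0 p : 0 <= moll (fun q => f q ^+ 2) p.
  by apply: Rintegral_ge0 => q _; rewrite mulr_ge0 ?sqr_ge0 ?kern_ge0.
apply: (@le_trans _ _ (\int[leb3 R]_(p in Q) ((3 / 2)%:E * (moll (fun q => f q ^+ 2) p)%:E))%E).
  apply: ge0_le_integral => //.
  - by move=> p; exact: dens_ge0.
  - by apply: measE_dens; exact: continuous_meas.
  - by apply: measurable_funeM; apply/measurable_EFinP; exact: continuous_meas.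
  move=> p Qp; rewrite -EFinM lee_fin mulrC.
  have /andP[r1 r2] := radius_bounds h_lt1 Qp.
  by apply: ler_pM; rewrite ?sqr_ge0 ?(radius_ge0 h_lt1 Qp)//; exact: (moll_sqr_le bf Qp).
rewrite ge0_integralZl_EFin//; last 2 first.
- by move=> p _; rewrite lee_fin.
- by apply/measurable_EFinP; exact: continuous_meas.
have -> : (\int[leb3 R]_(p in Q) (moll (fun q => f q ^+ 2) p)%:E =
    \int[leb3 R]_(p in Q) \int[leb3 R]_(q in Q) F (p, q))%E.
  by apply: eq_integral => p _; exact: e1.
rewrite -(tonelli_rect1 (leb3 R) (leb3 R) mQ mQ mF (fun pq _ => F0 pq)).
rewrite (tonelli_rect2 (leb3 R) (leb3 R) mQ mQ mF (fun pq _ => F0 pq)).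
pose kap q := Rintegral (leb3 R) Q (fun p => 1 * kern p q).
have I1 : intg (fun=> 1) by apply: continuous_integrable3 => p; exact: cvg_cst.
have ck : continuous kap.
  apply: (continuous_paramQ I1 (F := fun q p => kern p q)) => qp.
  apply: (continuous_comp (f := fun qp : pt * pt => (qp.2, qp.1)) (g := fun pq => kern pq.1 pq.2)).
    by apply: continuous_pair; [exact: continuous_snd|exact: continuous_fst].
  exact: continuous_kern.
have kap0 q : 0 <= kap q by apply: Rintegral_ge0 => p _; rewrite mul1r kern_ge0.
have kapE q : (\int[leb3 R]_(p in Q) (kern p q)%:E = (kap q)%:E)%E.
  rewrite /kap; under eq_Rintegral do rewrite mul1r.
  rewrite /Rintegral fineK//; apply: integrable_fin_num => //.
  exact/continuous_integrable3/continuous_kern_l.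
have e2 q : (\int[leb3 R]_(p in Q) F (p, q) = (f q ^+ 2 * kap q)%:E)%E.
  rewrite (_ : (fun p => F (p, q)) = (fun p => (f q ^+ 2)%:E * (kern p q)%:E)%E)//.
  rewrite ge0_integralZl_EFin ?sqr_ge0//; [by rewrite kapE|by move=> p _; rewrite lee_fin kern_ge0|].
  by apply/measurable_EFinP; apply: continuous_meas; exact: continuous_kern_l.
apply: (@le_trans _ _ ((3 / 2)%:E * \int[leb3 R]_(q in Q) (16%:E * (f q ^+ 2 * q.1.1)%:E))%E).
  apply: lee_wpmul2l; first by rewrite lee_fin.
  have -> : (\int[leb3 R]_(q in Q) \int[leb3 R]_(p in Q) F (p, q) =
      \int[leb3 R]_(q in Q) (f q ^+ 2 * kap q)%:E)%E.
    by apply: eq_integral => q _; exact: e2.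
  apply: ge0_le_integral => //.
  - by move=> q Qq; rewrite lee_fin mulr_ge0 ?sqr_ge0.
  - apply/measurable_EFinP; apply: measurable_funM; first exact: measurable_funX.
    exact: continuous_meas.
  - by apply: measurable_funeM; exact: measE_dens.
  move=> q Qq; rewrite EFinM -kapE.
  apply: (le_trans (lee_wpmul2l _ (kern_mass' Qq))); first by rewrite lee_fin sqr_ge0.
  rewrite -!EFinM lee_fin mulrC (_ : 16 * _ = 8 * (f q ^+ 2 * (2 * q.1.1))); last by ring.
  rewrite ler_pM2l// ler_peMr ?sqr_ge0//.
  by have /andP[r1 r2] := radius_bounds h_lt1 Qq; lra.
rewrite ge0_integralZl_EFin//; last 2 first.
- by move=> q; exact: dens_ge0.
- exact: measE_dens.
rewrite muleA -EFinM (_ : 3 / 2 * 16 = 24 :> R); last by field.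
by rewrite EFinM lee_wpmul2l//; exact: bf.2.
Qed.
End MollifierBound.

(** * A class of functions on which mollifiers converge *)

Section DominatedL2.
Context {R : realType}.
Local Notation pt := (R * R * R)%type.
Local Notation mR := (measurableTypeR R).
Local Notation leb := (@lebesgue_measure R).
Variables (h L : R).
Hypotheses (h_lt1 : h < 1).
Local Notation Q := (shell h L).
Local Notation bnd := (bnd h L).
Local Notation meas := (meas h L).
Implicit Types (f g F : pt -> R) (p q : pt) (i j : 'I_3).

Lemma aeS (P P' : set (mR * mR * mR)) : (forall p, P p -> P' p) ->
  {ae leb3 R, forall p, P p} -> {ae leb3 R, forall p, P' p}.
Proof. exact: (@filterS _ _ (ae_filter_ringOfSetsType (leb3 R))). Qed.

Lemma aeI (P P' : set (mR * mR * mR)) : {ae leb3 R, forall p, P p} ->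
  {ae leb3 R, forall p, P' p} -> {ae leb3 R, forall p, P p /\ P' p}.
Proof. exact: (@filterI _ _ (ae_filter_ringOfSetsType (leb3 R))). Qed.

Lemma dominated_L2 (g : nat -> pt -> R) F c eta : (forall n, meas (g n)) -> bnd c F ->
  (forall n p, Q p -> `|g n p| <= F p) ->
  {ae leb3 R, forall p, Q p -> g n p @[n --> \oo] --> (0 : R)} ->
  0 < eta -> \forall n \near \oo, bnd eta (g n).
Proof.
move=> mg bF gF g0 e0.
pose f_ n (p : mR * mR * mR) := (g n p ^+ 2 * p.1.1)%:E.
have fcvg : {ae leb3 R, forall p, Q p -> f_ ^~ p @ \oo --> cst 0%E p}.
  apply: aeS g0 => p H Qp; apply: cvg_EFin; first by near=> n.
  rewrite /comp /f_ /= -[X in _ --> X](mul0r p.1.1); apply: cvgMl.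
  rewrite -[X in _ --> X](mulr0 0); under eq_fun do rewrite expr2.
  by apply: cvgM; exact: H.
have fdom : {ae leb3 R, forall p n, Q p -> (`|f_ n p| <= (F p ^+ 2 * p.1.1)%:E)%E}.
  apply: aeW => p n Qp; rewrite /f_ gee0_abs; last exact: (dens_ge0 h_lt1 (g n) Qp).
  rewrite lee_fin; apply: ler_wpM2r; first exact: (radius_ge0 h_lt1 Qp).
  rewrite -(real_normK (num_real (g n p))); apply: sqr_le; [exact: normr_ge0|exact: gF].
have [_ _ H] := @dominated_convergence _ _ R (leb3 R) Q (measurable_shell h L) f_ (cst 0%E)
  (fun p => (F p ^+ 2 * p.1.1)%:E)
  (fun n => measE_dens (mg n)) (measurable_cst _) fcvg (integrable_dens h_lt1 bF) fdom.
have {H} : sqnorm h L (g n) @[n --> \oo] --> 0%E.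
  by rewrite -[X in _ --> X](integral0 (leb3 R) Q).
move=> /cvg0_near/(_ e0).
by apply: filterS => n Hn; split => //; exact: ltW.
Unshelve. all: by end_near. Qed.

Lemma crd_plane_negligible i (c : R) : (leb3 R).-negligible [set p : mR * mR * mR | crd i p = c].
Proof.
have p2 : (leb2 R) ([set c] `*` setT) = 0%E.
  by rewrite [LHS]product_measure1E//= lebesgue_measure_set1 mul0e.
have p2' : (leb2 R) (setT `*` [set c]) = 0%E.
  by rewrite [LHS]product_measure1E//= lebesgue_measure_set1 mule0.
case: (ord3P i) => ->.
- exists (([set c] `*` setT) `*` setT); split; [by apply: measurableX => //; apply: measurableX| |by move=> p /= <-].
  by rewrite [LHS]product_measure1E//; [rewrite [X in (X * _)%E]p2 mul0e|exact: measurableX].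
- exists ((setT `*` [set c]) `*` setT); split; [by apply: measurableX => //; apply: measurableX| |by move=> p /= <-].
  by rewrite [LHS]product_measure1E//; [rewrite [X in (X * _)%E]p2' mul0e|exact: measurableX].
- exists (setT `*` [set c]); split; [by apply: measurableX| |by move=> p /= <-].
  by rewrite [LHS]product_measure1E//= lebesgue_measure_set1 mule0.
Qed.

Lemma ae_off_plane i (c : R) : {ae leb3 R, forall p : mR * mR * mR, crd i p != c}.
Proof.
have [N [mN N0 sN]] := crd_plane_negligible i c.
by exists N; split => // p /= /negP; rewrite negbK => /eqP; exact: sN.
Qed.

Lemma eq_in_meas f g : (forall p, Q p -> f p = g p) -> meas f -> meas g.
Proof. by move=> fg; apply: eq_measurable_fun => p; rewrite inE => /fg. Qed.

Lemma eq_in_bnd c f g : (forall p, Q p -> f p = g p) -> bnd c f -> bnd c g.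
Proof.
move=> fg [mf lf]; split; first exact: eq_in_meas mf.
rewrite (_ : sqnorm h L g = sqnorm h L f)//.
by apply: eq_integral => p; rewrite inE => /fg ->.
Qed.

Lemma bnd_bounded M f : meas f -> (forall p, Q p -> `|f p| <= M) -> exists c, bnd c f.
Proof.
move=> mf fM.
have cM : continuous ((fun=> M) : pt -> R) by move=> p; exact: cvg_cst.
exists (1 * (2 * Ibox h L (((fun=> M) : pt -> R) * ((fun=> M) : pt -> R)))).
apply: (bnd_scale h_lt1 mf ler01 _ (bnd_Ibox L h_lt1 cM)) => p Qp.
rewrite mul1r -(real_normK (num_real (f p))); apply: sqr_le; [exact: normr_ge0|exact: fM].
Qed.
End DominatedL2.

Section Convergence.
Context {R : realType}.
Local Notation pt := (R * R * R)%type.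
Local Notation mR := (measurableTypeR R).
Local Notation leb := (@lebesgue_measure R).
Variables (h L : R).
Hypotheses (h_gt0 : 0 < h) (h_lt1 : h < 1) (L_gt0 : 0 < L).
Local Notation Q := (shell h L).
Local Notation bnd := (bnd h L).
Local Notation meas := (meas h L).
Local Notation intg := (intg h L).
Implicit Types (f g F : pt -> R) (p q : pt) (i j : 'I_3) (A B S : set pt).

Definition width n i : R := (hi h L i - lo h i) / (8 * n.+1%:R).

Lemma width_gt0 n i : 0 < width n i.
Proof. by rewrite divr_gt0 ?mulr_gt0// subr_gt0 lo_lt_hi. Qed.

Lemma width_le n i : 8 * width n i <= hi h L i - lo h i.
Proof.
rewrite /width invfM mulrCA (mulrA 8) divff// mul1r mulrC.
have := lo_lt_hi h_gt0 L_gt0 i; rewrite -subr_gt0 => l0.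
by rewrite ger_pMl// invf_le1// ler1n.
Qed.

Definition mkernel n i : kernel1 (i == ti) (lo h i) (hi h L i) (width n i).
Proof.
have [e|it] := eqVneq i ti; last exact: interval_kernel (width_gt0 n i) (width_le n i).
rewrite e; apply: circle_kernel; first exact: width_gt0.
by have := width_le n ti; rewrite [X in _ <= X]subr0.
Qed.

Definition mo n f := moll (mkernel n) f.

Lemma width_small i (e : R) : 0 < e -> \forall n \near \oo, 3 * width n i < e.
Proof.
move=> e0; have : (3 * (hi h L i - lo h i) / 8) * (n.+1%:R^-1) @[n --> \oo] --> (0 : R).
  rewrite -[X in _ --> X](mulr0 (3 * (hi h L i - lo h i) / 8)); apply: cvgMr.
  exact: cvg_harmonic.
move=> /cvgr_lt/(_ e e0); apply: filterS => n.
by rewrite /width invfM !mulrA.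
Qed.

Definition mollified f := (exists c, bnd c f) /\
  forall eta, 0 < eta -> \forall n \near \oo, bnd eta (fun p => mo n f p - f p).

Lemma mo_comb n a b f g : intg f -> intg g ->
  forall p, mo n (fun p => a * f p + b * g p) p = a * mo n f p + b * mo n g p.
Proof.
move=> If Ig p; have mQ := measurable_shell h L; rewrite /mo /moll.
have c0 := @continuous_kern0 R h L _ (mkernel n) p.
have I1 := intg_mul If c0; have I2 := intg_mul Ig c0.
rewrite -RintegralZl// -[X in _ + X]RintegralZl//.
rewrite -(RintegralD mQ (integrableZl mQ a I1) (integrableZl mQ b I2)).
by apply: eq_Rintegral => q _; rewrite mulrDl !mulrA.
Qed.

Lemma eq_mo n f g p : (forall q, Q q -> f q = g q) -> mo n f p = mo n g p.
Proof. by move=> fg; apply: eq_Rintegral => q; rewrite inE => /fg ->. Qed.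

Lemma meas_mo n f c : bnd c f -> meas (mo n f).
Proof. by move=> bf; have [] := moll_bound h_lt1 (mkernel n) bf. Qed.

Lemma mollified_comb a b f g : mollified f -> mollified g ->
  mollified (fun p => a * f p + b * g p).
Proof.
move=> [[c1 b1] H1] [[c2 b2] H2].
have a2 := sqr_ge0 a; have b2' := sqr_ge0 b.
have comb f' g' x y : bnd x f' -> bnd y g' ->
    bnd (2 * a ^+ 2 * x + 2 * b ^+ 2 * y) (fun p => a * f' p + b * g' p).
  move=> bf bg; apply: (bnd_comb h_lt1 _ (mulr_ge0 (ler0n _ 2) a2) (mulr_ge0 (ler0n _ 2) b2') _ bf bg).
    by apply: measurable_funD; apply: measurable_funM => //; [exact: bf.1|exact: bg.1].
  by move=> p _; rewrite -!(mulrA 2) -!exprMn; exact: sqrD_le.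
split; first by eexists; exact: comb b1 b2.
move=> eta e0; pose d := eta / (2 * a ^+ 2 + 2 * b ^+ 2 + 1).
have k0 : 0 <= 2 * a ^+ 2 + 2 * b ^+ 2 by rewrite addr_ge0// mulr_ge0.
have d0 : 0 < d by rewrite divr_gt0// ltr_wpDl.
have N1 := H1 _ d0; have N2 := H2 _ d0; apply: filterS2 N1 N2 => n B1 B2.
apply: bndW (_ : 2 * a ^+ 2 * d + 2 * b ^+ 2 * d <= _) _.
  rewrite -mulrDl /d mulrCA ger_pMr// ler_pdivrMr ?mul1r ?lerDl//.
  by rewrite ltr_wpDl.
apply: eq_bnd (comb _ _ _ _ B1 B2) => p.
by rewrite (mo_comb n a b (bnd_intg h_lt1 b1) (bnd_intg h_lt1 b2)); ring.
Qed.

Lemma eq_mollified f g : (forall p, Q p -> f p = g p) -> mollified f -> mollified g.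
Proof.
move=> fg [[c bf] H]; split; first by exists c; exact: eq_in_bnd bf.
move=> eta /H; apply: filterS => n; apply: eq_in_bnd => p Qp.
by rewrite (eq_mo n p fg) fg.
Qed.

(** The mollifiers are uniformly bounded on L^2. *)
Lemma mollified_closed f : (exists c, bnd c f) ->
  (forall eta, 0 < eta -> exists2 g, mollified g & bnd eta (fun p => f p - g p)) -> mollified f.
Proof.
move=> [c bf] H; split; first by exists c.
move=> eta e0; pose d := eta / 60; have d0 : 0 < d by rewrite divr_gt0.
have [g [[c' bg] Hg] fg] := H _ d0.
apply: filterS (Hg _ d0) => n gn.
have b1 := moll_bound h_lt1 (mkernel n) fg.
apply: bndW (_ : 2 * (24 * d + 2 * (d + d)) <= _) _; first by rewrite /d; lra.
apply: eq_bnd (bndD h_lt1 b1 (bndB h_lt1 gn fg)) => p.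
have := mo_comb n 1 (-1) (bnd_intg h_lt1 bf) (bnd_intg h_lt1 bg) p.
rewrite (_ : (fun p => 1 * f p + -1 * g p) = (fun p => f p - g p)); last first.
  by apply/funext => q; ring.
by rewrite /mo => ->; ring.
Qed.

Lemma mollified_limit (g : nat -> pt -> R) f F c : bnd c F -> (exists c, bnd c f) ->
  (forall n, mollified (g n)) -> (forall n p, Q p -> `|f p - g n p| <= F p) ->
  {ae leb3 R, forall p, Q p -> f p - g n p @[n --> \oo] --> (0 : R)} -> mollified f.
Proof.
move=> bF [cf bf] Mg gF g0; apply: mollified_closed; first by exists cf.
move=> eta e0.
have mg n : meas (fun p => f p - g n p).
  by have [[c' [m' _]] _] := Mg n; apply: measurable_funB => //; exact: bf.1.
have /filter_ex[n Hn] := dominated_L2 h_lt1 mg bF gF g0 e0.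
by exists (g n).
Qed.

Lemma meas_indic A : measurable (A : set (mR * mR * mR)) -> meas (\1_A).
Proof. by move=> mA; exact: measurable_indic. Qed.

Lemma bnd_indic A : measurable (A : set (mR * mR * mR)) -> exists c, bnd c (\1_A : pt -> R).
Proof.
move=> mA; apply: (bnd_bounded h_lt1 (meas_indic mA)) => p _.
by rewrite indicE ger0_norm//; case: (_ \in _) => //; exact: (lexx 1).
Qed.

(** If almost every point has a neighbourhood inside or outside A, then the
    mollified indicator is eventually exact there: the kernel has mass one. *)
Lemma mollified_regular A : measurable (A : set (mR * mR * mR)) ->
  {ae leb3 R, forall p : mR * mR * mR, Q p -> exists2 e : R, 0 < e & forall q, Q q ->
    (forall i, `|crd i q - crd i p| <= e) -> (A q <-> A p)} ->
  mollified (\1_A).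
Proof.
move=> mA regA; have [c bA] := bnd_indic mA; split; first by exists c.
have mQ := measurable_shell h L.
have diff n p : Q p -> mo n (\1_A) p - \1_A p =
    Rintegral (leb3 R) Q (fun q => (\1_A q - \1_A p) * kern (mkernel n) N0 p q).
  move=> Qp; have c0 := @continuous_kern0 R h L _ (mkernel n) p.
  have I1 := intg_mul (bnd_intg h_lt1 bA) c0.
  have I0 : intg (kern (mkernel n) N0 p) by exact: continuous_integrable3.
  have I2 : intg (fun q => \1_A p * kern (mkernel n) N0 p q) by exact: (integrableZl mQ (\1_A p) I0).
  transitivity (mo n (\1_A) p - \1_A p * Rintegral (leb3 R) Q (kern (mkernel n) N0 p)).
    by rewrite kern_mass// mulr1.
  rewrite -RintegralZl// /mo /moll -(RintegralB mQ I1 I2).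
  by apply: eq_Rintegral => q _; rewrite mulrBl.
have c1 : continuous ((fun=> 2) : pt -> R) by move=> p; exact: cvg_cst.
have b2 := bnd_Ibox L h_lt1 c1.
move=> eta e0; apply: (dominated_L2 h_lt1 _ b2 _ _ e0).
- by move=> n; apply: measurable_funB; [exact: meas_mo bA|exact: bA.1].
- move=> n p Qp.
  have i01 q : 0 <= (\1_A q : R) <= 1 by rewrite indicE; case: (_ \in _); rewrite ?lexx ?ler01.
  have c0 := @continuous_kern0 R h L _ (mkernel n) p.
  have I1 := intg_mul (bnd_intg h_lt1 bA) c0.
  have I0 : intg (kern (mkernel n) N0 p) by exact: continuous_integrable3.
  have m0 : 0 <= mo n (\1_A) p.
    by apply: Rintegral_ge0 => q _; rewrite mulr_ge0 ?kern_ge0//; have /andP[] := i01 q.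
  have m1 : mo n (\1_A) p <= 1.
    rewrite -(kern_mass (mkernel n) Qp); apply: le_Rintegral => // q _.
    by rewrite ler_piMl ?kern_ge0//; have /andP[] := i01 q.
  by have /andP[a0 a1] := i01 p; rewrite ler_norml; apply/andP; split; lra.
have off : {ae leb3 R, forall p : mR * mR * mR, forall i, (crd i p != lo h i) && (crd i p != hi h L i)}.
  have o i : {ae leb3 R, forall p : mR * mR * mR, (crd i p != lo h i) && (crd i p != hi h L i)}.
    by apply: aeS (aeI (ae_off_plane i (lo h i)) (ae_off_plane i (hi h L i))) => p [-> ->].
  apply: aeS (aeI (o ri) (aeI (o ti) (o zi))) => p [? [? ?]] i.
  by case: (ord3P i) => ->.
apply: aeS (aeI regA off) => p [reg pi] Qp.
have [e e1 He] := reg Qp.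
have far i : exists2 d : R, 0 < d & forall x, lo h i <= x <= hi h L i ->
    hi h L i - lo h i - d < `|x - crd i p| -> False.
  have /andP[l0 l1] := pi i; have /andP[q0 q1] := shell_crd i Qp.
  have d1 : 0 < crd i p - lo h i by rewrite subr_gt0 lt_neqAle eq_sym l0.
  have d2 : 0 < hi h L i - crd i p by rewrite subr_gt0 lt_neqAle l1.
  exists (Num.min (crd i p - lo h i) (hi h L i - crd i p)); first by rewrite lt_min d1.
  move=> x /andP[x0 x1]; apply/negP; rewrite -leNgt.
  have m1 : Num.min (crd i p - lo h i) (hi h L i - crd i p) <= crd i p - lo h i by rewrite ge_min lexx.
  have m2 : Num.min (crd i p - lo h i) (hi h L i - crd i p) <= hi h L i - crd i p by rewrite ge_min lexx orbT.
  by rewrite ler_norml; move: (Num.min _ _) m1 m2 => m *; apply/andP; split; lra.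
have small i : \forall n \near \oo, forall x, lo h i <= x <= hi h L i ->
    kb (mkernel n i) (x - kmu (mkernel n i) * crd i p - kc (mkernel n i)) != 0 -> `|x - crd i p| <= e.
  have [d d0 Hd] := far i.
  apply: filterS2 (width_small i e1) (width_small i d0) => n we wd x xI kx.
  have [n1|n1] := kb_near (shell_crd i Qp) xI kx; first by apply: le_trans n1 (ltW we).
  by case: (Hd x xI); apply: lt_le_trans n1; rewrite ltrD2l ltrN2.
apply: cvg_near_cst; apply: filterS3 (small ri) (small ti) (small zi) => n s1 s2 s3.
rewrite diff// /Rintegral integral0_eq// => q Qq; congr (_%:E).
rewrite kern0E; have [/eqP|] := boolP (kb (mkernel n ri) (crd ri q - kmu (mkernel n ri) * crd ri p - kc (mkernel n ri)) *
  kb (mkernel n ti) (crd ti q - kmu (mkernel n ti) * crd ti p - kc (mkernel n ti)) *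
  kb (mkernel n zi) (crd zi q - kmu (mkernel n zi) * crd zi p - kc (mkernel n zi)) == 0).
  by move=> ->; rewrite mulr0.
rewrite !mulf_eq0 !negb_or => /andP[/andP[k1 k2] k3].
have HA : A q <-> A p.
  apply: He => // i; case: (ord3P i) => ->.
  - exact: s1 (shell_crd ri Qq) k1.
  - exact: s2 (shell_crd ti Qq) k2.
  - exact: s3 (shell_crd zi Qq) k3.
rewrite (_ : (\1_A q : R) = \1_A p) ?subrr ?mul0r//.
by rewrite !indicE; congr ((_ : bool)%:R); apply/idP/idP; rewrite !inE => /HA.
Qed.
End Convergence.

(** * Mollifiers converge on L^2 *)

Import HBNNSimple.

Section Density.
Context {R : realType}.
Local Notation pt := (R * R * R)%type.
Local Notation mR := (measurableTypeR R).
Local Notation mpt := (mR * mR * mR)%type.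
Local Notation leb := (@lebesgue_measure R).
Variables (h L : R).
Hypotheses (h_gt0 : 0 < h) (h_lt1 : h < 1) (L_gt0 : 0 < L).
Local Notation Q := (shell h L).
Local Notation bnd := (bnd h L).
Local Notation meas := (meas h L).
Local Notation mollified := (mollified h_gt0 L_gt0).
Implicit Types (f g F : pt -> R) (p q : pt) (i j : 'I_3).

Lemma sqr_indic_le (A B : set pt) p : `|\1_A p - \1_B p| <= 1 :> R.
Proof. by rewrite !indicE; do 2 case: (_ \in _); rewrite /= ?subrr ?subr0 ?sub0r ?normrN ?normr0 ?normr1// ler01. Qed.

(** Dynkin's lemma for the slab-type sets obtained by pulling back along one
    projection while keeping the other constraints fixed. *)
Lemma mollified_dynkin d (T : measurableType d) (G : set (set T)) (pr : mpt -> T) (S : set mpt) :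
  measurable_fun setT pr -> measurable S -> @measurable _ T = <<s G >> -> setI_closed G ->
  mollified (\1_S) -> (forall A, G A -> mollified (\1_(pr @^-1` A `&` S))) ->
  forall A, measurable A -> mollified (\1_(pr @^-1` A `&` S)).
Proof.
move=> mpr mS gen GI MS HG A; rewrite [X in X A -> _]gen.
have mpre B : measurable B -> measurable (pr @^-1` B `&` S).
  by move=> mB; apply: measurableI => //; rewrite -[X in measurable X]setTI; exact: mpr.
apply: (@dynkin_induction _ T G (fun A => mollified (\1_(pr @^-1` A `&` S))) gen GI) => //.
- by rewrite preimage_setT setTI.
- move=> B mB MB; apply: eq_mollified (mollified_comb h_lt1 1 (-1) MS MB) => p _.
  rewrite !indicE !in_setI; have [pS|pS] := boolP (p \in S); last by rewrite !andbF !mulr0 addr0.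
  rewrite !andbT; have [pB|pB] := boolP (p \in pr @^-1` B).
    rewrite (_ : (p \in pr @^-1` (~` B)) = false) ?mul1r ?mulN1r ?subrr//.
    by apply/negbTE; rewrite notin_setE => nB; apply: nB; rewrite inE in pB.
  rewrite (_ : (p \in pr @^-1` (~` B)) = true) ?mul1r ?mulr0 ?addr0//.
  by apply: mem_set => pB'; move: pB; rewrite notin_setE; exact.
move=> F mF tF MF.
pose FN n := \bigcup_(k in `I_n) F k.
have mFN n : measurable (FN n) by apply: bigcup_measurable => k _.
have MFN n : mollified (\1_(pr @^-1` (FN n) `&` S)).
  elim: n => [|n IH].
    apply: eq_mollified (mollified_comb h_lt1 0 0 MS MS) => p _.
    rewrite !mul0r addr0 indicE (_ : (p \in _) = false)//.
    by apply/negbTE; rewrite notin_setE => -[[k]].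
  apply: eq_mollified (mollified_comb h_lt1 1 1 IH (MF n)) => p _.
  rewrite !mul1r !indicE !in_setI.
  have [pS|pS] := boolP (p \in S); last by rewrite !andbF addr0.
  rewrite !andbT.
  have e : (p \in pr @^-1` FN n.+1) = (p \in pr @^-1` FN n) || (p \in pr @^-1` F n).
    apply/idP/idP; rewrite !inE.
      move=> [k /=]; rewrite ltnS leq_eqVlt => /orP[/eqP -> Fk|kn Fk].
        by apply/orP; right; rewrite inE.
      by apply/orP; left; rewrite inE; exists k.
    move=> /orP[]; rewrite inE.
      by move=> [k /= kn Fk]; exists k => //=; exact: ltnW.
    by move=> Fn; exists n => /=.
  rewrite e; have [p1|p1] := boolP (p \in pr @^-1` FN n) => /=.
    rewrite (_ : (p \in pr @^-1` F n) = false) ?addr0//.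
    apply/negbTE; rewrite notin_setE => /= Fn; move: p1; rewrite inE => -[k /= kn Fk].
    have := tF k n I I; move=> /(_ (ex_intro _ (pr p) (conj Fk Fn))) kn'.
    by move: kn; rewrite kn' ltnn.
  by rewrite add0r.
have c1 : continuous ((fun=> 1) : pt -> R) by move=> p; exact: cvg_cst.
have mU : measurable (\bigcup_k F k) by apply: bigcup_measurable => k _.
apply: (@mollified_limit R h L h_gt0 h_lt1 L_gt0 (fun n => \1_(pr @^-1` (FN n) `&` S))
  (\1_(pr @^-1` (\bigcup_k F k) `&` S)) _ _ (bnd_Ibox L h_lt1 c1) (@bnd_indic R h L h_lt1 _ (mpre _ mU)) MFN).
  by move=> n p _; exact: sqr_indic_le.
apply: aeW => p _.
have [[k _ Fk]|nU] := pselect ((\bigcup_k F k) (pr p)); last first.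
  have e1 : (p \in pr @^-1` (\bigcup_k F k)) = false by apply: memNset.
  apply: cvg_near_cst; apply: nearW => n; rewrite !indicE !in_setI e1.
  have -> : (p \in pr @^-1` FN n) = false.
    by apply: memNset => -[k _ Fk]; apply: nU; exists k.
  by rewrite subrr.
have e1 : (p \in pr @^-1` (\bigcup_k F k)) = true by apply: mem_set; exists k.
apply: cvg_near_cst; exists k.+1 => // n /= kn; rewrite !indicE !in_setI e1.
have -> : (p \in pr @^-1` FN n) = true by apply: mem_set; exists k.
by rewrite subrr.
Qed.

Definition regular_set (J : set mR) := measurable J /\ exists a b : R, forall x, x != a -> x != b ->
  exists2 e : R, 0 < e & forall y, `|y - x| <= e -> (J y <-> J x).

Lemma regular_setT : regular_set setT.
Proof. by split => //; exists 0, 0 => x _ _; exists 1. Qed.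

Lemma regular_itv (a b : R) : regular_set `]a, b[%classic.
Proof.
split; first exact: measurable_itv.
exists a, b => x xa xb.
have d1 : 0 < `|x - a| by rewrite normr_gt0 subr_eq0.
have d2 : 0 < `|x - b| by rewrite normr_gt0 subr_eq0.
exists (Num.min `|x - a| `|x - b| / 2); first by rewrite divr_gt0// lt_min d1.
have m0 : 0 < Num.min `|x - a| `|x - b| by rewrite lt_min d1.
have side (c : R) : Num.min `|x - a| `|x - b| <= `|x - c| ->
    Num.min `|x - a| `|x - b| <= x - c \/ Num.min `|x - a| `|x - b| <= c - x.
  by case: (ger0P (x - c)) => _ H; [left|right; rewrite -(opprB x c)].
have sa := side a; have sb := side b; rewrite ge_min lexx in sa; rewrite ge_min lexx orbT in sb.
move: (Num.min _ _) m0 (sa isT) (sb isT) => m m0 {}sa {}sb y; rewrite ler_norml => /andP[H1 H2].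
have {sa}sa : (a < y) = (a < x) by case: sa => m1; apply/idP/idP => ?; lra.
have {sb}sb : (y < b) = (x < b) by case: sb => m2; apply/idP/idP => ?; lra.
by rewrite /= !in_itv/= sa sb.
Qed.

Lemma mollified_box (J : 'I_3 -> set mR) : (forall i, regular_set (J i)) ->
  mollified (\1_[set p : mpt | forall i, J i (crd i p)]).
Proof.
move=> rJ.
have mc i : measurable_fun setT (crd i : mpt -> mR).
  by apply: continuous_measurable3; exact: continuous_crd.
apply: mollified_regular => //.
  rewrite (_ : [set p | _] = (crd ri : mpt -> mR) @^-1` J ri `&` ((crd ti : mpt -> mR) @^-1` J ti `&`
      (crd zi : mpt -> mR) @^-1` J zi)).
    have mp i : measurable ((crd i : mpt -> mR) @^-1` J i).
      by rewrite -[X in measurable X]setTI; apply: mc => //; exact: (rJ i).1.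
    by apply: measurableI; [exact: mp|apply: measurableI; exact: mp].
  apply/seteqP; split=> p /=; first by move=> H; split; [|split]; exact: H.
  by move=> [? [? ?]] i; case: (ord3P i) => ->.
have reg i : {ae leb3 R, forall p : mpt, exists2 e : R, 0 < e &
    forall q, `|crd i q - crd i p| <= e -> (J i (crd i q) <-> J i (crd i p))}.
  have [_ [a [b H]]] := rJ i.
  apply: aeS (aeI (ae_off_plane i a) (ae_off_plane i b)) => p [pa pb].
  by have [e e0 He] := H _ pa pb; exists e => // q; exact: He.
apply: aeS (aeI (reg ri) (aeI (reg ti) (reg zi))) => p [[e1 p1 H1] [[e2 p2 H2] [e3 p3 H3]]] _.
exists (Num.min e1 (Num.min e2 e3)); first by rewrite !lt_min p1 p2.
move=> q _ Hq; have := Hq ri; have := Hq ti; have := Hq zi.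
rewrite !le_min => /andP[_ /andP[_ q3]] /andP[_ /andP[q2 _]] /andP[q1 _].
have [a1 b1] := H1 _ q1; have [a2 b2] := H2 _ q2; have [a3 b3] := H3 _ q3.
split=> H i; case: (ord3P i) => ->.
- exact/a1/H. - exact/a2/H. - exact/a3/H.
- exact/b1/H. - exact/b2/H. - exact/b3/H.
Qed.

Lemma mollified_measurable (A : set mpt) : measurable A -> mollified (\1_A).
Proof.
have genI : @measurable _ mR = <<s @RGenOpens.G R >> by exact: RGenOpens.measurableE.
have GI : setI_closed (@RGenOpens.G R).
  move=> _ _ [a [b ->]] [c [e ->]]; exists (Num.max a c), (Num.min b e).
  apply/seteqP; split=> x /=; rewrite !in_itv/= lt_min gt_max.
    by move=> [/andP[-> ->] /andP[-> ->]].
  by move=> /andP[/andP[-> ->] /andP[-> ->]].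
have mc i : measurable_fun setT (crd i : mpt -> mR).
  by apply: continuous_measurable3; exact: continuous_crd.
have mp i B : measurable B -> measurable ((crd i : mpt -> mR) @^-1` B).
  by move=> mB; rewrite -[X in measurable X]setTI; exact: mc.
have eqS (X Y : set mpt) : X = Y -> mollified (\1_X) -> mollified (\1_Y) by move=> ->.
have stage1 (J1 J2 J3 : set mR) : regular_set J1 -> regular_set J2 -> regular_set J3 ->
    mollified (\1_((crd ri : mpt -> mR) @^-1` J1 `&` ((crd ti : mpt -> mR) @^-1` J2 `&` (crd zi : mpt -> mR) @^-1` J3))).
  move=> r1 r2 r3.
  apply: eqS (@mollified_box (fun i => if i == ri then J1 else if i == ti then J2 else J3) _).
    apply/seteqP; split=> p /=; first by move=> H; split; [exact: H ri|split; [exact: H ti|exact: H zi]].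
    by move=> [? [? ?]] i; case: (ord3P i) => ->.
  by move=> i; case: (ord3P i) => ->.
have stage2 (A1 J2 J3 : set mR) : measurable A1 -> regular_set J2 -> regular_set J3 ->
    mollified (\1_((crd ri : mpt -> mR) @^-1` A1 `&` ((crd ti : mpt -> mR) @^-1` J2 `&` (crd zi : mpt -> mR) @^-1` J3))).
  move=> m1 r2 r3; apply: (mollified_dynkin (mc ri) _ genI GI) => //.
  - by apply: measurableI; apply: mp; [exact: r2.1|exact: r3.1].
  - apply: eqS (stage1 setT J2 J3 regular_setT r2 r3).
    by rewrite preimage_setT setTI.
  - by move=> _ [a [b ->]]; apply: stage1 => //; exact: regular_itv.
have stage3 (A1 A2 J3 : set mR) : measurable A1 -> measurable A2 -> regular_set J3 ->
    mollified (\1_((crd ti : mpt -> mR) @^-1` A2 `&` ((crd ri : mpt -> mR) @^-1` A1 `&` (crd zi : mpt -> mR) @^-1` J3))).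
  move=> m1 m2 r3; apply: (mollified_dynkin (mc ti) _ genI GI) => //.
  - by apply: measurableI; apply: mp => //; exact: r3.1.
  - apply: eqS (stage2 A1 setT J3 m1 regular_setT r3).
    by rewrite preimage_setT setTI.
  - move=> _ [a [b ->]]; apply: eqS (stage2 A1 _ J3 m1 (regular_itv a b) r3).
    by rewrite setICA.
have stage4 (M : set (mR * mR)%type) (J3 : set mR) : measurable M -> regular_set J3 ->
    mollified (\1_((fst : mpt -> mR * mR) @^-1` M `&` (crd zi : mpt -> mR) @^-1` J3)).
  move=> mM r3; apply: (mollified_dynkin measurable_fst _ (measurable_prod_measurableType mR mR)) => //.
  - by apply: mp; exact: r3.1.
  - move=> _ _ [A1 m1 [A2 m2 <-]] [B1 n1 [B2 n2 <-]].
    exists (A1 `&` B1); first exact: measurableI.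
    by exists (A2 `&` B2); [exact: measurableI|rewrite setXI].
  - apply: eqS (stage1 setT setT J3 regular_setT regular_setT r3).
    by rewrite !preimage_setT !setTI.
  - move=> _ [A1 m1 [A2 m2 <-]]; apply: eqS (stage3 A1 A2 J3 m1 m2 r3).
    by rewrite setICA setIA; congr (_ `&` _).
have stage5 (M : set (mR * mR)%type) (A3 : set mR) : measurable M -> measurable A3 ->
    mollified (\1_((crd zi : mpt -> mR) @^-1` A3 `&` (fst : mpt -> mR * mR) @^-1` M)).
  move=> mM m3; apply: (mollified_dynkin (mc zi) _ genI GI) => //.
  - by rewrite -[X in measurable X]setTI; exact: measurable_fst.
  - apply: eqS (stage4 M setT mM regular_setT).
    by rewrite preimage_setT setIT.
  - by move=> _ [a [b ->]]; rewrite setIC; apply: stage4 => //; exact: regular_itv.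
move=> mA.
have := @mollified_dynkin _ mpt _ id setT (@measurable_id _ _ setT) measurableT
  (measurable_prod_measurableType (mR * mR)%type mR) _ _ _ A mA.
rewrite setIT preimage_id; apply.
- move=> _ _ [A1 m1 [A2 m2 <-]] [B1 n1 [B2 n2 <-]].
  exists (A1 `&` B1); first exact: measurableI.
  by exists (A2 `&` B2); [exact: measurableI|rewrite setXI].
- apply: eqS (stage1 setT setT setT regular_setT regular_setT regular_setT).
  by rewrite !preimage_setT !setTI.
- move=> _ [A1 m1 [A2 m2 <-]]; rewrite setIT preimage_id.
  by apply: eqS (stage5 A1 A2 m1 m2); rewrite setIC.
Qed.

Lemma mollified_sum n (c : 'I_n -> R) (A : 'I_n -> set mpt) : (forall k, measurable (A k)) ->
  mollified (fun p => \sum_(k < n) c k * \1_(A k) p).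
Proof.
elim: n c A => [|n IH] c A mA.
  apply: eq_mollified (mollified_comb h_lt1 0 0 (mollified_measurable measurableT) (mollified_measurable measurableT)) => p _.
  by rewrite big_ord0; ring.
apply: eq_mollified (mollified_comb h_lt1 1 (c ord_max) (IH _ _ (fun k => mA (widen_ord (leqnSn n) k)))
   (mollified_measurable (mA ord_max))) => p _.
by rewrite big_ord_recr /= mul1r.
Qed.

Lemma mollified_ge0 f c : bnd c f -> (forall p, 0 <= f p) -> mollified f.
Proof.
move=> bf f0; have mQ := measurable_shell h L.
have mE : measurable_fun Q (EFin \o f : mpt -> \bar R) by apply/measurable_EFinP; exact: bf.1.
pose s := nnsfun_approx mQ mE.
pose s' n : mpt -> R := s n.
have sf n (p : mpt) : Q p -> s' n p <= f p.
  by move=> Qp; rewrite -lee_fin /s' /s nnsfun_approxE; apply: (@le_approx _ _ _ Q (EFin \o f)) => // q _; rewrite lee_fin.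
have s0 n (p : mpt) : 0 <= s' n p by exact: fun_ge0.
apply: (@mollified_limit _ _ _ h_gt0 h_lt1 L_gt0 s' f f c bf).
- by exists c.
- move=> n; have -> : s' n = _ := funext (fimfunEord (s n)).
  by apply: mollified_sum => k; exact: measurable_sfunP.
- move=> n p Qp; rewrite ger0_norm ?subr_ge0 ?sf// lerBlDr lerDl; exact: s0.
apply: aeW => p Qp.
have H := cvg_nnsfun_approx mQ mE (fun x _ => f0 x) Qp.
rewrite -[X in _ --> X](subrr (f p)); apply: cvgB; first exact: cvg_cst.
exact: (fine_cvg H).
Qed.

(** Boxes are regular sets; by Dynkin the class contains all measurable
    indicators, hence simple functions, hence nonnegative functions by
    dominated convergence. *)
Theorem mollified_L2 f c : bnd c f -> mollified f.
Proof.
move=> bf; have [mf _] := bf.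
have part g : meas g -> (forall p, Q p -> g p ^+ 2 <= 1 * f p ^+ 2) -> (forall p, 0 <= g p) -> mollified g.
  by move=> mg gf g0; apply: mollified_ge0 (bnd_scale h_lt1 mg ler01 gf bf) g0.
have m1 : mollified (fun p => Num.max (f p) 0).
  apply: part => [|p _|p]; first exact: measurable_maxr.
    by rewrite mul1r; case: (leP (f p) 0) => _; rewrite ?expr0n ?sqr_ge0.
  by rewrite le_max lexx orbT.
have m2 : mollified (fun p => Num.max (- f p) 0).
  apply: part => [|p _|p]; first by apply: measurable_maxr => //; exact: measurable_funN.
    by rewrite mul1r; case: (leP (- f p) 0) => _; rewrite ?sqrrN ?expr0n ?sqr_ge0.
  by rewrite le_max lexx orbT.
apply: eq_mollified (mollified_comb h_lt1 1 (-1) m1 m2) => p _.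
by case: (leP (f p) 0) => a; case: (leP (- f p) 0) => b; lra.
Qed.

(** Mollification commutes with weak derivatives up to a factor tending to 1. *)
Theorem W12_approximable u : W12 h L u ->
  approximable h L (fun=> True) u (fun i => weak_partial h L i u).
Proof.
move=> Wu; have [_ /(in_L2_bnd h_lt1)[c bu] Hw] := Wu.
move=> eta e0; pose d := eta / 8; have d0 : 0 < d by rewrite divr_gt0.
have d8 : eta = 8 * d by rewrite mulrC divfK.
clearbody d.
have Iu := bnd_intg h_lt1 bu.
have near i : \forall n \near \oo, bnd eta (fun p => pd i (mo h_gt0 L_gt0 n u) p - weak_partial h L i u p).
  have [b bv] := weak_partial_bnd h_lt1 i Wu.
  have [_ /(_ _ d0) Hv] := mollified_L2 bv.
  have b0 := bnd_ge0 h_lt1 bv.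
  pose e := d / (b + 1); have e'0 : 0 < e by rewrite divr_gt0// ltr_wpDl.
  have eb : e * b <= d.
    by rewrite /e mulrAC ler_pdivrMr ?ltr_wpDl// ler_pM2l// lerDl.
  have e2 : 0 < Num.min e 1 by rewrite lt_min e'0 ltr01.
  have Hm : \forall n \near \oo, 3 * width h L n i < (hi h L i - lo h i) * Num.min e 1.
    by apply: width_small; rewrite mulr_gt0// subr_gt0 lo_lt_hi.
  apply: filterS2 Hv Hm => n Hn Hmu.
  set mu := kmu (mkernel h_gt0 L_gt0 n i).
  have l0 : 0 < hi h L i - lo h i by rewrite subr_gt0 lo_lt_hi.
  have mu1 : 0 <= 1 - mu by rewrite subr_ge0; exact: kmu_le1.
  have mum : 1 - mu <= 2 * Num.min e 1.
    apply: le_trans (kmu_near1 _) _; rewrite ler_pdivrMr//.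
    have w0 := width_gt0 h_gt0 L_gt0 n i.
    by move: (Num.min e 1) Hmu => m Hmu; lra.
  have m1 : Num.min e 1 <= 1 by rewrite ge_min lexx orbT.
  have me : Num.min e 1 <= e by rewrite ge_min lexx.
  have muq : (1 - mu) ^+ 2 <= 2 * e.
    have mu1' : 1 - mu <= 1 by have := kmu_half (mkernel h_gt0 L_gt0 n i); rewrite -/mu; lra.
    apply: le_trans (_ : 1 - mu <= _); first by rewrite expr2 ler_piMl.
    by apply: le_trans mum _; rewrite ler_pM2l.
  have mu2 : mu ^+ 2 <= 1.
    rewrite exprn_ile1 ?kmu_le1//; apply: le_trans (kmu_half _); exact: divr_ge0.
  apply: bndW (_ : 2 * 1 * d + 2 * (2 * e) * b <= _) _.
    rewrite (_ : 2 * 1 * d + 2 * (2 * e) * b = 2 * d + 4 * (e * b)); last by ring.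
    by rewrite d8; lra.
  apply: (bnd_comb h_lt1 _ _ _ _ Hn bv).
  - apply: measurable_funB; last exact: bv.1.
    by apply: continuous_meas; exact: sm_cont (sm_pd i (sm_moll _ Iu)).
  - by [].
  - exact: (mulr_ge0 (ler0n _ 2) (mulr_ge0 (ler0n _ 2) (ltW e'0))).
  move=> p Qp; have Ew := moll_weak_partial (mkernel h_gt0 L_gt0 n) (width_gt0 h_gt0 L_gt0 n) Qp Iu (weak_partial_spec (Hw i)).
  rewrite [X in (X - _) ^+ 2]Ew.
  rewrite -/mu -/(mo h_gt0 L_gt0 n (weak_partial h L i u)).
  move: (mo _ _ _ _ p) (weak_partial h L i u p) => x y.
  have -> : mu * x - y = mu * (x - y) + - (1 - mu) * y by ring.
  apply: le_trans (sqrD_le _ _) _; rewrite !exprMn sqrrN.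
  have A1 := ler_wpM2r (sqr_ge0 (x - y)) mu2; have A2 := ler_wpM2r (sqr_ge0 y) muq.
  move: (mu ^+ 2 * _) ((1 - mu) ^+ 2 * _) A1 A2 => A B A1 A2; rewrite mulr1 -(mulrA 2 (2 * e)).
  by apply: lerD; rewrite ler_pM2l// -[leRHS]mul1r.
have [_ /(_ _ e0) Hu] := mollified_L2 bu.
have [n [[n1 n2] [n3 n4]]] := filter_ex (filterI (filterI Hu (near ri)) (filterI (near ti) (near zi))).
exists (mo h_gt0 L_gt0 n u); split; [exact: sm_moll|exact: I|exact: n1|].
move=> i; case: (ord3P i) => ->; [exact: n2|exact: n3|exact: n4].
Qed.
End Density.

(** * The theorem *)

Section Field.
Context {R : realType}.
Local Notation pt := (R * R * R)%type.
Local Notation mR := (measurableTypeR R).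
Variables (h L : R).
Hypotheses (h_gt0 : 0 < h) (h_lt1 : h < 1) (L_gt0 : 0 < L).
Local Notation Q := (shell h L).
Local Notation bnd := (bnd h L).
Local Notation meas := (meas h L).
Implicit Types (f g F : pt -> R) (p q : pt) (i j : 'I_3) (phi : pt -> 'rV[R]_3).

Lemma bnd0_ae f : bnd 0 f -> {ae leb3 R, forall p : mR * mR * mR, Q p -> f p = 0}.
Proof.
move=> [mf lf]; have mQ := measurable_shell h L.
have e : (\int[leb3 R]_(p in Q) `|(f p ^+ 2 * p.1.1)%:E| = 0)%E.
  apply/eqP; rewrite eq_le integral_ge0// andbT; apply: le_trans lf.
  rewrite (_ : (\int[leb3 R]_(p in Q) `|(f p ^+ 2 * p.1.1)%:E| = sqnorm h L f)%E)//.
  by apply: eq_integral => p; rewrite inE => Qp; rewrite gee0_abs//; exact: (dens_ge0 h_lt1 f Qp).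
have := (ae_eq_integral_abs (leb3 R) mQ (measE_dens mf)).1 e.
apply: aeS => p H Qp; have := H Qp => /= -[/eqP].
have /andP[r1 _] := radius_bounds h_lt1 Qp.
rewrite mulf_eq0 sqrf_eq0 => /orP[/eqP//|/eqP r0].
by move: r1; rewrite r0 leNgt divr_gt0.
Qed.

Lemma bnd_norm f c : bnd c f -> bnd c (fun p => `|f p|).
Proof.
move=> bf; rewrite -[c]mul1r; apply: (bnd_scale h_lt1 _ ler01 _ bf).
  by apply: measurableT_comp bf.1; exact: normr_measurable.
by move=> p _; rewrite mul1r real_normK ?num_real.
Qed.

Lemma sum_sqr_le (a f k c g d : R) :
  a ^+ 2 + (f ^+ 2 + (k ^+ 2 + (2^-1 * c ^+ 2 + (2^-1 * g ^+ 2 + 2^-1 * d ^+ 2)))) <=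
  (`|a| + (`|f| + (`|k| + (`|c| + (`|g| + `|d|))))) ^+ 2.
Proof.
have n (x : R) : x ^+ 2 = `|x| ^+ 2 by rewrite real_normK ?num_real.
have hf (x : R) : 2^-1 * x ^+ 2 <= `|x| ^+ 2 by rewrite -n; have := sqr_ge0 x; lra.
have st (x y z : R) : 0 <= x -> 0 <= y -> z <= y ^+ 2 -> x ^+ 2 + z <= (x + y) ^+ 2.
  by move=> x0 y0 zy; have := mulr_ge0 x0 y0; rewrite sqrrD; lra.
have st' (x y z : R) : 0 <= y -> z <= y ^+ 2 -> 2^-1 * x ^+ 2 + z <= (`|x| + y) ^+ 2.
  by move=> y0 zy; apply: le_trans (lerD (hf x) (lexx z)) (st _ _ _ (normr_ge0 x) y0 zy).
have p1 (x y : R) : 0 <= y -> 0 <= `|x| + y by exact: addr_ge0 (normr_ge0 x).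
rewrite (n a) (n f) (n k).
have g1 := p1 g _ (normr_ge0 d); have g2 := p1 c _ g1; have g3 := p1 k _ g2; have g4 := p1 f _ g3.
apply: (st _ _ _ (normr_ge0 a) g4); apply: (st _ _ _ (normr_ge0 f) g3).
apply: (st _ _ _ (normr_ge0 k) g2); apply: (st' _ _ _ g1); exact: (st' _ _ _ (normr_ge0 d) (hf d)).
Qed.

Lemma square_parts (a f k c g d : R)
    (S := a ^+ 2 + (f ^+ 2 + (k ^+ 2 + (2^-1 * c ^+ 2 + (2^-1 * g ^+ 2 + 2^-1 * d ^+ 2))))) :
  [/\ a ^+ 2 <= 2 * S, k ^+ 2 <= 2 * S, c ^+ 2 <= 2 * S &
    [/\ f ^+ 2 <= 2 * S, g ^+ 2 <= 2 * S & d ^+ 2 <= 2 * S]].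
Proof.
rewrite /S; have := sqr_ge0 a; have := sqr_ge0 k; have := sqr_ge0 c.
have := sqr_ge0 f; have := sqr_ge0 g; have := sqr_ge0 d.
move: (a ^+ 2) (k ^+ 2) (c ^+ 2) (f ^+ 2) (g ^+ 2) (d ^+ 2) => *.
by split; [lra|lra|lra|split; lra].
Qed.

Lemma strain_sum phi p (r := p.1.1) (U := component phi ri) (V := component phi ti)
    (dU := fun i => weak_partial h L i (component phi ri))
    (dV := fun i => weak_partial h L i (component phi ti))
    (dW := fun i => weak_partial h L i (component phi zi)) :
  \sum_i \sum_j cyl_strain h L phi p i j ^+ 2 =
  dU ri p ^+ 2 + (((dV ti p + U p) / r) ^+ 2 + (dW zi p ^+ 2 +
  (2^-1 * (dU zi p + dW ri p) ^+ 2 + (2^-1 * (dV zi p + dW ti p / r) ^+ 2 +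
   2^-1 * ((dU ti p - V p) / r + dV ri p) ^+ 2)))).
Proof.
have e0 : (ord0 : 'I_3) = ri by exact: val_inj.
have e1 : lift ord0 (ord0 : 'I_2) = ti by exact: val_inj.
have e2 : lift ord0 (lift ord0 (ord0 : 'I_1)) = zi by exact: val_inj.
rewrite !big_ord_recl !big_ord0 e2 e1 e0 /cyl_strain /cyl_grad !mxE /=.
rewrite /dU /dV /dW /U /V /component /r.
move: (weak_partial _ _ _ _ _) => a1; move: (weak_partial _ _ _ _ _) => a2.
move: (weak_partial _ _ _ _ _) => a3; move: (weak_partial _ _ _ _ _) => a4.
move: (weak_partial _ _ _ _ _) => a5; move: (weak_partial _ _ _ _ _) => a6.
move: (weak_partial _ _ _ _ _) => a7; move: (weak_partial _ _ _ _ _) => a8.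
move: (weak_partial _ _ _ _ _) => a9; move: (p.1.1)^-1 (phi p 0 ri) (phi p 0 ti) => s u v.
by field.
Qed.

(** The two boundary conditions differ only in which of u and w vanishes at
    both ends. The components that vanish at the ends are approximated with
    boundary values, the remaining one by mollification. *)
Theorem field_korn phi (E := fine (sqnorm_mx h L (cyl_strain h L phi)))
    (K := 64 * korn_const L) : 40 * h <= 1 -> (V1 h L `|` V2 h L) phi ->
  0 <= E /\ [/\ bnd (K / (h * Num.sqrt h) * E) (fun p => cyl_grad h L phi p ri ti),
      bnd (K / Num.sqrt h * E) (weak_partial h L zi (component phi ti)),
      bnd (K / h * E) (weak_partial h L zi (component phi ri)) &
      E = 0 -> forall i, bnd 0 (component phi i)].
Proof.
move=> h40 Hphi.
set U := component phi ri; set V := component phi ti; set W := component phi zi.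
pose dU i := weak_partial h L i U; pose dV i := weak_partial h L i V; pose dW i := weak_partial h L i W.
have WW i : W12 h L (component phi i) by case: Hphi => -[].
have [cU bU] : exists c, bnd c U by have [_ H _] := WW ri; exact: in_L2_bnd.
have [cV bV] : exists c, bnd c V by have [_ H _] := WW ti; exact: in_L2_bnd.
have wp i j : exists c, bnd c (weak_partial h L j (component phi i)).
  exact: (weak_partial_bnd h_lt1 j (WW i)).
have [c1 b1] := wp ri ri; have [c2 b2] := wp ri ti; have [c3 b3] := wp ri zi.
have [c4 b4] := wp ti ri; have [c5 b5] := wp ti ti; have [c6 b6] := wp ti zi.
have [c7 b7] := wp zi ri; have [c8 b8] := wp zi ti; have [c9 b9] := wp zi zi.
pose a p := dU ri p; pose k p := dW zi p; pose c p := dU zi p + dW ri p.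
pose f p := (dV ti p + U p) / p.1.1; pose g p := dV zi p + dW ti p / p.1.1.
pose d p := (dU ti p - V p) / p.1.1 + dV ri p.
have ba : bnd c1 a := b1.
have bk : bnd c9 k := b9.
have bc : bnd (2 * (c3 + c7)) c by exact: (bndD h_lt1 b3 b7).
have bf : bnd (4 * (2 * (c5 + cU))) f by exact: (bnd_div h_lt1 (bndD h_lt1 b5 bU)).
have bg : bnd (2 * (c6 + 4 * c8)) g by exact: (bndD h_lt1 b6 (bnd_div h_lt1 b8)).
have bd : bnd (2 * (4 * (2 * (c2 + cV)) + c4)) d.
  exact: (bndD h_lt1 (bnd_div h_lt1 (bndB h_lt1 b2 bV)) b4).
pose S2 p := a p ^+ 2 + (f p ^+ 2 + (k p ^+ 2 + (2^-1 * c p ^+ 2 + (2^-1 * g p ^+ 2 + 2^-1 * d p ^+ 2)))).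
have S2E p : \sum_i \sum_j cyl_strain h L phi p i j ^+ 2 = S2 p by exact: strain_sum.
have half0 (x : R) : 0 <= 2^-1 * x ^+ 2 by rewrite mulr_ge0 ?sqr_ge0 ?invr_ge0.
have S20 p : 0 <= S2 p by rewrite /S2 !addr_ge0 ?sqr_ge0.
pose S p := Num.sqrt (S2 p).
have SS p : S p ^+ 2 = S2 p by rewrite sqr_sqrtr.
have mS : meas S.
  apply: measurableT_comp; first exact: (continuous_measurable_fun (@sqrt_continuous R)).
  have m2 u b : bnd b u -> meas (fun p => u p ^+ 2) by move=> bu; apply: measurable_funX; exact: bu.1.
  have mh u b : bnd b u -> meas (fun p => 2^-1 * u p ^+ 2).
    by move=> bu; apply: measurable_funM => //; exact: m2 bu.
  apply: measurable_funD; first exact: m2 ba.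
  apply: measurable_funD; first exact: m2 bf.
  apply: measurable_funD; first exact: m2 bk.
  apply: measurable_funD; first exact: mh bc.
  by apply: measurable_funD; [exact: mh bg|exact: mh bd].
have SE : sqnorm_mx h L (cyl_strain h L phi) = sqnorm h L S.
  by apply: eq_integral => p _; rewrite S2E SS.
have [b bS] : exists b, bnd b S.
  have bsum := bndD h_lt1 (bnd_norm ba) (bndD h_lt1 (bnd_norm bf) (bndD h_lt1 (bnd_norm bk)
    (bndD h_lt1 (bnd_norm bc) (bndD h_lt1 (bnd_norm bg) (bnd_norm bd))))).
  eexists; apply: (bnd_scale h_lt1 mS ler01 _ bsum) => p _.
  by rewrite mul1r SS; exact: sum_sqr_le.
have ES : bnd E S.
  split => //; rewrite /E SE fineK// ge0_fin_numE; last exact: sqnorm_ge0.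
  by apply: le_lt_trans bS.2 _; rewrite ltry.
have E0 : 0 <= E := bnd_ge0 h_lt1 ES.
have sub u : (exists c, bnd c u) -> (forall p, u p ^+ 2 <= 2 * S2 p) -> bnd (2 * E) u.
  move=> [c' bu] uS; apply: (bnd_scale h_lt1 bu.1 (ler0n _ 2) _ ES) => p _; rewrite SS; exact: uS.
have parts p : [/\ a p ^+ 2 <= 2 * S2 p, k p ^+ 2 <= 2 * S2 p, c p ^+ 2 <= 2 * S2 p &
    [/\ f p ^+ 2 <= 2 * S2 p, g p ^+ 2 <= 2 * S2 p & d p ^+ 2 <= 2 * S2 p]].
  exact: square_parts.
have Ba : bnd (2 * E) a by apply: sub => [|p]; [exists c1|have [] := parts p].
have Bk : bnd (2 * E) k by apply: sub => [|p]; [exists c9|have [] := parts p].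
have Bc : bnd (2 * E) c by apply: sub => [|p]; [eexists; exact: bc|have [] := parts p].
have Bf : bnd (2 * E) f by apply: sub => [|p]; [eexists; exact: bf|have [_ _ _ []] := parts p].
have Bg : bnd (2 * E) g by apply: sub => [|p]; [eexists; exact: bg|have [_ _ _ []] := parts p].
have Bd : bnd (2 * E) d by apply: sub => [|p]; [eexists; exact: bd|have [_ _ _ []] := parts p].
have z0 : (0 : R) = 0 \/ (0 : R) = L by left.
have zL : L = 0 \/ L = L by right.
have ends i : zero_trace h L 0 (component phi i) -> zero_trace h L L (component phi i) ->
    approximable h L (ends_zero L) (component phi i) (fun j => weak_partial h L j (component phi i)).
  move=> t0 tL; apply: ends_approximable => //.
    exact: (zero_trace_approximable h_lt1 L_gt0 z0 (WW i) t0).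
  exact: (zero_trace_approximable h_lt1 L_gt0 zL (WW i) tL).
have KE (x : R) : 32 * korn_const L / x * (2 * E) = K / x * E by rewrite /K; ring.
have fin : [/\ bnd (32 * korn_const L / (h * Num.sqrt h) * (2 * E)) (fun p => (dU ti p - V p) / p.1.1),
      bnd (32 * korn_const L / Num.sqrt h * (2 * E)) (dV zi),
      bnd (32 * korn_const L / h * (2 * E)) (dU zi) &
      [/\ bnd (32 * korn_const L / h * (2 * E)) U, bnd (32 * korn_const L / h * (2 * E)) V &
          bnd (288 * L ^+ 2 * (2 * E)) W]].
  case: Hphi => [[_ t0 tr tt]|[_ t1 t2 t3 t4]].
    exact: (limit_korn h_gt0 h_lt1 L_gt0 h40 (ends ri (t0 ri) tr) (ends ti (t0 ti) tt)
      (zero_trace_approximable h_lt1 L_gt0 z0 (WW zi) (t0 zi)) (fun w vw => vw)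
      (fun u w zu _ => or_intror zu) Ba Bk Bc Bf Bg Bd).
  exact: (limit_korn h_gt0 h_lt1 L_gt0 h40 (W12_approximable h_gt0 h_lt1 L_gt0 (WW ri)) (ends ti t1 t3)
    (ends zi t2 t4) (fun w zw => zw.1) (fun u w _ zw => or_introl zw) Ba Bk Bc Bf Bg Bd).
have [F1 F2 F3 [F4 F5 F6]] := fin; rewrite !KE in F1 F2 F3.
split; first exact: E0.
split; [by apply: eq_bnd F1 => p; rewrite mxE|exact: F2|exact: F3|].
move=> E00 i; rewrite E00 !mulr0 in F4 F5 F6.
by case: (ord3P i) => ->; [exact: F4|exact: F5|exact: F6].
Qed.
End Field.

Theorem theorem2p3 (R : realType) (L : R) (L_gt0 : 0 < L) :
  exists C h0 : R, 0 < h0 /\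
  forall h : R, 0 < h -> h < 1 -> h < h0 ->
  forall phi : R * R * R -> 'rV[R]_3, (V1 h L `|` V2 h L) phi ->
  nonzero_field h L phi ->
  (* the denominator of the three quotients is nonzero *)
  fine (sqnorm_mx h L (cyl_strain h L phi)) != 0 /\
  [/\ sq_ratio h L (fun p => cyl_grad h L phi p ri ti) (cyl_strain h L phi)
        <= C / (h * Num.sqrt h),
      sq_ratio h L (weak_partial h L zi (component phi ti)) (cyl_strain h L phi)
        <= C / Num.sqrt h &
      sq_ratio h L (weak_partial h L zi (component phi ri)) (cyl_strain h L phi)
        <= C / h].
Proof.
exists (64 * korn_const L), (1 / 40); split; first by rewrite divr_gt0.
move=> h h_gt0 h_lt1 hh0 phi Hphi nz.
have h40 : 40 * h <= 1 by rewrite mulrC -ler_pdivlMr// ltW.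
have [E0 [B1 B2 B3 B0]] := field_korn h_gt0 h_lt1 L_gt0 h40 Hphi.
have En : fine (sqnorm_mx h L (cyl_strain h L phi)) != 0.
  apply/eqP => E00; apply: nz; have z := B0 E00.
  have ae i := bnd0_ae h_lt1 (z i).
  apply: aeS (aeI (ae ri) (aeI (ae ti) (ae zi))) => p [p1 [p2 p3]] Qp.
  apply/rowP => i; rewrite mxE.
  by case: (ord3P i) => ->; [exact: p1|exact: p2|exact: p3].
split => //.
have Egt : 0 < fine (sqnorm_mx h L (cyl_strain h L phi)) by rewrite lt_neqAle eq_sym En.
have ratio c f : bnd h L (c * fine (sqnorm_mx h L (cyl_strain h L phi))) f ->
    sq_ratio h L f (cyl_strain h L phi) <= c.
  move=> [_ lf]; rewrite /sq_ratio ler_pdivrMr// -lee_fin fineK//.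
  rewrite ge0_fin_numE; last exact: sqnorm_ge0.
  by apply: le_lt_trans lf _; rewrite ltry.
by split; exact: ratio.
Qed.
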